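(* Let $(T_t)_{t\in\mathbb{R}}$ be an ergodic special flow on $(X,\mu)$ and let $f:X\to\mathbb{R}$ be a $\mu$-integrable function with zero mean, $\int_X f\,d\mu=0$. Let $A\subset X$ be a measurable set with $\mu(A)>0$. Then for $\mu$-almost all $x\in A$ with $f(x)\neq 0$ there exists a sequence $t_k\to\infty$ such that $\sigma(t_k,x)=0$ and $T_{t_k}x\in A$ for all $k$, where $\sigma(t,x)=\int_0^t f(T_sx)\,ds$.
   Context: Special flow: let $Y\subset\mathbb{R}$ be a measurable set (with Lebesgue measure), $P:Y\to Y$ an automorphism (invertible, measurable, measure-preserving transformation), and $r:Y\to[0,\infty)$ an integrable function. The phase space $X$ is the part of the plane $\mathbb{R}^2$ under the graph of $r$, i.e. $\{(a,b): a\in Y,\ 0\le b\le r(a)\}$ with the points $(a,r(a))$ and $(P(a),0)$ identified; $\mu$ is the two-dimensional Lebesgue measure on $X$ (normalized to be a probability measure). Points move vertically upward with unit speed, $T_t(a,b)=(a,b+t)$, with the boundary identification $(a,r(a))\sim(P(a),0)$. The flow $T_t$ is measurable and preserves $\mu$. Standing assumption: every orbit of the flow has $\mu$-measure zero. The flow is ergodic if every measurable set invariant under all $T_t$ has measure $0$ or full measure. For almost every $x$ the function $s\mapsto f(T_sx)$ is locally integrable, so $\sigma(t,x)$ is defined for all $t$. *)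

(* Defs.v *)
From HB Require Import structures.
From mathcomp Require Import all_boot all_order all_algebra.
From mathcomp Require Import all_classical all_reals all_analysis.

Set Implicit Arguments.
Unset Strict Implicit.
Unset Printing Implicit Defensive.

Import Order.TTheory GRing.Theory Num.Theory.
Import numFieldNormedType.Exports.

Local Open Scope classical_set_scope.
Local Open Scope ring_scope.

(* "Measurable" means Lebesgue (not Borel) measurable throughout: [line R] and
   [plane R] are R and R * R with the sigma-algebras on which the completed
   Lebesgue measures live. *)
Definition line (R : realType) : Type :=
  caratheodory_type (mu_ext (wlength (@idfun R))).
HB.instance Definition _ (R : realType) := Measurable.on (line R).

Definition plane (R : realType) : Type := caratheodory_type
  (mu_ext (@lebesgue_measure R \x @lebesgue_measure R)%E).
HB.instance Definition _ (R : realType) := Measurable.on (plane R).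

Definition lebesgue1 (R : realType) : {measure set (line R) -> \bar R} :=
  @completed_lebesgue_measure R.

Definition lebesgue2 (R : realType) : {measure set (plane R) -> \bar R} :=
  @completed_measure_extension _ _ R
    (@lebesgue_measure R \x @lebesgue_measure R)%E.

Section special_flow.
Context {R : realType}.
Implicit Types (Y : set (line R)) (P : line R -> line R) (r : line R -> R).

(* [P] is only looked at on [Y]. The third clause is the measurability of the
   inverse of [P]. *)
Definition automorphism Y P : Prop :=
  [/\ set_bij Y Y P,
      measurable_fun Y P,
      forall B, B `<=` Y -> measurable B -> measurable (P @` B) &
      forall B, B `<=` Y -> measurable B ->
        lebesgue1 R (Y `&` P @^-1` B) = lebesgue1 R B].

(* The half-open region under the graph of [r] has exactly one point in each
   class of the identification (a, r a) ~ (P a, 0), except for the classes of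
   the points (a, 0) with r = 0 along the whole forward P-orbit of a, from which
   no motion is possible; these classes lie in the null set formed by R x {0}
   and the graph of r. *)
Definition phase_space Y r : set (plane R) :=
  [set x | Y x.1 /\ 0 <= x.2 < r x.1].

(* [y] is the point reached from [x] by moving up for a time t >= 0, with [n]
   passages from the graph of [r] back to the base. *)
Definition moves_up Y P r (t : R) (x y : plane R) : Prop :=
  phase_space Y r y /\
  exists n : nat,
    y = (iter n P x.1, x.2 + t - \sum_(k < n) r (iter k P x.1)).

(* For t < 0, T_t is the inverse of T_(-t). *)
Definition flow_rel Y P r (t : R) (x y : plane R) : Prop :=
  if 0 <= t then moves_up Y P r t x y
  else phase_space Y r y /\ moves_up Y P r (- t) y x.

(* For x in the phase space there is at most one [y] with [flow_rel t x y]; the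
   convention T_t x = x is used when there is none, which happens when the sums
   of [r] along the forward or backward P-orbit of x.1 stay bounded. *)
Definition flow Y P r (t : R) (x : plane R) : plane R :=
  xget x [set y | flow_rel Y P r t x y].

(* The last clause says that (T_t) is indeed a flow: T_t is defined for all real
   times at almost every point. By recurrence it holds automatically when [Y]
   has finite measure, but not in general: take P = (+%R 1) on the real line. *)
Definition special_flow Y P r : Prop :=
  [/\ measurable Y,
      automorphism Y P,
      forall a, Y a -> 0 <= r a,
      (lebesgue1 R).-integrable Y (EFin \o r) &
      {ae lebesgue2 R, forall x, phase_space Y r x ->
        forall t, exists y, flow_rel Y P r t x y}].

(* If the phase space has area 0 no probability measure satisfies this. *)
Definition normalized_area Y r (mu : probability (plane R) R) : Prop :=
  forall B, measurable B ->
    mu B = (lebesgue2 R (phase_space Y r `&` B) *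
            (fine (lebesgue2 R (phase_space Y r)))^-1%:E)%E.

Definition null_orbits Y P r (mu : probability (plane R) R) : Prop :=
  forall x, phase_space Y r x ->
    mu.-negligible (range (fun t : R => flow Y P r t x)).

Definition ergodic Y P r (mu : probability (plane R) R) : Prop :=
  forall B, B `<=` phase_space Y r -> measurable B ->
    (forall t : R, phase_space Y r `&` flow Y P r t @^-1` B = B) ->
    mu B = 0%E \/ mu B = 1%E.

Definition sigma Y P r (f : plane R -> R) (t : R) (x : plane R) : R :=
  if 0 <= t then \int[lebesgue1 R]_(s in `[0, t]) f (flow Y P r s x)
  else - \int[lebesgue1 R]_(s in `[t, 0]) f (flow Y P r s x).

End special_flow.

(* Main.v *)
Require Import Defs.
From mathcomp Require Import all_boot all_order all_algebra.
From mathcomp Require Import all_classical all_reals all_analysis.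
From mathcomp Require Import measurable_realfun.
From mathcomp Require Import ring lra.

Set Implicit Arguments.
Unset Strict Implicit.
Unset Printing Implicit Defensive.

Import Order.TTheory GRing.Theory Num.Theory.
Import numFieldNormedType.Exports.

Local Open Scope classical_set_scope.
Local Open Scope ring_scope.

(** Let g x t be the integral of f along the orbit of x up to time t. By the
    ergodic theorem g x t = o(t) almost everywhere. Suppose that f > 0 on a set K
    of positive measure none of whose points x returns to K at a time t >= n with
    g x t = 0. Then along an orbit g takes different values at any two visits to K
    that are at least n apart, so the values taken at the visits during the windows
    [2nj, 2nj + d], j < J, with d <= 1, form disjoint subsets of an interval of
    length o(J). If K is closed along the orbits, the values of the j-th window
    have measure at least the integral of q = f - |f| 1_(~ K) over that window: an
    open set U containing them may be removed from the line, and outside U only the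
    variation of g off K counts. Averaging over j, the positive part of the
    integral of q over [0, d] vanishes almost everywhere, for every d; hence q <= 0
    almost everywhere, whereas q = f > 0 on K. The case f < 0 is symmetric, and
    general sets are exhausted from inside by sets closed along the orbits. *)

(** * Images of closed sets under primitives *)

(** The windows have to be short: over a long one the integral of [q] may be negative although K is
    visited. With d = 1 / (i + 1) and starting points shifted by multiples of d, the windows become
    the cells of a grid, and Lebesgue differentiation yields q <= 0 at almost every time of almost
    every orbit. The period 2n leaves a pause of at least 2n - 1 >= n after each window, so equal
    values of g at times s < t of two windows would be a forbidden return of the point reached at
    time s. Ergodicity enters through the sublinear growth of g alone; what follows needs an
    invariant probability measure. The argument is therefore run for an abstract semiflow, with
    nonnegative times, in which measurable sets can be approximated from inside by sets closed along
    the orbits. In a special flow P is merely measurable, so closedness is asked along the vertical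
    fibres only. Sets and functions measurable for the completed measure of the plane are first
    replaced, off a null set, by versions for the product of the Lebesgue sets of the base with the
    Borel sets of the fibre. *)

Lemma itv_local_global (R : realType) (Q : R -> R -> Prop) (a b : R) :
  a <= b ->
  (forall s t u, a <= s -> s <= t -> t <= u -> u <= b ->
    Q s t -> Q t u -> Q s u) ->
  (forall x, a <= x <= b -> exists2 e : R, 0 < e &
    forall s t, a <= s -> s <= t -> t <= b -> x - e < s -> t < x + e -> Q s t) ->
  Q a b.
Proof.
move=> ab Qtrans Qloc.
(* Real induction in place of a finite subcover: from a point of [S] close to its supremum [c], one
   step leads to [c + e / 2], beyond the supremum, unless [b] comes first. *)
pose S := [set t | a <= t <= b /\ Q a t].
have Sa : S a.
  split; first by rewrite lexx.
  have [|e e0 H] := Qloc a; first by rewrite lexx.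
  by apply: H => //; lra.
have Sub : ubound S b by move=> t [/andP[]].
have Ssup : has_sup S by split; [exists a | exists b].
set c := sup S.
have ac : a <= c by apply: ub_le_sup => //; exists b.
have cb : c <= b by apply: ge_sup => //; exists a.
have [|e e0 H] := Qloc c; first by rewrite ac cb.
have [s [/andP[sa sb] Qas] cs] := sup_adherent e0 Ssup.
have sc : s <= c by apply: ub_le_sup; [exists b|split => //; rewrite sa].
pose t := Num.min b (c + e / 2).
have ct : c <= t by rewrite /t le_min cb; lra.
have tb : t <= b by rewrite /t ge_min lexx.
have te : t <= c + e / 2 by rewrite /t ge_min lexx orbT.
have Qat : Q a t.
  apply: (Qtrans _ s) => //; first by rewrite (le_trans sc).
  by apply: H => //; [exact: le_trans sc ct|lra].
have tc : t <= c.
  by apply: ub_le_sup; [exists b|split => //; rewrite tb (le_trans ac)].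
have tE : t = b.
  by move: tc te ct; rewrite /t; case: (leP b (c + e / 2)) => //; lra.
by rewrite -tE.
Qed.

Lemma within_continuous_dist (R : realType) (A : set R) (g : R -> R) x d :
  {within A, continuous g} -> A x -> 0 < d ->
  exists2 e : R, 0 < e & forall y, A y -> `|y - x| < e -> `|g y - g x| < d.
Proof.
move=> /subspace_continuousP/(_ x) + Ax d0 => /(_ Ax)/cvgrPdist_lt/(_ _ d0).
move=> /nbhs_ballP[e e0 H]; exists e => // y Ay yx.
by rewrite distrC; apply: H => //; rewrite /ball/= distrC.
Qed.

Section image_of_closed.
Context {R : realType}.
Notation mu := (@lebesgue_measure R).

Lemma measurable_open_setD (y z : R) (U : set R) : open U ->
  measurable (`]y, z] `\` U : set (measurableTypeR R)).
Proof. by move=> oU; apply: measurableD => //; exact: open_measurable. Qed.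

Lemma lebesgue_itvD_fin (y z : R) (U : set R) : open U ->
  (mu (`]y, z] `\` U) \is a fin_num)%E.
Proof.
move=> oU; rewrite ge0_fin_numE//.
apply: (@le_lt_trans _ _ (mu `]y, z])).
  by apply: le_measure; rewrite ?inE//; exact: measurable_open_setD.
by rewrite lebesgue_measure_itv/=; case: ifP; rewrite ltry.
Qed.

Lemma lebesgue_itvD_split (x y z : R) (U : set R) : open U ->
  x <= y -> y <= z ->
  fine (mu (`]x, z] `\` U)) =
  fine (mu (`]x, y] `\` U)) + fine (mu (`]y, z] `\` U)).
Proof.
move=> oU xy yz; rewrite -fineD ?lebesgue_itvD_fin// -measureU//=.
- congr (fine (mu _)); rewrite -setDUl; congr (_ `\` _).
  by apply: itv_bndbnd_setU; rewrite bnd_simp.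
- exact: measurable_open_setD.
- exact: measurable_open_setD.
- rewrite -subset0 => w /= [[+ _] [+ _]].
  by rewrite !in_itv/= => /andP[_ wy]; rewrite ltNge wy.
Qed.

Lemma lebesgue_itvD_le (y z : R) (U : set R) : open U -> y <= z ->
  fine (mu (`]y, z] `\` U)) <= z - y.
Proof.
move=> oU yz; rewrite -lee_fin fineK ?lebesgue_itvD_fin//.
apply: (@le_trans _ _ (mu `]y, z])).
  by apply: le_measure; rewrite ?inE//; exact: measurable_open_setD.
rewrite lebesgue_measure_itv/= lte_fin; case: ifP => //.
by rewrite lee_fin subr_ge0.
Qed.

Variables (phi g : R -> R) (a b : R) (W : set R).
Hypotheses (ab : a <= b) (iphi : mu.-integrable `[a, b] (EFin \o phi)).
Hypothesis gphi : forall s t, a <= s -> s <= t -> t <= b ->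
  g t - g s = \int[mu]_(u in `[s, t]) phi u.
Hypothesis Wclosed : forall t, a <= t <= b -> ~ W t ->
  exists2 e : R, 0 < e & forall s, a <= s <= b -> `|s - t| < e -> ~ W s.

Lemma closed_itv_trace : closed (W `&` `[a, b]).
Proof.
rewrite -[X in closed X]setCK; apply: open_closedC.
rewrite openE => t nWt; apply/nbhs_ballP.
have [tab|tab] := boolP (a <= t <= b).
  have {}nWt : ~ W t by move=> Wt; apply: nWt; split => //=; rewrite in_itv.
  have [e e0 H] := Wclosed tab nWt.
  exists e => //= s; rewrite /ball /= distrC => ts [Ws].
  by rewrite /= in_itv/= => sab; exact: (H _ sab ts).
have : open (~` `[a, b]%classic) by apply: closed_openC; exact: itv_closed.
rewrite openE => /(_ t) /(_ _)/nbhs_ballP[|e e0 H].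
  by rewrite /= in_itv/=; exact/negP.
by exists e => // s /H ns [_ ?]; exact: ns.
Qed.

Lemma primitive_continuous : {within `[a, b], continuous g}.
Proof.
have [->|anb] := eqVneq a b.
  by rewrite set_itv1; exact: continuous_subspace1.
have altb : a < b by rewrite lt_neqAle anb.
have hc := parameterized_integral_continuous ab iphi.
apply: (@subspace_eq_continuous _ _ _
    (cst (g a) + (fun x => parameterized_integral mu a x phi))).
  move=> x; rewrite inE /= in_itv/= => /andP[ax xb].
  rewrite /from_subspace /= fctE /parameterized_integral -gphi//.
  by rewrite addrC subrK.
apply: within_continuousD hc; apply: continuous_subspaceT => x.
exact: cst_continuous.
Qed.

Lemma compact_image_trace : compact (g @` (W `&` `[a, b])).
Proof.
apply: continuous_compact.
  by apply: continuous_subspaceW primitive_continuous; exact: subIsetr.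
apply: subclosed_compact (@segment_compact _ a b) _; last exact: subIsetr.
exact: closed_itv_trace.
Qed.

Lemma measurable_trace : measurable (W `&` `[a, b] : set (measurableTypeR R)).
Proof. by apply: closed_measurable; exact: closed_itv_trace. Qed.

(** Half-open, so that adjacent pieces are disjoint and their integrals add up. *)
Let Z s t := `]s, t] `\` (W `&` `[a, b]).

Let mZ s t : measurable (Z s t : set (measurableTypeR R)).
Proof. by apply: measurableD => //; exact: measurable_trace. Qed.

Let iphiS s t (A : set R) : a <= s -> t <= b ->
  measurable (A : set (measurableTypeR R)) -> A `<=` `]s, t] ->
  mu.-integrable A (EFin \o (fun u => `|phi u|)).
Proof.
move=> sa tb mA Ast; apply: (integrableS _ mA); last exact: integrable_norm iphi.
  by [].
move=> u /Ast; rewrite /= !in_itv/= => /andP[su ut].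
by rewrite (le_trans sa (ltW su)) (le_trans ut tb).
Qed.

(** [Theta] is a primitive of the indicator of the complement of [U], hence 1-Lipschitz and constant
    on intervals contained in [U]. The base point [m] stays below both arguments because an interval
    with reversed ends is empty. *)
Let Theta_variation (m y z : R) (U : set R) : open U -> m <= y -> m <= z ->
  let Theta y := fine (mu (`]m, y] `\` U)) in
  `|Theta z - Theta y| <= `|z - y| /\
  ((forall w, Num.min y z <= w -> w <= Num.max y z -> U w) -> Theta z = Theta y).
Proof.
move=> oU my mz; wlog yz : y z my mz / y <= z.
  move=> H; have /orP[yz|zy] := le_total y z; first exact: (H y z).
  have /= [H1 H2] := H _ _ mz my zy; rewrite distrC (distrC z); split => // H3.
  by apply/esym/H2; rewrite minC maxC.
rewrite /= (lebesgue_itvD_split oU my yz) (min_idPl yz) (max_idPr yz) addrAC subrr add0r; split.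
  rewrite ger0_norm ?fine_ge0// ger0_norm ?subr_ge0//.
  exact: lebesgue_itvD_le.
move=> H; have -> : `]y, z] `\` U = set0.
  rewrite -subset0 => w [/=]; rewrite in_itv/= => /andP[yw wz]; apply.
  by apply: H => //; exact: ltW.
by rewrite measure0 addr0.
Qed.

(** An open [U] slightly larger than the image covers []g a, g b]] except for a part of measure
    [Theta (g b) - Theta (g a)]. This part can be swept only at times off [W], so it costs at most
    the integral of [|phi|] over those times. *)
Lemma image_trace_lower_bound :
  ((\int[mu]_(u in `[a, b]) phi u - \int[mu]_(u in `[a, b] `\` W) `|phi u|)%:E <=
   mu (g @` (W `&` `[a, b])))%E.
Proof.
set C := g @` _.
have mC : measurable (C : set (measurableTypeR R)).
  exact: measurable_realfun.compact_measurable compact_image_trace.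
have [->|Coo] := eqVneq (mu C) +oo%E; first exact: leey.
apply/lee_addgt0Pr => e e0.
have Cfin : (mu C < +oo)%E by rewrite lt_neqAle Coo leey.
have [U [oU CU UCe]] := lebesgue_regularity_outer mC Cfin e0.
have mU : measurable (U : set (measurableTypeR R)).
  exact: measurable_realfun.open_measurable.
have Ule : (mu U <= mu C + e%:E)%E.
  have OE : U = C `|` (U `\` C) by rewrite setDUK.
  rewrite [X in mu X]OE; apply: (le_trans (measureU2 _ _ _)) => //=.
    exact: measurableD.
  by rewrite leeD2l// ltW.
apply: le_trans Ule.
(* The minimum of [g] is the base point of [Theta], so that every value [g t] lies to the right of
   it. *)
have [c cab cmin] := EVT_min ab primitive_continuous.
(* t |-> Theta (g t) is constant near each point of W, since g maps it into the
   open set U, and elsewhere it varies at most as g does. *)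
pose Theta y := fine (mu (`]g c, y] `\` U)).
have gc t : a <= t <= b -> g c <= g t by move=> tab; apply: cmin; rewrite in_itv.
have key : `|Theta (g b) - Theta (g a)| <= \int[mu]_(u in Z a b) `|phi u|.
  apply: (itv_local_global (Q := fun s t =>
    `|Theta (g t) - Theta (g s)| <= \int[mu]_(u in Z s t) `|phi u|)) => //.
  - move=> s t u sa st tu ub Qst Qtu.
    have -> : Z s u = Z s t `|` Z t u.
      by rewrite /Z -setDUl; congr (_ `\` _);
        apply: itv_bndbnd_setU; rewrite bnd_simp.
    rewrite Rintegral_setU//; last 2 first.
    + apply: (@iphiS s u) => //; first exact: measurableU.
      move=> x [|] [] /=; rewrite !in_itv/= => /andP[sx xt] _.
        by rewrite sx (le_trans xt).
      by rewrite xt (le_lt_trans st).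
    + apply/disj_setPS => x [[+ _] [+ _]].
      by rewrite /= !in_itv/= => /andP[_ xt]; rewrite ltNge xt.
    rewrite -(subrKA (Theta (g t))) (le_trans (ler_normD _ _))//.
    by rewrite addrC lerD.
  - move=> x xab; have [Wx|nWx] := pselect (W x).
      have Ugx : U (g x) by apply: CU; exists x => //; split => //=; rewrite in_itv.
      have : nbhs (g x) U by apply: open_nbhs_nbhs.
      move=> /nbhs_ballP[d /= d0 dU].
      have xI : `[a, b]%classic x by rewrite /= in_itv.
      have [r r0 H] := within_continuous_dist primitive_continuous xI d0.
      exists r => // s t sa st tb sx tx.
      have Igs w : s <= w <= t -> `|g w - g x| < d.
        move=> /andP[sw wt]; apply: H; last by rewrite ltr_distl; lra.
        by rewrite /= in_itv/=; lra.
      have gcs : g c <= g s by apply: gc; lra.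
      have gct : g c <= g t by apply: gc; lra.
      have /= [_ TE] := Theta_variation oU gcs gct.
      rewrite /Theta TE; first by rewrite subrr normr0; apply: Rintegral_ge0.
      move=> w w1 w2; apply: dU; rewrite /ball/= distrC.
      have := Igs s; have := Igs t; rewrite st !lexx/= => /(_ isT) A1 /(_ isT) A2.
      move: A1 A2 w1 w2; rewrite !ltr_distl ge_min le_max.
      by move=> /andP[? ?] /andP[? ?] /orP[] ? /orP[] ?; lra.
    have [r r0 H] := Wclosed xab nWx.
    exists r => // s t sa st tb sx tx.
    have gcs : g c <= g s by apply: gc; lra.
    have gct : g c <= g t by apply: gc; lra.
    have [Tg _] := Theta_variation oU gcs gct.
    apply: (le_trans Tg); rewrite gphi//.
    have istI : mu.-integrable `[s, t] (EFin \o phi).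
      apply: integrableS iphi => // w; rewrite /= !in_itv/= => /andP[sw wt].
      by rewrite (le_trans sa sw) (le_trans wt tb).
    apply: (le_trans (le_normr_Rintegral _ istI)) => //.
    rewrite -Rintegral_itv_obnd_cbnd; last first.
      by apply: iphiS sa tb _ _ => //; exact: subset_refl.
    suff -> : Z s t = `]s, t]%classic by [].
    apply/seteqP; split => [w []//|w stw]; split => // -[Ww].
    move: stw; rewrite /= !in_itv/= => /andP[sw wt] wab.
    by apply: (H w) => //; rewrite ltr_distl; lra.
have [gba|gab] := ltP (g b) (g a).
  apply: (@le_trans _ _ 0%:E) => //; rewrite lee_fin -gphi//.
  have : 0 <= \int[mu]_(u in `[a, b] `\` W) `|phi u| by apply: Rintegral_ge0.
  lra.
have gca : g c <= g a by apply: gc; rewrite lexx.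
have ThE : Theta (g b) - Theta (g a) = fine (mu (`]g a, g b] `\` U)).
  by rewrite /Theta (lebesgue_itvD_split oU gca gab) addrAC subrr add0r.
(* The two domains differ at most by the point [a]. *)
have ZE : \int[mu]_(u in Z a b) `|phi u| = \int[mu]_(u in `[a, b] `\` W) `|phi u|.
  have psiI A : measurable (A : set (measurableTypeR R)) -> A `<=` `[a, b] ->
      mu.-integrable A (EFin \o (fun u => `|phi u|)).
    move=> mA Aab; apply: (integrableS _ mA Aab) => //.
    exact: integrable_norm iphi.
  have mW := measurable_trace.
  have mD : measurable (`[a, b] `\` W : set (measurableTypeR R)).
    suff -> : `[a, b] `\` W = `[a, b] `\` (W `&` `[a, b]) by exact: measurableD.
    apply/seteqP; split => w [wI nW]; split => //; first by move=> [].
    by move=> Ww; apply: nW.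
  rewrite Rintegral_mkcond [RHS]Rintegral_mkcond.
  congr fine; apply: ae_eq_integral => //.
  - apply/measurable_EFinP/(measurable_restrictT _ _).1 => //.
    apply/measurable_EFinP; apply: (measurable_int mu); apply: psiI => // w [] /=.
    by rewrite !in_itv/= => /andP[/ltW -> ->].
  - apply/measurable_EFinP/(measurable_restrictT _ _).1 => //.
    by apply/measurable_EFinP; apply: (measurable_int mu); apply: psiI => // w [].
  exists [set a].
  split; [exact: measurable_set1|exact: lebesgue_measure_set1|].
  move=> w /= nH; apply: contrapT => wa; apply: nH => _.
  rewrite !patchE.
  have -> // : (w \in Z a b) = (w \in `[a, b] `\` W).
  apply/idP/idP => /set_mem[+ wN]; rewrite /= in_itv/= => /andP[aw wb];
    apply/mem_set; split; rewrite /= ?in_itv/= ?wb ?andbT.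
  - exact: ltW.
  - by move=> Ww; apply: wN; split => //=; rewrite in_itv/= wb ltW.
  - by rewrite lt_neqAle aw andbT; apply/eqP => aw'; apply: wa.
  - by move=> [].
rewrite -gphi//.
have : (mu `]g a, g b] <= mu (`]g a, g b] `\` U) + mu U)%E.
  apply: le_trans (measureU2 _ _ _); last 2 first.
  - exact: measurable_open_setD.
  - exact: mU.
  apply: le_measure; rewrite ?inE//.
    by apply: measurableU => //; exact: measurable_open_setD.
  by move=> w ?; have [|] := pselect (U w); [right|left].
rewrite lebesgue_measure_itv/= lte_fin.
move: key; rewrite ThE ZE ger0_norm ?fine_ge0// => key.
have -> : (if (g a < g b)%R then (g b)%:E - (g a)%:E else 0)%E = (g b - g a)%:E.
  by case: ltP => // ?; congr EFin; lra.
move=> H.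
rewrite EFinB leeBlDr//; apply: (le_trans H).
by rewrite addeC leeD2l// -[leLHS]fineK ?lebesgue_itvD_fin// lee_fin.
Qed.

End image_of_closed.

(** * Change of variables under measure-preserving maps *)

Section measure_preserving.
Context d1 d2 (X : measurableType d1) (Y : measurableType d2) (R : realType).
Variables (mu : {measure set X -> \bar R}) (nu : {measure set Y -> \bar R}).
Variable phi : X -> Y.
Hypotheses (mphi : measurable_fun setT phi)
  (phi_mp : forall A, measurable A -> mu (phi @^-1` A) = nu A).
Implicit Types (D : set Y) (f : Y -> \bar R).

Lemma mp_ge0_integral D f : measurable D -> measurable_fun D f ->
  {in D, forall y, 0 <= f y}%E ->
  (\int[mu]_(x in phi @^-1` D) f (phi x) = \int[nu]_(y in D) f y)%E.
Proof.
move=> mD mf f0; rewrite -[LHS](ge0_integral_pushforward mphi mu mD mf f0).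
by apply: eq_measure_integral => A mA _; rewrite /= /pushforward phi_mp.
Qed.

Lemma mp_integral D f : measurable D -> measurable_fun D f ->
  (\int[mu]_(x in phi @^-1` D) f (phi x) = \int[nu]_(y in D) f y)%E.
Proof.
move=> mD mf; rewrite integralE [RHS]integralE.
rewrite -(mp_ge0_integral mD (measurable_funepos mf)); last first.
  by move=> y _; exact: funepos_ge0.
rewrite -(mp_ge0_integral mD (measurable_funeneg mf)); last first.
  by move=> y _; exact: funeneg_ge0.
by congr (_ - _)%E; apply: eq_integral => x _; rewrite !unlock.
Qed.

Lemma mp_integrable D f : measurable D -> nu.-integrable D f ->
  mu.-integrable (phi @^-1` D) (f \o phi).
Proof.
move=> mD /integrableP[mf fi]; apply/integrableP; split.
  apply: (measurable_comp mD _ mf); first by move=> _ [x ? <-].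
  exact: measurable_funTS.
rewrite (mp_ge0_integral (f := fun y => `|f y|%E))//.
exact: measurableT_comp.
Qed.

End measure_preserving.

Section translation.
Context {R : realType}.
Notation mu := (@lebesgue_measure R).

Lemma measurable_translation (c : R) :
  measurable_fun setT ((fun x => c + x) : measurableTypeR R -> measurableTypeR R).
Proof. exact: measurable_funD. Qed.

Lemma lebesgue_translation (c : R) (A : set R) : measurable A ->
  mu ((fun x => c + x) @^-1` A) = mu A.
Proof.
move=> mA; apply/esym.
apply: (@lebesgue_measure_unique R (pushforward mu
  (fun x => c + x : measurableTypeR R))) => //=.
  exact: measurable_translation.
move=> mt _ [[a b]] _ <-; rewrite /pushforward/=.
have -> : (fun x => c + x) @^-1` `]a, b] = `]a - c, b - c]%classic.
  by apply/seteqP; split => x /=; rewrite !in_itv/= lerBrDl ltrBlDl.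
rewrite !lebesgue_measure_itv/= !lte_fin ltrD2r; case: ifP => // _.
by rewrite -!EFinB opprB addrA subrK.
Qed.

Let itv_translation (c a b : R) :
  `[a, b]%classic = (fun x => c + x) @^-1` `[c + a, c + b].
Proof. by apply/seteqP; split => x /=; rewrite !in_itv/= !lerD2l. Qed.

Lemma integral_translation (c a b : R) (f : R -> \bar R) :
  measurable_fun `[c + a, c + b] f ->
  (\int[mu]_(x in `[a, b]) f (c + x)%R =
   \int[mu]_(x in `[(c + a)%R, (c + b)%R]) f x)%E.
Proof.
move=> mf; rewrite (itv_translation c).
exact: (mp_integral (measurable_translation c) (@lebesgue_translation c)).
Qed.

End translation.

(** * Lebesgue differentiation along a grid *)

Section nonpositive_averages.
Context {R : realType}.
Notation mu := (@lebesgue_measure R).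

(** Grid cells rather than balls around [x]: the averages to be controlled are then countably
    many. *)
Let cell (x : R) (n : nat) : set R :=
  `[(Num.floor (x * n.+1%:R))%:~R / n.+1%:R,
    ((Num.floor (x * n.+1%:R))%:~R + 1) / n.+1%:R].

Let cell_itv (x : R) (n : nat) : cell x n x.
Proof.
rewrite /cell /= in_itv/= ler_pdivrMr// ler_pdivlMr//.
by rewrite floor_le ltW// -intrD1 floorD1_gt.
Qed.

Let cell_nice (x : R) : nicely_shrinking x (cell x).
Proof.
split=> [n|]; first exact: measurable_itv.
have pos n : 0 < 2 / n.+1%:R :> R by rewrite divr_gt0.
(* The ball of radius 2 / (n + 1) around [x] contains the cell, and its length 4 / (n + 1) is four
   times that of the cell. *)
exists (4, fun n => PosNum (pos n)); split => //=.
- rewrite -(mulr0 2); apply: cvgMr.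
  exact: cvg_harmonic.
- move=> n y; have := cell_itv x n; rewrite /cell /ball /= !in_itv/=.
  have : 0 < n.+1%:R :> R by [].
  move: (n.+1%:R : R) (_%:~R : R) => N f N0.
  rewrite !ler_pdivrMr// !ler_pdivlMr// => /andP[x1 x2] /andP[y1 y2].
  rewrite ltr_pdivlMr// -{1}(gtr0_norm N0) -normrM mulrBl ltr_norml.
  by apply/andP; split; lra.
- move=> n; rewrite lebesgue_measure_ball; last exact: ltW.
  rewrite lebesgue_measure_itv/= lte_fin ltr_pM2r ?invr_gt0// ltrDl ltr01.
  rewrite -EFinB -EFinM lee_fin -mulrBl addrAC subrr add0r mul1r mulr2n.
  by move: (n.+1%:R^-1 : R) => N; lra.
Qed.

(** Almost everywhere [f] is the limit of its averages over the cells. The hypothesis consists of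
    countably many inequalities, so for the functions read along the orbits it can be secured
    outside a single null set of starting points. *)
Lemma ae_le0_averages (f : R -> R) :
  mu.-integrable `[0, 1] (EFin \o f) ->
  (forall n k, (k < n.+1)%N ->
    \int[mu]_(u in `[k%:R / n.+1%:R, (k%:R + 1) / n.+1%:R]) f u <= 0) ->
  {ae mu, forall u, 0 < u < 1 -> f u <= 0}.
Proof.
move=> fi H.
have fl : locally_integrable setT (f \_ `[0, 1]) by exact: integrable_locally.
have := lebesgue_differentiation fl.
apply: filterS; first exact: (ae_filter_ringOfSetsType mu).
move=> x fx /andP[x0 x1].
have := nice_lebesgue_differentiation cell_nice fl fx.
rewrite patchE mem_set/=; last by rewrite in_itv/= !ltW.
move=> fc; rewrite -lee_fin; apply: cvge_to_le fc _.
apply: nearW => n.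
pose k := `|Num.floor (x * n.+1%:R)|%N.
have kE : (Num.floor (x * n.+1%:R))%:~R = k%:R :> R.
  by rewrite /k natr_absz ger0_norm// floor_ge0 mulr_ge0// ltW.
have kn : (k < n.+1)%N.
  rewrite -(@ltr_nat R) -kE; apply: le_lt_trans (floor_le _) _.
  by rewrite gtr_pMl.
have cE : cell x n = `[k%:R / n.+1%:R, (k%:R + 1) / n.+1%:R]%classic.
  by rewrite /cell kE.
have c01 : cell x n `<=` `[0, 1].
  move=> y; rewrite cE /= !in_itv/= => /andP[y1 y2]; apply/andP; split.
    by apply: le_trans y1; rewrite divr_ge0.
  by apply: (le_trans y2); rewrite ler_pdivrMr// mul1r natr1 ler_nat.
have mc : measurable (cell x n) by exact: (cell_nice x).1.
have cfin := nicely_shrinking_fin_num (cell_nice x) n.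
have c0 := nicely_shrinking_gt0 (cell_nice x) n.
have fic : mu.-integrable (cell x n) (EFin \o f) by apply: integrableS fi.
have -> : (\int[mu]_(y in cell x n) ((f \_ `[0, 1]) y)%:E =
    (\int[mu]_(y in cell x n) f y)%:E)%E.
  rewrite fineK ?integrable_fin_num//; apply: eq_integral => y /set_mem cy.
  by rewrite patchE mem_set//; exact: c01.
have [m mE] : exists m : R, mu (cell x n) = m%:E by exists (fine (mu (cell x n))); rewrite fineK.
have m0 : 0 < m by rewrite -lte_fin -mE.
rewrite mE inver gt_eqF// -EFinM lee_fin pmulr_rle0 ?invr_gt0//.
by rewrite cE; exact: H.
Qed.

End nonpositive_averages.

(** * Integrals along the orbits of a semiflow *)

Section semiflow_averages.
Context d (T : measurableType d) (R : realType) (m : probability T R).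
Variable Phi : R -> T -> T.
Notation mu := (@lebesgue_measure R).
Hypotheses (Phi0 : forall x, Phi 0 x = x)
  (PhiD : forall (s t : R) x, 0 <= s -> 0 <= t -> Phi (s + t) x = Phi s (Phi t x))
  (mPhi : measurable_fun setT
    (fun z : measurableTypeR R * T => Phi z.1 z.2))
  (Phi_mp : forall (t : R) E, 0 <= t -> measurable E -> m (Phi t @^-1` E) = m E).

Lemma measurable_flow t : measurable_fun setT (Phi t).
Proof.
apply: (measurableT_comp mPhi (g := fun x => (t, x))).
exact: pair1_measurable.
Qed.

Lemma measurable_orbit (h : T -> R) x : measurable_fun setT h ->
  measurable_fun setT (fun s : measurableTypeR R => h (Phi s x)).
Proof.
move=> mh; apply: (measurableT_comp mh).
apply: (measurableT_comp mPhi (g := fun s => (s, x))).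
exact: pair2_measurable.
Qed.

Lemma flow_ge0_integral t (h : T -> \bar R) : 0 <= t ->
  measurable_fun setT h -> (forall x, 0 <= h x)%E ->
  (\int[m]_x h (Phi t x) = \int[m]_x h x)%E.
Proof.
move=> t0 mh h0.
have := mp_ge0_integral (@measurable_flow t) (fun A => @Phi_mp t A t0) measurableT mh.
by rewrite preimage_setT; apply=> x _.
Qed.

Lemma flow_integral t (h : T -> \bar R) : 0 <= t -> measurable_fun setT h ->
  (\int[m]_x h (Phi t x) = \int[m]_x h x)%E.
Proof.
move=> t0 mh.
have := mp_integral (@measurable_flow t) (fun A => @Phi_mp t A t0) measurableT mh.
by rewrite preimage_setT.
Qed.

Lemma flow_integrable t (h : T -> \bar R) : 0 <= t -> m.-integrable setT h ->
  m.-integrable setT (fun x => h (Phi t x)).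
Proof.
move=> t0 ih.
have := mp_integrable (@measurable_flow t) (fun A => @Phi_mp t A t0) measurableT ih.
by rewrite preimage_setT.
Qed.

(** The cut-off in time is part of the integrand, so that Fubini's theorem applies on the whole
    product. *)
Let slab (t : R) (h : T -> R) (z : T * measurableTypeR R) : \bar R :=
  (h (Phi z.2 z.1) * \1_(`[0, t]%classic : set (measurableTypeR R)) z.2)%:E.

Let measurable_slab t h : measurable_fun setT h -> measurable_fun setT (slab t h).
Proof.
move=> mh; apply/measurable_EFinP; apply: measurable_funM.
  apply: (measurableT_comp mh).
  apply: (measurableT_comp mPhi (g := fun z => (z.2, z.1))).
  exact: measurable_fun_pair.
apply: (measurableT_comp (measurable_indic _)) => //.
Qed.

Let integral_slab t h x : (\int[mu]_s slab t h (x, s) =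
  \int[mu]_(s in `[0%R, t]) (h (Phi s x))%:E)%E.
Proof.
rewrite [RHS]integral_mkcond; apply: eq_integral => s _.
by rewrite /slab /= patchE indicE; case: ifP => _; rewrite ?mulr1 ?mulr0.
Qed.

(** After exchanging the integrals by Tonelli, invariance makes the integral over [x] the same for
    every [s]. *)
Lemma integral_time_integral_ge0 (h : T -> R) t : 0 <= t ->
  measurable_fun setT h -> (forall x, 0 <= h x) ->
  (\int[m]_x \int[mu]_(s in `[0%R, t]) (h (Phi s x))%:E =
   t%:E * \int[m]_x (h x)%:E)%E.
Proof.
move=> t0 mh h0.
under eq_integral do rewrite -integral_slab.
rewrite (fubini_tonelli (slab t h)); last 2 first.
- exact: measurable_slab.
- by move=> z; rewrite lee_fin mulr_ge0.
transitivity (\int[mu]_s ((\int[m]_x (h x)%:E) *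
  (\1_(`[0%R, t]%classic : set (measurableTypeR R)) s)%:E))%E.
  apply: eq_integral => s _; rewrite /slab/= indicE.
  have [/set_mem|_] := boolP (s \in _).
    rewrite /= in_itv/= => /andP[s0 _].
    under eq_integral do rewrite mulr1.
    rewrite mule1 (flow_ge0_integral (h := EFin \o h))//.
    exact/measurable_EFinP.
  under eq_integral do rewrite mulr0.
  by rewrite mule0 integral0.
rewrite ge0_integralZl//.
- rewrite integral_indic//= setIT lebesgue_measure_itv/= lte_fin muleC.
  have [_|t0'] := ltP 0 t; first by rewrite -EFinB subr0.
  by have -> : t = 0 by apply/eqP; rewrite eq_le t0 t0'.
- by apply/measurable_EFinP; exact: measurable_indic.
- by apply: integral_ge0 => x _; rewrite lee_fin.
Qed.

Lemma measurable_time_integral_ge0 (h : T -> R) t :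
  measurable_fun setT h -> (forall x, 0 <= h x) ->
  measurable_fun setT
    (fun x => \int[mu]_(s in `[0%R, t]) (h (Phi s x))%:E)%E.
Proof.
move=> mh h0; rewrite (_ : (fun x => _) = fubini_F mu (slab t h)).
  apply: measurable_fun_fubini_tonelli_F; first exact: measurable_slab.
  by move=> z; rewrite lee_fin mulr_ge0.
by apply/funext => x; rewrite /fubini_F integral_slab.
Qed.

(** The mean time spent in [N] up to [t] is [t * m N]. Hence a change of an observable on a null set
    does not alter its integrals along almost all orbits. *)
Lemma null_set_time_ae (N : set T) t : 0 <= t -> measurable N -> m N = 0%E ->
  {ae m, forall x, (\int[mu]_(s in `[0%R, t]) (\1_N (Phi s x))%:E = 0)%E}.
Proof.
move=> t0 mN N0; have N_ge0 x : 0 <= \1_N x :> R by [].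
have mI := measurable_time_integral_ge0 t (measurable_indic mN) N_ge0.
suff /(ae_eq_integral_abs m measurableT mI) : (\int[m]_x
    `|\int[mu]_(s in `[0%R, t]) (\1_N (Phi s x))%:E| = 0)%E.
  by apply: filterS => x; exact.
under eq_integral do rewrite gee0_abs ?integral_ge0//.
rewrite (integral_time_integral_ge0 t0 (measurable_indic mN) N_ge0).
by rewrite integral_indic// setIT [X in (_ * X)%E]N0 mule0.
Qed.

Definition time_integral (h : T -> R) (t : R) (x : T) : R :=
  \int[mu]_(s in `[0, t]) h (Phi s x).

Section integrable_observable.
Variable h : T -> R.
Hypotheses (mh : measurable_fun setT h) (ih : m.-integrable setT (EFin \o h)).

Let integrable_slab t : 0 <= t -> (m \x mu)%E.-integrable setT (slab t h).
Proof.
move=> t0; apply/integrable12ltyP; first exact: measurable_slab.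
rewrite (_ : (fun x => _) = (fun x =>
  \int[mu]_(s in `[0%R, t]) (`|h (Phi s x)|)%:E)%E); last first.
  apply/funext => x; rewrite [RHS]integral_mkcond; apply: eq_integral => s _.
  rewrite /slab /= patchE indicE.
  by case: ifP => _; rewrite ?mulr1 ?mulr0 ?normr0.
rewrite (@integral_time_integral_ge0 (fun x => `|h x|))//; last first.
  exact: measurableT_comp.
have /integrableP[_] := ih.
rewrite /= -[X in (X < _ -> _)%E]/(\int[m]_x (`|h x|)%:E)%E.
by move=> ?; apply: lte_mul_pinfty.
Qed.

Let time_integral_fine t : time_integral h t = fine \o fubini_F mu (slab t h).
Proof.
by apply/funext => x; rewrite /time_integral /Rintegral /= /fubini_F integral_slab.
Qed.

Lemma measurable_time_integral t : 0 <= t -> measurable_fun setT (time_integral h t).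
Proof.
move=> t0; rewrite time_integral_fine; apply: (measurableT_comp (@measurable_realfun.fine_measurable R _ measurableT)).
exact: measurable_fubini_F (integrable_slab t0).
Qed.

Hypothesis LIh : forall x t, mu.-integrable `[0, t] (fun s => (h (Phi s x))%:E).

Let time_integralE t : EFin \o time_integral h t = fubini_F mu (slab t h).
Proof.
apply/funext => x; rewrite /= /fubini_F integral_slab /time_integral /Rintegral.
by rewrite fineK//; apply: integrable_fin_num.
Qed.

Lemma integrable_time_integral t : 0 <= t ->
  m.-integrable setT (EFin \o time_integral h t).
Proof.
by move=> t0; rewrite time_integralE; exact: integrable_fubini_F (integrable_slab t0).
Qed.

Lemma integral_time_integral t : 0 <= t ->
  (\int[m]_x (time_integral h t x)%:E = t%:E * \int[m]_x (h x)%:E)%E.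
Proof.
move=> t0; transitivity (\int[m]_x fubini_F mu (slab t h) x)%E.
  by apply: eq_integral => x _; rewrite -time_integralE.
rewrite (Fubini (integrable_slab t0)).
transitivity (\int[mu]_s ((\int[m]_x (h x)%:E) *
  (\1_(`[0%R, t]%classic : set (measurableTypeR R)) s)%:E))%E.
  apply: eq_integral => s _; rewrite /slab/= indicE.
  have [/set_mem|_] := boolP (s \in _).
    rewrite /= in_itv/= => /andP[s0 _].
    under eq_integral do rewrite mulr1.
    rewrite mule1 (flow_integral (h := EFin \o h))//.
    exact/measurable_EFinP.
  under eq_integral do rewrite mulr0.
  by rewrite mule0 integral0.
have hfin : (\int[m]_x (h x)%:E \is a fin_num)%E by exact: integrable_fin_num.
rewrite -(fineK hfin) integralZl//.
- rewrite integral_indic//= setIT lebesgue_measure_itv/= lte_fin muleC.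
  have [_|t0'] := ltP 0 t; first by rewrite -EFinB subr0.
  by have -> : t = 0 by apply/eqP; rewrite eq_le t0 t0'.
- exact: integrable_indic_itv.
Qed.

Lemma time_integral_diff (s t : R) x : 0 <= s -> s <= t ->
  time_integral h t x - time_integral h s x = \int[mu]_(u in `[s, t]) h (Phi u x).
Proof.
move=> s0 st; rewrite /time_integral (Rintegral_itvB (LIh x t)) ?bnd_simp//.
rewrite Rintegral_itv_obnd_cbnd//.
apply: integrableS (LIh x t) => // u; rewrite /= !in_itv/= => /andP[su ->].
by rewrite andbT (le_trans s0 (ltW su)).
Qed.

(** The cocycle identity: it turns two equal values along an orbit into a vanishing integral started
    at the first of the two points. *)
Lemma time_integralD (s t : R) x : 0 <= s -> 0 <= t ->
  time_integral h (s + t) x = time_integral h s x + time_integral h t (Phi s x).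
Proof.
move=> s0 t0; have st : s <= s + t by rewrite lerDl.
rewrite -[LHS](subrK (time_integral h s x)) addrC time_integral_diff//.
congr (_ + _); rewrite /time_integral /Rintegral; congr fine.
rewrite -[X in `[X, _]](addr0 s) -(@integral_translation _ s 0 t
  (fun u => (h (Phi u x))%:E)).
  apply: eq_integral => u /set_mem; rewrite /= in_itv/= => /andP[u0 _].
  by rewrite addrC PhiD.
by apply: measurable_funTS; apply/measurable_EFinP; exact: measurable_orbit.
Qed.

Lemma time_integral_continuous x (t e : R) : 0 <= t -> 0 < e ->
  exists2 r : R, 0 < r &
    forall s, 0 <= s -> `|s - t| < r ->
      `|time_integral h s x - time_integral h t x| < e.
Proof.
move=> t0 e0; have t1 : 0 <= t + 1 by lra.
have c := parameterized_integral_continuous t1 (LIh x (t + 1)).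
have tI : `[0, t + 1]%classic t by rewrite /= in_itv/=; lra.
have [r r0 H] := within_continuous_dist c tI e0.
exists (Num.min r 1); first by rewrite lt_min r0 ltr01.
move=> s s0; rewrite lt_min => /andP[st st1]; apply: H => //.
by rewrite /= in_itv/= s0/=; move: st1; rewrite ltr_distl; lra.
Qed.

End integrable_observable.

End semiflow_averages.

(** * Sublinear growth of the orbit integrals *)

Lemma measurable_set_lt d (T : measurableType d) (R : realType) (f g : T -> R) :
  measurable_fun setT f -> measurable_fun setT g ->
  measurable [set x | f x < g x].
Proof.
move=> mf mg; rewrite -[X in measurable X]setTI.
exact: (measurable_fun_ltr mf mg measurableT (Y := [set true])).
Qed.

Lemma ae_probability1 d (T : measurableType d) (R : realType)
    (m : probability T R) (B : set T) :
  measurable B -> m B = 1%E -> {ae m, forall x, B x}.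
Proof.
move=> mB B1; exists (~` B); split => //; first exact: measurableC.
by rewrite probability_setC// B1 subee.
Qed.

Lemma integral_probability_cst d (T : measurableType d) (R : realType)
    (m : probability T R) (c : R) : (\int[m]_x (cst c x)%:E = c%:E)%E.
Proof.
exact: (etrans (integral_cst m measurableT c%:E)
  (etrans (congr1 (mule c%:E) (probability_setT m)) (mule1 _))).
Qed.

Section linear_growth.
Context d (T : measurableType d) (R : realType) (m : probability T R).
Variable Phi : R -> T -> T.
Notation mu := (@lebesgue_measure R).
Hypotheses (Phi0 : forall x, Phi 0 x = x)
  (PhiD : forall (s t : R) x, 0 <= s -> 0 <= t ->
    Phi (s + t) x = Phi s (Phi t x))
  (mPhi : measurable_fun setT
    (fun z : measurableTypeR R * T => Phi z.1 z.2))
  (Phi_mp : forall (t : R) E, 0 <= t -> measurable E -> m (Phi t @^-1` E) = m E)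
  (Phi_erg : forall B, measurable B ->
    (forall (t : R) x, 0 <= t -> B x -> B (Phi t x)) ->
    m B = 0%E \/ m B = 1%E).
Variable h : T -> R.
Hypotheses (mh : measurable_fun setT h) (ih : m.-integrable setT (EFin \o h))
  (LIh : forall x t, mu.-integrable `[0, t] (fun s => (h (Phi s x))%:E))
  (h0 : (\int[m]_x (h x)%:E = 0)%E).
Variable e : R.
Hypothesis e0 : 0 < e.

Let avg := time_integral Phi h.
Let absh : T -> R := fun x => `|h x|.
Let G := time_integral Phi absh 1.
Let F := avg 1.

Let mabsh : measurable_fun setT absh.
Proof. exact: measurableT_comp. Qed.

Let iabsh : m.-integrable setT (EFin \o absh).
Proof. exact: integrable_norm. Qed.

Let LIabsh x t : mu.-integrable `[0, t] (fun s => (absh (Phi s x))%:E).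
Proof. exact: (integrable_norm (LIh x t)). Qed.

Let avg_le_abs (s t : R) x : 0 <= s -> s <= t ->
  `|avg s x| <= time_integral Phi absh t x.
Proof.
move=> s0 st; have absh_ge0 a b : 0 <= \int[mu]_(u in `[a, b]) absh (Phi u x).
  by apply: Rintegral_ge0 => u _; exact: normr_ge0.
apply: (@le_trans _ _ (time_integral Phi absh s x)).
  exact: (le_normr_Rintegral _ (LIh x s)).
by rewrite -subr_ge0 (time_integral_diff LIabsh).
Qed.

Let unbounded_set := [set x | forall C : nat,
  exists2 t : R, 0 <= t & e * t + C%:R < avg t x].

Let measurable_unbounded_set : measurable unbounded_set.
Proof.
have -> : unbounded_set = \bigcap_(C in [set: nat]) \bigcup_(q in [set: rat])
    (if 0 <= ratr q :> R
     then [set x | e * ratr q + C%:R < avg (ratr q) x] else set0).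
  apply/seteqP; split => x.
    move=> Bx C _; have [t t0 Ht] := Bx C.
    have d0 : 0 < (avg t x - (e * t + C%:R)) / 2 by rewrite divr_gt0 ?subr_gt0.
    have [r r0 H] := time_integral_continuous LIh x t0 d0.
    (* On the interval of length [r'] the term [e * t] grows by at most half of the margin, and
       [avg] loses less than the other half. *)
    pose r' := Num.min r ((avg t x - (e * t + C%:R)) / (2 * e)).
    have r'0 : 0 < r'.
      by rewrite lt_min r0 divr_gt0 ?subr_gt0// mulr_gt0.
    have [q] : exists q, ratr q \in `]t, (t + r')[.
      by apply: rat_in_itvoo; rewrite ltrDl.
    rewrite in_itv/= => /andP[tq qr].
    have q0 : 0 <= ratr q :> R by rewrite (le_trans t0)// ltW.
    exists q => //; rewrite q0 /=.
    have /(H _ q0) : `|ratr q - t| < r.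
      rewrite gtr0_norm ?subr_gt0// ltrBlDl (lt_le_trans qr)// lerD2l.
      by rewrite ge_min lexx.
    rewrite ltr_distl => /andP[+ _].
    have : e * ratr q <= e * t + (avg t x - (e * t + C%:R)) / 2.
      have : e * ratr q <= e * (t + r') by rewrite ler_pM2l// ltW.
      have : e * r' <= (avg t x - (e * t + C%:R)) / 2.
        have -> : (avg t x - (e * t + C%:R)) / 2 =
            e * ((avg t x - (e * t + C%:R)) / (2 * e)).
          by field; rewrite gt_eqF.
        by rewrite ler_pM2l// ge_min lexx orbT.
      by rewrite mulrDr; lra.
    rewrite /avg; lra.
  move=> H C; have [q _] := H C Logic.I.
  by case: ifP => // q0 /= Hq; exists (ratr q).
apply: bigcapT_measurable => C; apply: bigcupT_measurable_rat => q.
case: ifP => // q0; apply: measurable_set_lt; first exact: measurable_cst.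
exact: (measurable_time_integral mPhi Phi_mp).
Qed.

(** Dropping the orbit up to time [t] changes the integral by at most [A], which a larger constant
    absorbs; this is what makes ergodicity applicable. *)
Let unbounded_set_invariant (t : R) x : 0 <= t ->
  unbounded_set x -> unbounded_set (Phi t x).
Proof.
move=> t0 Bx C; pose A := time_integral Phi absh t x.
(* A level above [A] excludes [u <= t], since [avg] does not exceed [A] up to time [t]. *)
have [u u0] := Bx (C + (Num.trunc A).+1)%N.
have := truncnS_gt A; rewrite natrD => A1 Hu.
have ut : t < u.
  rewrite ltNge; apply/negP => ut; have := avg_le_abs x u0 ut.
  move=> /(le_trans (ler_norm _)); rewrite -/A.
  have : 0 <= e * u by rewrite mulr_ge0// ltW.
  have : 0 <= C%:R :> R by [].
  lra.
exists (u - t); first by rewrite subr_ge0 ltW.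
have := time_integralD PhiD mPhi mh LIh x t0 (_ : 0 <= u - t).
rewrite subr_ge0 addrC subrK => /(_ (ltW ut)) E.
have := avg_le_abs x t0 (lexx t); rewrite -/A => /(le_trans (ler_norm _)).
have : e * (u - t) <= e * u by rewrite ler_pM2l// gerBl.
move: E Hu; rewrite -/avg; lra.
Qed.

(* M n dominates avg t - e * t for t <= n + 1. The integral of M n.+1 - M n o Phi 1
   is nonnegative, and on unbounded_set this function is eventually F - e. *)
Let M : nat -> T -> R :=
  fix M n := if n is k.+1 then fun x => Num.max (G x) (F x - e + M k (Phi 1 x))
             else G.

Let mG : measurable_fun setT G.
Proof. exact: (measurable_time_integral mPhi Phi_mp mabsh iabsh ler01). Qed.

Let mF : measurable_fun setT F.
Proof. exact: (measurable_time_integral mPhi Phi_mp mh ih ler01). Qed.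

Let iG : m.-integrable setT (EFin \o G).
Proof. exact: (integrable_time_integral mPhi Phi_mp mabsh iabsh LIabsh ler01). Qed.

Let iF : m.-integrable setT (EFin \o F).
Proof. exact: (integrable_time_integral mPhi Phi_mp mh ih LIh ler01). Qed.

Let mM n : measurable_fun setT (M n).
Proof.
elim: n => [|n IH] /=; first exact: mG.
apply: measurable_maxr => //; apply: measurable_funD; first exact: measurable_funB.
exact: (measurableT_comp IH (measurable_flow mPhi 1)).
Qed.

Let iM n : m.-integrable setT (EFin \o M n).
Proof.
elim: n => [|n IH]; first exact: iG.
have i1 : m.-integrable setT (fun x => (F x - e + M n (Phi 1 x))%:E).
  apply: (integrableD measurableT (f := fun x => (F x - e)%:E)
    (g := fun x => (M n (Phi 1 x))%:E)) => //.
    apply: (integrableB measurableT (f := EFin \o F) (g := EFin \o cst e)) => //.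
    exact: finite_measure_integrable_cst.
  exact: (flow_integrable mPhi Phi_mp _ IH).
apply: (le_integrable measurableT (g := fun x =>
    (`|G x| + `|F x - e + M n (Phi 1 x)|)%:E)).
- by apply/measurable_EFinP; exact: (mM n.+1).
- move=> x _ /=; rewrite !lee_fin [leRHS]ger0_norm ?addr_ge0//.
  by case: (leP (G x)) => _; rewrite ?lerDl ?lerDr.
- apply: (integrableD measurableT (f := fun x => `|G x|%:E)
    (g := fun x => `|F x - e + M n (Phi 1 x)|%:E)) => //.
    exact: (integrable_norm iG).
  exact: (integrable_norm i1).
Qed.

Let M_le n x : M n x <= M n.+1 x.
Proof.
elim: n x => [|n IH] x /=; first by rewrite le_max lexx.
by rewrite ge_max !le_max lexx/= lerD2l IH orbT.
Qed.

Let M_ge n (t : R) x : 0 <= t -> t <= n.+1%:R -> avg t x - e * t <= M n x.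
Proof.
have H s y : 0 <= s -> s <= 1 -> avg s y - e * s <= G y.
  move=> s0 s1; have := avg_le_abs y s0 s1 => /(le_trans (ler_norm _)).
  by have : 0 <= e * s by [rewrite mulr_ge0// ltW]; rewrite /G; lra.
elim: n t x => [|n IH] t x t0 tn; first exact: H.
have [t1|t1] := leP t 1; first by rewrite /= le_max H.
rewrite /= le_max; apply/orP; right.
have t10 : 0 <= t - 1 by lra.
have /(IH _ (Phi 1 x) t10) : t - 1 <= n.+1%:R by rewrite lerBlDr natr1.
have := time_integralD PhiD mPhi mh LIh x ler01 t10.
by rewrite addrC subrK /F -/avg => ->; lra.
Qed.

Let D n x := M n.+1 x - M n (Phi 1 x).

(** As soon as [M n (Phi 1 x)] exceeds [G x - F x + e], the maximum defining [M n.+1 x] is its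
    second term and the difference equals [F x - e]. *)
Let D_cvg x : unbounded_set x -> (D n x)%:E @[n --> \oo] --> (F x - e)%:E.
Proof.
move=> Bx; apply: cvg_near_cst.
have [t t0 Ht] := unbounded_set_invariant ler01 Bx (Num.trunc (G x - F x + e)).+1.
exists (Num.trunc t).+1 => // n /= tn.
congr EFin; rewrite /D /=.
have : t <= n.+1%:R.
  by apply: ltW; apply: (lt_le_trans (truncnS_gt t)); rewrite ler_nat ltnW.
move=> /(M_ge (Phi 1 x) t0) tM.
have := truncnS_gt (G x - F x + e) => GF.
rewrite max_r; last by lra.
by rewrite addrK.
Qed.

(** [D n x] is the maximum of [G x - M n (Phi 1 x)] and [F x - e], and [M n >= G >= 0]; so the bound
    is uniform in [n]. *)
Let D_bound n x : `|D n x| <= `|F x| + e + G x + G (Phi 1 x).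
Proof.
have Gge0 y : 0 <= G y by apply: Rintegral_ge0 => u _; exact: normr_ge0.
have M0 y : G y <= M n y by elim: n => // n IH; exact: le_trans IH (M_le _ _).
have := M0 (Phi 1 x); have := Gge0 x; have := Gge0 (Phi 1 x).
have := ler_norm (F x); have : - F x <= `|F x| by rewrite -normrN ler_norm.
rewrite /D /= => H1 H2 H3 H4 H5.
case: (leP (G x) (F x - e + M n (Phi 1 x))) => H6;
  rewrite ler_norml; move: e0 H1 H2 H3 H4 H5 H6;
  move: (M n (Phi 1 x)) (G (Phi 1 x)) (G x) `|F x| (F x) e => *;
  by apply/andP; split; lra.
Qed.

(** As in Garsia's proof of the maximal ergodic theorem: on a set of full measure, dominated
    convergence would make the integral of [F - e] nonnegative, whereas [F] has integral 0. *)
Let unbounded_set_null : m unbounded_set <> 1%E.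
Proof.
move=> /(ae_probability1 measurable_unbounded_set) B1.
have mFPhi : measurable_fun setT (G \o Phi 1).
  exact: (measurableT_comp mG (measurable_flow mPhi 1)).
have mMPhi n : measurable_fun setT (fun x => M n (Phi 1 x)).
  exact: (measurableT_comp (mM n) (measurable_flow mPhi 1)).
have iMPhi n : m.-integrable setT (fun x => (M n (Phi 1 x))%:E).
  exact: (flow_integrable mPhi Phi_mp ler01 (iM n)).
have [] := @dominated_convergence _ _ _ m setT measurableT
  (fun n => EFin \o D n) (fun x => (F x - e)%:E)
  (fun x => (`|F x| + e + G x + G (Phi 1 x))%:E).
- move=> n; apply/measurable_EFinP; exact: measurable_funB.
- by apply/measurable_EFinP; exact: measurable_funB.
- by apply: filterS B1 => x Bx _; exact: D_cvg.
- apply: (integrableD measurableT (f := fun x => (`|F x| + e + G x)%:E)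
    (g := fun x => (G (Phi 1 x))%:E)) => //; last first.
    exact: (flow_integrable mPhi Phi_mp ler01 iG).
  apply: (integrableD measurableT (f := fun x => (`|F x| + e)%:E) (g := EFin \o G)) => //.
  apply: (integrableD measurableT (f := fun x => (`|F x|)%:E) (g := EFin \o cst e)) => //.
    exact: (integrable_norm iF).
  exact: finite_measure_integrable_cst.
- by apply: aeW => x n _; rewrite lee_fin D_bound.
move=> _ _ /cvge_to_ge => H.
have : (0 <= \int[m]_x (F x - e)%:E)%E.
  apply: H; apply: nearW => n.
  rewrite /= -[leRHS]/(\int[m]_x ((M n.+1 x)%:E - (M n (Phi 1 x))%:E))%E.
  rewrite integralB//; last exact: (iM n.+1).
  rewrite (flow_integral mPhi Phi_mp (h := EFin \o M n))//; last first.
    by apply/measurable_EFinP.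
  rewrite sube_ge0; last by apply/orP; left; exact: integrable_fin_num.
  apply: le_integral; [by []|exact: iM|exact: (iM n.+1)|].
  by move=> x _; rewrite lee_fin M_le.
rewrite -[leRHS]/(\int[m]_x ((F x)%:E - (cst e x)%:E))%E.
rewrite integralB//; last exact: finite_measure_integrable_cst.
rewrite (integral_time_integral mPhi Phi_mp mh ih LIh ler01) h0 mule0.
rewrite integral_probability_cst sub0e leeNr oppe0 lee_fin.
by rewrite leNgt e0.
Qed.

(** One half of the ergodic theorem; the other half is the same statement for [- h]. *)
Lemma time_integral_upper_growth :
  {ae m, forall x, exists C, forall t, 0 <= t -> avg t x <= e * t + C}.
Proof.
have [B0|//] := Phi_erg measurable_unbounded_set unbounded_set_invariant.
exists unbounded_set; split => // x /= nH C; apply: contrapT => nC.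
apply: nH; exists C%:R => t t0; rewrite leNgt; apply/negP => tC.
by apply: nC; exists t.
Qed.

End linear_growth.

(** * Recurrence of the orbit integrals *)

(* Closedness of the visiting times {t >= 0 | K (Phi t x)} in the form that is
   needed: the measurable sets U j are "neighbourhoods" of K along the orbits,
   on the right of each visiting time only, because a special flow jumps from
   the graph of the roof to the base. *)
Definition orbit_closed d (T : measurableType d) (R : realType)
    (Phi : R -> T -> T) (K : set T) : Prop :=
  exists U : nat -> set T,
    [/\ forall j, measurable (U j),
        forall j, U j.+1 `<=` U j,
        forall x (t : R) j, 0 <= t -> K (Phi t x) ->
          exists2 e : R, 0 < e & forall s, t <= s -> s < t + e -> U j (Phi s x) &
        forall x (t : R), 0 <= t -> ~ K (Phi t x) ->
          exists j, exists2 e : R, 0 < e &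
            forall s, 0 <= s -> `|s - t| < e -> ~ U j (Phi s x)].

Section orbit_closed.
Context d (T : measurableType d) (R : realType).
Variable Phi : R -> T -> T.
Notation mu := (@lebesgue_measure R).
Hypotheses (Phi0 : forall x, Phi 0 x = x)
  (mPhi : measurable_fun setT
    (fun z : measurableTypeR R * T => Phi z.1 z.2)).
Variables (K : set T) (Kcl : orbit_closed Phi K).

(** Time 0 of each orbit shows that [K] is the intersection of the sets [U j]. *)
Lemma measurable_orbit_closed : measurable K.
Proof.
have [U [mU _ KU nKU]] := Kcl.
have -> : K = \bigcap_(j in [set: nat]) U j.
  apply/seteqP; split => x.
    move=> Kx j _; have := KU x 0 j (lexx 0); rewrite Phi0 => /(_ Kx)[e e0 H].
    by rewrite -(Phi0 x); apply: H => //; rewrite add0r.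
  move=> Ux; apply: contrapT => nKx.
  have := nKU x 0 (lexx 0); rewrite Phi0 => /(_ nKx)[j [e e0 H]].
  by apply: (H 0) => //; [rewrite subrr normr0|rewrite Phi0; exact: Ux].
exact: bigcapT_measurable.
Qed.

Lemma orbit_closedC x (t : R) : 0 <= t -> ~ K (Phi t x) ->
  exists2 e : R, 0 < e & forall s, 0 <= s -> `|s - t| < e -> ~ K (Phi s x).
Proof.
have [U [mU _ KU nKU]] := Kcl => t0 nK; have [j [e e0 H]] := nKU x t t0 nK.
exists e => // s s0 st Ks; apply: (H s s0 st).
by have [e' e'0 H'] := KU x s j s0 Ks; apply: H' => //; rewrite ltrDl.
Qed.

Variable h : T -> R.
Hypotheses (mh : forall t : R, 0 <= t -> measurable_fun setT (time_integral Phi h t))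
  (LIh : forall x t, mu.-integrable `[0, t] (fun s => (h (Phi s x))%:E)).

Definition zero_return (a : R) (x : T) : Prop :=
  exists t, [/\ a <= t, time_integral Phi h t x = 0 & K (Phi t x)].

(** A relaxed return that persists for a short while after a true one, so that rational times detect
    it. *)
Let approx_return (U : nat -> set T) (k : nat) (t : R) (x : T) :=
  `|time_integral Phi h t x| < k.+1%:R^-1 /\ U k (Phi t x).

Let approx_returnS (U : nat -> set T) (k k' : nat) t x :
  (forall j, U j.+1 `<=` U j) -> (k <= k')%N ->
  approx_return U k' t x -> approx_return U k t x.
Proof.
move=> Udec kk' [H1 H2]; split.
  by apply: (lt_le_trans H1); rewrite lef_pV2 ?posrE// ler_nat ltnS.
elim: k' kk' H2 {H1} => [|k' IH]; first by rewrite leqn0 => /eqP ->.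
by rewrite leq_eqVlt => /orP[/eqP -> //|kk'] /Udec; exact: IH.
Qed.

(** Compactness of the time interval: without a true return, every time has a neighbourhood free of
    approximate returns of some order, because either the integral is nonzero there or the orbit is
    off [K]. [itv_local_global] then produces one order valid on all of [[a, b]]. *)
Let approx_returnP U (a b : R) x : 0 <= a -> a <= b ->
  (forall j, U j.+1 `<=` U j) ->
  (forall x (t : R), 0 <= t -> ~ K (Phi t x) ->
    exists j, exists2 e : R, 0 < e &
      forall s, 0 <= s -> `|s - t| < e -> ~ U j (Phi s x)) ->
  (forall k, exists2 t, a <= t <= b & approx_return U k t x) ->
  exists2 t, a <= t <= b & time_integral Phi h t x = 0 /\ K (Phi t x).
Proof.
move=> a0 ab Udec nKU H; apply: contrapT => nex.
have [k Hk] : exists k, forall t, a <= t <= b -> ~ approx_return U k t x.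
  apply: (@itv_local_global _ (fun s t =>
    exists k, forall u, s <= u <= t -> ~ approx_return U k u x)) => //.
    move=> s t u _ st tu _ [k Hk] [k' Hk']; exists (maxn k k') => v /andP[sv vu].
    have [vt|tv] := leP v t => Hv.
      apply: (Hk v); first by rewrite sv.
      by apply: approx_returnS Hv => //; exact: leq_maxl.
    apply: (Hk' v); first by rewrite vu ltW.
    by apply: approx_returnS Hv => //; exact: leq_maxr.
  move=> t /andP[at_ tb].
  have t0 : 0 <= t by exact: le_trans at_.
  have [g0|gn0] := eqVneq (time_integral Phi h t x) 0.
    have nK : ~ K (Phi t x) by move=> KP; apply: nex; exists t => //; rewrite at_.
    have [j [e e0 He]] := nKU x t t0 nK.
    exists e => // s s' as_ ss' s'b s1 s2; exists j => u /andP[su us'] [_ Uu].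
    apply: (He u) => //; first by rewrite (le_trans a0)// (le_trans as_).
    by rewrite ltr_distl; lra.
  have n0 : 0 < `|time_integral Phi h t x| / 2 by rewrite divr_gt0// normr_gt0.
  have [e e0 He] := time_integral_continuous LIh x t0 n0.
  pose k := Num.trunc ((`|time_integral Phi h t x| / 2)^-1).
  exists e => // s s' as_ ss' s'b s1 s2; exists k => u /andP[su us'] [gu _].
  have /He : 0 <= u by rewrite (le_trans a0)// (le_trans as_).
  have ut : `|u - t| < e by rewrite ltr_distl; lra.
  move=> /(_ ut) H1.
  have : k.+1%:R^-1 < `|time_integral Phi h t x| / 2.
    by rewrite -[ltRHS]invrK ltf_pV2 ?posrE ?invr_gt0// truncnS_gt.
  move=> H2; have := lt_trans gu H2 => H3.
  have := ler_normB (time_integral Phi h u x)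
    (time_integral Phi h u x - time_integral Phi h t x).
  by rewrite opprB addrC subrK; lra.
by have [t tab] := H k; exact: Hk.
Qed.

(** A return before time [N] amounts to approximate returns of every order at rational times up to
    [N]; the bound [N] provides the compact interval for [approx_returnP]. *)
Lemma measurable_zero_return (a : R) : 0 <= a -> measurable [set x | zero_return a x].
Proof.
move=> a0; have [U [mU Udec KU nKU]] := Kcl.
have -> : [set x | zero_return a x] = \bigcup_(N in [set: nat])
    \bigcap_(k in [set: nat]) \bigcup_(q in [set: rat])
    (if a <= ratr q <= (N%:R : R) then [set x | approx_return U k (ratr q) x] else set0).
  apply/seteqP; split => x.
    move=> [t [at_ gt Kt]]; have t0 := le_trans a0 at_.
    exists (Num.trunc t).+1 => // k _.
    have kp : 0 < k.+1%:R^-1 :> R by rewrite invr_gt0.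
    have [e e0 He] := time_integral_continuous LIh x t0 kp.
    have [e' e'0 He'] := KU x t k t0 Kt.
    pose r := Num.min e (Num.min e' ((Num.trunc t).+1%:R - t)).
    have r0 : 0 < r by rewrite !lt_min e0 e'0 subr_gt0 truncnS_gt.
    have [q] : exists q, ratr q \in `]t, (t + r)[.
      by apply: rat_in_itvoo; rewrite ltrDl.
    rewrite in_itv/= => /andP[tq qr]; exists q => //.
    have : r <= e by rewrite ge_min lexx.
    have : r <= e' by rewrite /r !ge_min lexx orbT.
    have : r <= (Num.trunc t).+1%:R - t by rewrite /r !ge_min lexx !orbT.
    move=> r1 r2 r3.
    rewrite ifT; last by apply/andP; split; lra.
    split; last by apply: He'; lra.
    have -> : time_integral Phi h (ratr q) x =
        time_integral Phi h (ratr q) x - time_integral Phi h t x.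
      by rewrite gt subr0.
    by apply: He; [lra|rewrite ltr_distl; lra].
  move=> [N _ H].
  have aN : a <= N%:R.
    have [q _] := H 0%N Logic.I.
    by case: ifP => // /andP[aq qN] _; exact: le_trans qN.
  have [|t /andP[at_ _] [gt Kt]] := @approx_returnP U a N%:R x a0 aN Udec nKU.
    move=> k; have [q _] := H k Logic.I.
    by case: ifP => // aqN Hq; exists (ratr q).
  by exists t.
apply: bigcupT_measurable => N; apply: bigcapT_measurable => k.
apply: bigcupT_measurable_rat => q; case: ifP => // /andP[aq _].
have q0 : 0 <= ratr q :> R by exact: le_trans aq.
apply: measurableI.
  apply: measurable_set_lt; last exact: measurable_cst.
  by apply: measurableT_comp => //; exact: mh.
rewrite -[X in measurable X]setTI; exact: (measurable_flow mPhi).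
Qed.

End orbit_closed.

Section recurrence.
Context d (T : measurableType d) (R : realType) (m : probability T R).
Variable Phi : R -> T -> T.
Notation mu := (@lebesgue_measure R).
Hypotheses (Phi0 : forall x, Phi 0 x = x)
  (PhiD : forall (s t : R) x, 0 <= s -> 0 <= t ->
    Phi (s + t) x = Phi s (Phi t x))
  (mPhi : measurable_fun setT
    (fun z : measurableTypeR R * T => Phi z.1 z.2))
  (Phi_mp : forall (t : R) E, 0 <= t -> measurable E -> m (Phi t @^-1` E) = m E).

Section no_return.
Variable f : T -> R.
Hypotheses (mf : measurable_fun setT f) (if_ : m.-integrable setT (EFin \o f))
  (LIf : forall x t, mu.-integrable `[0, t] (fun s => (f (Phi s x))%:E)).
Hypothesis f_growth : {ae m, forall x, forall i : nat, exists C, forall t : R,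
  0 <= t -> `|time_integral Phi f t x| <= i.+1%:R^-1 * t + C}.
Variables (K : set T) (n : nat).
Hypotheses (Kcl : orbit_closed Phi K) (Kf : forall x, K x -> 0 < f x)
  (n0 : (0 < n)%N) (noret : forall x, K x -> ~ zero_return Phi K f n%:R x).

Let mK : measurable K := measurable_orbit_closed Phi0 Kcl.

(* The integral of q along an orbit segment bounds from below the measure of the
   set of values that the integral of f takes at the visits to K. *)
Let q (x : T) : R := f x - `|f x| * \1_(~` K) x.

Let mq : measurable_fun setT q.
Proof.
apply: measurable_funB => //; apply: measurable_funM; first exact: measurableT_comp.
by apply: measurable_indic; exact: measurableC.
Qed.

Let q_bound x : `|q x| <= 2 * `|f x|.
Proof.
rewrite (le_trans (ler_normB _ _))// mulr2n mulrDl mul1r lerD2l normrM normr_id.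
by rewrite indicE; case: (x \in _); rewrite ?normr1 ?normr0 ?mulr1 ?mulr0.
Qed.

Let iq : m.-integrable setT (EFin \o q).
Proof.
apply: (le_integrable measurableT (g := fun x => (2 * `|f x|)%:E)).
- exact/measurable_EFinP.
- by move=> x _; rewrite lee_fin (le_trans (q_bound x))// ler_norm.
- exact: (integrableZl measurableT 2 (integrable_norm if_)).
Qed.

Let LIq x t : mu.-integrable `[0, t] (fun s => (q (Phi s x))%:E).
Proof.
have mI : measurable (`[0, t]%classic : set (measurableTypeR R)) by [].
apply: (le_integrable mI
  (g := fun s : measurableTypeR R => (2 * `|f (Phi s x)|)%:E)).
- by apply: measurable_funTS; apply/measurable_EFinP; exact: measurable_orbit.
- by move=> s _; rewrite lee_fin (le_trans (q_bound _))// ler_norm.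
- exact: (integrableZl mI 2 (integrable_norm (LIf x t))).
Qed.

Let g x t := time_integral Phi f t x.
Let W x := [set t : R | 0 <= t /\ K (Phi t x)].

Let Wclosed x a b (t : R) : 0 <= a -> a <= t <= b -> ~ W x t ->
  exists2 e : R, 0 < e & forall s, a <= s <= b -> `|s - t| < e -> ~ W x s.
Proof.
move=> a0 /andP[at_ tb] nW; have t0 := le_trans a0 at_.
have nK : ~ K (Phi t x) by move=> KP; exact: nW.
have [e e0 H] := orbit_closedC Kcl t0 nK.
by exists e => // s /andP[as_ _] st [s0]; exact: H.
Qed.

Let LIf_itv x a b : 0 <= a -> mu.-integrable `[a, b] (fun s => (f (Phi s x))%:E).
Proof.
move=> a0; apply: integrableS (LIf x b) => // u; rewrite /= !in_itv/=.
by move=> /andP[au ->]; rewrite (le_trans a0 au).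
Qed.

Let image x (a b : R) := g x @` (W x `&` `[a, b]).

(** [image_trace_lower_bound] on one window of the orbit: [q] is designed so that its integral is
    the lower bound found there. *)
Let image_measure x (a dl : R) : 0 <= a -> 0 <= dl ->
  ((time_integral Phi q dl (Phi a x))%:E <= mu (image x a (a + dl)))%E.
Proof.
move=> a0 dl0; have ab : a <= a + dl by rewrite lerDl.
have gphi s t : a <= s -> s <= t -> t <= a + dl ->
    g x t - g x s = \int[mu]_(u in `[s, t]) f (Phi u x).
  by move=> sa st tb; rewrite /g time_integral_diff// (le_trans a0).
have := image_trace_lower_bound ab (LIf_itv x (a + dl) a0) gphi
  (fun t => @Wclosed x a (a + dl) t a0).
apply: le_trans; rewrite lee_fin.
have -> : time_integral Phi q dl (Phi a x) =
    \int[mu]_(u in `[a, a + dl]) q (Phi u x).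
  rewrite -(time_integral_diff LIq)// (time_integralD PhiD mPhi mq LIq)//.
  by rewrite addrAC subrr add0r.
rewrite le_eqVlt; apply/orP; left; apply/eqP.
have iabs : mu.-integrable `[a, a + dl] (fun u => (`|f (Phi u x)|)%:E).
  exact: (integrable_norm (LIf_itv x (a + dl) a0)).
pose c u := `|f (Phi u x)| * \1_(~` K) (Phi u x).
have ic : mu.-integrable `[a, a + dl] (EFin \o c).
  apply: le_integrable iabs => //.
    apply: measurable_funTS; apply/measurable_EFinP.
    apply: (@measurable_orbit _ _ _ _ mPhi (fun y => `|f y| * \1_(~` K) y)).
    apply: measurable_funM; first exact: measurableT_comp.
    by apply: measurable_indic; exact: measurableC.
  move=> u _; rewrite lee_fin normrM indicE.
  by case: (_ \in _); rewrite ?normr1 ?normr0 ?mulr1 ?mulr0.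
rewrite /q RintegralB//; last exact: LIf_itv.
congr (_ - _); rewrite Rintegral_mkcond [RHS]Rintegral_mkcond.
apply: eq_Rintegral => u _; rewrite !patchE.
have -> : (u \in `[a, a + dl] `\` W x) =
    (u \in `[a, a + dl]%classic) && (Phi u x \in ~` K).
  apply/idP/andP.
    move=> /set_mem[Iu nW]; split; apply/mem_set => // Ku; apply: nW; split => //.
    by move: Iu; rewrite /= in_itv/= => /andP[au _]; rewrite (le_trans a0).
  move=> [/set_mem Iu /set_mem nK]; apply/mem_set; split => // -[_].
  exact: nK.
case: (u \in _) => //=.
by rewrite indicE; case: (_ \in _); rewrite ?mulr1 ?mulr0.
Qed.

Let measurable_image x (a b : R) : 0 <= a -> a <= b ->
  measurable (image x a b : set (measurableTypeR R)).
Proof.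
move=> a0 ab; apply: compact_measurable.
apply: (compact_image_trace ab (LIf_itv x b a0)).
  by move=> s t sa st tb; rewrite /g time_integral_diff// (le_trans a0).
by move=> t; exact: Wclosed.
Qed.

(** A common value taken at visits [s] and [t] would make [t - s >= n] a zero return of [Phi s x],
    which lies in [K]. *)
Let image_disjoint x (a b a' b' : R) : 0 <= a -> b + n%:R <= a' ->
  image x a b `&` image x a' b' = set0.
Proof.
move=> a0 ba'; rewrite -subset0 => y [[s [[s0 Ks] /=]]].
rewrite in_itv/= => /andP[as_ sb] gs [t [[t0 Kt] /=]].
rewrite in_itv/= => /andP[a't _] gt.
apply: (noret Ks); exists (t - s).
have st : s <= t by have : (0 : R) <= n%:R by []; lra.
split; first lra.
  have := time_integralD PhiD mPhi mf LIf x s0 (_ : 0 <= t - s).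
  rewrite subr_ge0 addrC subrK => /(_ st); rewrite -/(g x t) -/(g x s) gs gt.
  by lra.
by rewrite -PhiD ?subr_ge0// subrK.
Qed.

Section window.
Variable dl : R.
Hypotheses (dl0 : 0 <= dl) (dl1 : dl <= 1).

(** The positive part is what the measure of an image bounds from above; truncation at 1 gives a
    constant dominating function and is harmless, since the aim is [u = 0]. *)
Let u (x : T) : R := Num.min (Num.max (time_integral Phi q dl x) 0) 1.

Let u_ge0 x : 0 <= u x.
Proof. by rewrite /u le_min ler01 le_max lexx orbT. Qed.

Let u_le1 x : u x <= 1.
Proof. by rewrite /u ge_min lexx orbT. Qed.

Let mu_ : measurable_fun setT u.
Proof.
apply: measurable_minr; last exact: measurable_cst.
apply: measurable_maxr; last exact: measurable_cst.
exact: (measurable_time_integral mPhi Phi_mp mq iq).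
Qed.

(** A window has length [dl <= 1 <= n], so the period [2 * n] leaves a gap of at least [n] between
    windows. *)
Let start (j : nat) : R := (2 * n * j)%:R.

Let u_image x j :
  ((u (Phi (start j) x))%:E <= mu (image x (start j) (start j + dl)))%E.
Proof.
apply: (@le_trans _ _ (Num.max (time_integral Phi q dl (Phi (start j) x)) 0)%:E).
  by rewrite lee_fin /u ge_min lexx.
by rewrite EFin_max ge_max measure_ge0 andbT; exact: image_measure.
Qed.

Let sum_u_bound x (J : nat) (B : R) : 0 <= B ->
  (forall t, 0 <= t -> t <= start J -> `|g x t| <= B) ->
  \sum_(j < J) u (Phi (start j) x) <= 2 * B.
Proof.
move=> B0 gB; rewrite -lee_fin -sumEFin.
pose C j := image x (start j) (start j + dl).
have st0 j : 0 <= start j by rewrite /start.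
have mC j : measurable (C j : set (measurableTypeR R)).
  by apply: measurable_image => //; rewrite lerDl.
have startD i j : (i < j)%N -> start i + 2 * n%:R <= start j.
  move=> ij; rewrite /start -natrM -natrD ler_nat addnC.
  by rewrite -mulnS leq_mul2l ij orbT.
have n1 : 1 <= n%:R :> R by rewrite ler1n.
have tC : trivIset setT C.
  apply/trivIsetP => i j _ _; wlog ij : i j / (i < j)%N.
    move=> H ij; have [lij|lji|eij] := ltngtP i j; first exact: H.
      by rewrite setIC; apply: H => //; rewrite eq_sym.
    by rewrite eij eqxx in ij.
  move=> _; apply: image_disjoint => //; move: n1 dl1 (startD _ _ ij).
  by move: (n%:R : R) (start i) (start j) => *; lra.
apply: (@le_trans _ _ (\sum_(j < J) mu (C j))%E).
  by apply: lee_sum => j _; exact: u_image.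
rewrite -(@measure_bigsetU _ _ _ mu C mC tC J).
apply: (@le_trans _ _ (mu `[- B, B])).
  apply: le_measure; rewrite ?inE//; first exact: bigsetU_measurable.
  rewrite -bigcup_mkord => y [j /= jJ] [t [[t0 _] /=]].
  rewrite !in_itv/= => /andP[st ts] <-; rewrite -ler_norml; apply: gB => //.
  move: n1 dl1 ts (startD _ _ jJ).
  by move: (n%:R : R) (start j) (start J) => *; lra.
rewrite lebesgue_measure_itv/= lte_fin; case: ifP => _.
  by rewrite -EFinB lee_fin; lra.
by rewrite lee_fin; lra.
Qed.

(** By invariance the average of [u] over [J > 0] windows has the same integral as [u]; by
    [sum_u_bound] and the sublinear growth it tends to 0 almost everywhere. Hence [u] has integral
    0. *)
Lemma positive_average_null : {ae m, forall x, time_integral Phi q dl x <= 0}.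
Proof.
pose avu (J : nat) x := (\sum_(j < J) u (Phi (start j) x)) / J%:R.
have mavu J : measurable_fun setT (avu J).
  apply: measurable_funM; last exact: measurable_cst.
  apply: measurable_sum => j.
  exact: (measurableT_comp mu_ (measurable_flow mPhi _)).
have iu : m.-integrable setT (EFin \o u).
  apply: (le_integrable measurableT (g := EFin \o cst 1)).
  - exact/measurable_EFinP.
  - by move=> x _; rewrite lee_fin normr1 ger0_norm.
  - exact: finite_measure_integrable_cst.
have Eu_fin : (\int[m]_x (u x)%:E \is a fin_num)%E by exact: integrable_fin_num.
have Eavu J : (0 < J)%N -> (\int[m]_x (avu J x)%:E = \int[m]_x (u x)%:E)%E.
  move=> J0; transitivity
    (\int[m]_x ((J%:R^-1)%:E * \sum_(j < J) (u (Phi (start j) x))%:E))%E.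
    by apply: eq_integral => x _; rewrite sumEFin -EFinM mulrC.
  have muP j : measurable_fun setT (fun x => (u (Phi (start j) x))%:E).
    by apply/measurable_EFinP; exact: (measurableT_comp mu_ (measurable_flow mPhi _)).
  rewrite ge0_integralZl//; last 2 first.
  - exact: emeasurable_sum.
  - by move=> x _; apply: sume_ge0 => j _; rewrite lee_fin.
  rewrite ge0_integral_sum//; last by move=> j x _; rewrite lee_fin.
  rewrite (eq_bigr (fun _ => (fine (\int[m]_x (u x)%:E))%:E)); last first.
    move=> j _; rewrite fineK//.
    apply: (flow_ge0_integral mPhi Phi_mp (h := EFin \o u)); rewrite /start//.
    by apply/measurable_EFinP.
  rewrite sumEFin sumr_const card_ord -EFinM -[X in _ * X]mulr_natl mulKf ?fineK//.
  by rewrite pnatr_eq0 -lt0n.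
have avu_ge0 J x : 0 <= avu J x by rewrite divr_ge0// sumr_ge0.
have avu01 J x : `|avu J x| <= 1.
  rewrite ger0_norm//; case: J => [|J].
    by rewrite /avu invr0 mulr0.
  rewrite ler_pdivrMr// mul1r.
  apply: (@le_trans _ _ (\sum_(j < J.+1) 1)); first exact: ler_sum.
  by rewrite sumr_const card_ord.
have avu_cvg : {ae m, forall x, setT x -> (avu J x)%:E @[J --> \oo] --> 0%:E}.
  apply: filterS f_growth => x gx _.
  apply: cvg_EFin; first exact: nearW.
  apply/cvgrPdist_le => e e0.
  (* The [J] windows take time [2 * n * J], so [sum_u_bound] gives [4 * n * J / (i + 1) + 2 * |C|].
     With [8 * n / (i + 1) <= e] and [4 * |C| <= e * J] each term is at most [e * J / 2]. *)
  have n8 : 0 < 8 * n%:R :> R by rewrite mulr_gt0// ltr0n.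
  have [C HC] := gx (Num.trunc (8 * n%:R / e)).
  set i := Num.trunc _ in HC.
  have ie : 8 * n%:R * i.+1%:R^-1 <= e.
    rewrite ler_pdivrMr// -ler_pdivrMl// mulrC; apply: ltW.
    exact: truncnS_gt.
  exists (Num.trunc (4 * `|C| / e)).+1 => // J /= iJ.
  have J0 : 0 < J%:R :> R by rewrite ltr0n; exact: leq_trans iJ.
  have CJ : 4 * `|C| <= e * J%:R.
    rewrite -ler_pdivrMl// mulrC; apply: ltW.
    by apply: (lt_le_trans (truncnS_gt _)); rewrite ler_nat.
  rewrite sub0r normrN ger0_norm// ler_pdivrMr//.
  have st0 : 0 <= start J by rewrite /start.
  apply: (@le_trans _ _ (2 * (i.+1%:R^-1 * start J + `|C|))).
    apply: sum_u_bound; first by rewrite addr_ge0// mulr_ge0// invr_ge0.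
    move=> t t0 tJ; apply: (le_trans (HC t t0)); apply: lerD; last exact: ler_norm.
    by rewrite ler_wpM2l// invr_ge0.
  have : 8 * n%:R * i.+1%:R^-1 * J%:R <= e * J%:R by rewrite ler_wpM2r// ltW.
  rewrite /start !natrM; move: CJ; move: (i.+1%:R^-1 : R) (n%:R : R) (J%:R : R).
  by move=> I N J' *; lra.
have [] := @dominated_convergence _ _ _ m setT measurableT
  (fun J => EFin \o avu J) (EFin \o cst 0) (EFin \o cst 1).
- by move=> J; apply/measurable_EFinP.
- by apply/measurable_EFinP; exact: measurable_cst.
- exact: avu_cvg.
- exact: finite_measure_integrable_cst.
- by apply: aeW => x J _; rewrite lee_fin.
move=> _ _; rewrite integral0_eq// => H.
have Eu : (\int[m]_x (u x)%:E = 0)%E.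
  apply: cvg_unique H => //; apply: cvg_near_cst.
  by exists 1%N => // J /= J0; exact: Eavu.
have : (\int[m]_x `|(u x)%:E| = 0)%E.
  by rewrite -Eu; apply: eq_integral => x _; rewrite gee0_abs ?lee_fin.
move=> /ae_eq_integral_abs -/(_ measurableT) H0.
have /H0 : measurable_fun setT (EFin \o u) by apply/measurable_EFinP.
apply: filterS => x /(_ Logic.I)/= [ux]; rewrite leNgt; apply/negP => q0.
have : 0 < u x by rewrite /u lt_min ltr01 lt_max q0.
by rewrite ux ltxx.
Qed.

End window.

Let ae_flow (Q : set T) (t : R) : 0 <= t -> {ae m, forall x, Q x} ->
  {ae m, forall x, Q (Phi t x)}.
Proof.
move=> t0 [N [mN N0 QN]]; exists (Phi t @^-1` N); split.
- by rewrite -[X in measurable X]setTI; exact: (measurable_flow mPhi).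
- by rewrite Phi_mp.
- by move=> x nQ; exact: QN.
Qed.

(** The averages of [q] over all grid cells of almost every orbit are nonpositive, so [q <= 0] at
    almost every time in [[0, 1]]. As [q = f > 0] on [K], the orbit spends no time in [K], and the
    mean of that time is [m K]. *)
Lemma no_return_null : m K = 0%E.
Proof.
have q0 : {ae m, forall x, forall i j : nat,
    time_integral Phi q i.+1%:R^-1 (Phi (j%:R / i.+1%:R) x) <= 0}.
  apply: ae_foralln => i; apply: ae_foralln => j.
  apply: (@ae_flow [set y | time_integral Phi q i.+1%:R^-1 y <= 0]).
    by rewrite divr_ge0.
  by apply: positive_average_null; rewrite ?invr_ge0// invf_le1// ler1n.
have K0 : {ae m, forall x, (\int[mu]_(u in `[0%R, 1%R]) (\1_K (Phi u x))%:E = 0)%E}.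
  apply: filterS q0 => x qx.
  have qneg : {ae mu, forall u, 0 < u < 1 -> q (Phi u x) <= 0}.
    apply: (ae_le0_averages (LIq x 1)) => i j ji.
    have -> : (j%:R + 1) / i.+1%:R = j%:R / i.+1%:R + i.+1%:R^-1 :> R.
      by rewrite mulrDl mul1r.
    have j0 : 0 <= j%:R / i.+1%:R :> R by rewrite divr_ge0.
    have i0 : 0 <= i.+1%:R^-1 :> R by rewrite invr_ge0.
    rewrite -(time_integral_diff LIq)// ?lerDl//.
    by rewrite (time_integralD PhiD mPhi mq LIq)// addrAC subrr add0r.
  have mKo A : measurable (A : set (measurableTypeR R)) ->
      measurable_fun A (fun u => (\1_K (Phi u x))%:E : \bar R).
    move=> mA; apply: measurable_funTS; apply/measurable_EFinP.
    by apply: (measurable_orbit mPhi (h := \1_K)); exact: measurable_indic.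
  rewrite -integral_itv_bndo_bndc -?integral_itv_obnd_cbnd; do ?exact: mKo.
  rewrite -(integral0 mu `]0%R, 1%R[); apply: ae_eq_integral => //.
    exact: mKo.
  apply: filterS qneg; first exact: (ae_filter_ringOfSetsType mu).
  move=> u qu /=; rewrite in_itv/= => /qu.
  rewrite indicE; have [/set_mem Ku|//] := boolP (_ \in K).
  by rewrite /q indicE memNset//= mulr0 subr0 leNgt Kf.
have m1K : measurable_fun setT (\1_K : T -> R) by exact: measurable_indic.
have i1K : m.-integrable setT (EFin \o (\1_K : T -> R)) by exact: integrable_indic.
have LI1K x t : mu.-integrable `[0, t] (fun s => (\1_K (Phi s x))%:E).
  have mI : measurable (`[0, t]%classic : set (measurableTypeR R)) by [].
  apply: (measurable_bounded_integrable mI (f := fun s : measurableTypeR R =>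
    \1_K (Phi s x) : R)).
  - suff : (mu `[0%R, t] < +oo)%E by [].
    by rewrite lebesgue_measure_itv/=; case: ifP; rewrite ltry.
  - apply: measurable_funTS; exact: (measurable_orbit mPhi).
  - exists 1; split => // y y1 s _; apply: ltW; apply: le_lt_trans y1.
    by rewrite indicE; case: (_ \in _); rewrite ?normr1 ?normr0.
have := integral_time_integral mPhi Phi_mp m1K i1K LI1K ler01.
rewrite mul1e integral_indic// setIT => <-.
transitivity (\int[m]_x 0)%E; last exact: integral0.
apply: ae_eq_integral => //.
  by apply/measurable_EFinP; exact: (measurable_time_integral mPhi Phi_mp m1K i1K).
by apply: filterS K0 => x K0x _; rewrite /time_integral /Rintegral K0x.
Qed.

End no_return.

End recurrence.

(** * Arbitrary measurable sets and both signs of the observable *)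

Section semiflow_recurrence.
Context d (T : measurableType d) (R : realType) (m : probability T R).
Variable Phi : R -> T -> T.
Notation mu := (@lebesgue_measure R).
Hypotheses (Phi0 : forall x, Phi 0 x = x)
  (PhiD : forall (s t : R) x, 0 <= s -> 0 <= t ->
    Phi (s + t) x = Phi s (Phi t x))
  (mPhi : measurable_fun setT
    (fun z : measurableTypeR R * T => Phi z.1 z.2))
  (Phi_mp : forall (t : R) E, 0 <= t -> measurable E -> m (Phi t @^-1` E) = m E)
  (Phi_erg : forall B, measurable B ->
    (forall (t : R) x, 0 <= t -> B x -> B (Phi t x)) ->
    m B = 0%E \/ m B = 1%E)
  (Phi_reg : forall E (e : R), measurable E -> 0 < e ->
    exists K, [/\ K `<=` E, orbit_closed Phi K & (m (E `\` K) < e%:E)%E]).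

Lemma time_integralN (f : T -> R) (t : R) x :
  mu.-integrable `[0, t] (fun s => (f (Phi s x))%:E) ->
  time_integral Phi (fun y => - f y) t x = - time_integral Phi f t x.
Proof.
move=> LIf; rewrite /time_integral -mulN1r -RintegralZl//.
by apply: eq_Rintegral => s _; rewrite mulN1r.
Qed.

Section positive_part.
Variable f : T -> R.
Hypotheses (mf : measurable_fun setT f) (if_ : m.-integrable setT (EFin \o f))
  (LIf : forall x t, mu.-integrable `[0, t] (fun s => (f (Phi s x))%:E)).
Hypothesis f_growth : {ae m, forall x, forall i : nat, exists C, forall t : R,
  0 <= t -> `|time_integral Phi f t x| <= i.+1%:R^-1 * t + C}.

(** If the points of [K] without return had positive measure, they would contain a set [K'] closed
    along the orbits and still of positive measure. A return to [K'] is a return to [K], so [K'] has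
    none, against [no_return_null]. *)
Let closed_recurrence K (n : nat) : orbit_closed Phi K ->
  (forall x, K x -> 0 < f x) -> (0 < n)%N ->
  {ae m, forall x, K x -> zero_return Phi K f n%:R x}.
Proof.
move=> Kcl Kf n0; have mK := measurable_orbit_closed Phi0 Kcl.
have mret : measurable [set x | zero_return Phi K f n%:R x].
  apply: (measurable_zero_return mPhi Kcl _ LIf) => // t t0.
  exact: (measurable_time_integral mPhi Phi_mp mf if_).
pose L := K `\` [set x | zero_return Phi K f n%:R x].
have mL : measurable L by exact: measurableD.
suff L0 : m L = 0%E.
  by exists L; split => // x /= nH; split; [|move=> ?]; apply: contrapT => ?; apply: nH.
apply: contrapT => /eqP Ln0.
have L_fin : m L \is a fin_num by exact: fin_num_measure.
have L_gt0 : 0 < fine (m L) by rewrite fine_gt0// lt0e Ln0 measure_ge0 -ge0_fin_numE.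
have [K' [K'L K'cl K'm]] := Phi_reg mL L_gt0.
have mK' := measurable_orbit_closed Phi0 K'cl.
have K'0 : m K' = 0%E.
  apply: (no_return_null Phi0 PhiD mPhi Phi_mp mf if_ LIf f_growth K'cl _ n0).
    by move=> x /K'L[/Kf].
  move=> x /K'L[_ nret] [t [nt gt K't]]; apply: nret; exists t; split => //.
  by have [] := K'L _ K't.
move: K'm; rewrite fineK// measureD//=; last by rewrite ltey_eq L_fin.
by rewrite (setIidr K'L) K'0 sube0 ltxx.
Qed.

Lemma positive_recurrence A : measurable A ->
  {ae m, forall x, A x -> 0 < f x -> forall n : nat, zero_return Phi A f n%:R x}.
Proof.
move=> mA; pose E := A `&` [set x | 0 < f x].
have mE : measurable E.
  by apply: measurableI => //; apply: measurable_set_lt.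
have inv0 i : 0 < i.+1%:R^-1 :> R by rewrite invr_gt0.
have /choice[K HK] i := Phi_reg mE (inv0 i).
have mK i : measurable (K i).
  by have [_ Kcl _] := HK i; exact: measurable_orbit_closed Kcl.
(* The bound is [n.+1] because [closed_recurrence] asks for a positive one; a return after [n.+1] is
   also one after [n]. *)
have Krec : {ae m, forall x, forall i n : nat,
    K i x -> zero_return Phi (K i) f n.+1%:R x}.
  apply: ae_foralln => i; apply: ae_foralln => n; have [KE Kcl _] := HK i.
  by apply: closed_recurrence => // x /KE[].
have KU : {ae m, forall x, E x -> exists i, K i x}.
  exists (\bigcap_(i in [set: nat]) (E `\` K i)); split.
  - by apply: bigcapT_measurable => i; exact: measurableD.
  - apply/eqP; rewrite eq_le measure_ge0 andbT; apply/lee_addgt0Pr => e e0.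
    rewrite add0e.
    have [_ _ +] := HK (Num.trunc (e^-1)) => Ksmall.
    apply: (@le_trans _ _ (m (E `\` K (Num.trunc e^-1)))).
      apply: le_measure; rewrite ?inE//.
      - by apply: bigcapT_measurable => i; exact: measurableD.
      - exact: measurableD.
      - by move=> x; apply.
    apply: (le_trans (ltW Ksmall)); rewrite lee_fin ltW//.
    by rewrite -[ltRHS]invrK ltf_pV2 ?posrE ?invr_gt0// truncnS_gt.
  - move=> x /= nH i _; apply: contrapT => nEK; apply: nH => Ex.
    by exists i; apply: contrapT => nK; apply: nEK.
apply: filterS2 Krec KU => x Krecx KUx Ax fx n.
have [|i Kix] := KUx; first by [].
have [t [nt gt Kt]] := Krecx i n Kix; exists t; split => //.
  by apply: le_trans nt; rewrite ler_nat.
by have [KE _ _] := HK i; have [] := KE _ Kt.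
Qed.

End positive_part.

Variable f : T -> R.
Hypotheses (mf : measurable_fun setT f) (if_ : m.-integrable setT (EFin \o f))
  (LIf : forall x t, mu.-integrable `[0, t] (fun s => (f (Phi s x))%:E))
  (f0 : (\int[m]_x (f x)%:E = 0)%E).

(** The upper growth bounds of [f] and [- f] combine into the two-sided bound; [positive_recurrence]
    then treats the points with [f x > 0] directly and those with [f x < 0] through [- f], which has
    the same zero returns. *)
Theorem semiflow_recurrence A : measurable A ->
  {ae m, forall x, A x -> f x != 0 ->
    forall n : nat, zero_return Phi A f n%:R x}.
Proof.
move=> mA; pose f' x := - f x.
have mf' : measurable_fun setT f' by exact: measurable_funN.
have if' : m.-integrable setT (EFin \o f').
  by apply: (integrableN (f := EFin \o f)).
have LIf' x t : mu.-integrable `[0, t] (fun s => (f' (Phi s x))%:E).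
  exact: (integrableN (LIf x t)).
have f'0 : (\int[m]_x (f' x)%:E = 0)%E.
  transitivity (\int[m]_x ((-1)%:E * (f x)%:E))%E.
    by apply: eq_integral => x _; rewrite -EFinM mulN1r.
  by rewrite (integralZl _ if_)// f0 mule0.
have inv0 i : 0 < i.+1%:R^-1 :> R by rewrite invr_gt0.
have growth : {ae m, forall x, forall i : nat, exists C, forall t : R,
    0 <= t -> `|time_integral Phi f t x| <= i.+1%:R^-1 * t + C}.
  apply: ae_foralln => i.
  have H1 := time_integral_upper_growth PhiD mPhi Phi_mp Phi_erg mf if_ LIf f0 (inv0 i).
  have H2 := time_integral_upper_growth PhiD mPhi Phi_mp Phi_erg mf' if' LIf' f'0 (inv0 i).
  apply: filterS2 H1 H2 => x [C1 H1] [C2 H2]; exists (Num.max C1 C2) => t t0.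
  have := H2 t t0; rewrite time_integralN// => {}H2; have {}H1 := H1 t t0.
  rewrite ler_norml lerNl; apply/andP; split.
    by apply: (le_trans H2); rewrite lerD2l le_max lexx orbT.
  by apply: (le_trans H1); rewrite lerD2l le_max lexx.
have growth' : {ae m, forall x, forall i : nat, exists C, forall t : R,
    0 <= t -> `|time_integral Phi f' t x| <= i.+1%:R^-1 * t + C}.
  apply: filterS growth => x gx i; have [C HC] := gx i; exists C => t t0.
  by rewrite time_integralN// normrN; exact: HC.
have P1 := positive_recurrence mf if_ LIf growth mA.
have P2 := positive_recurrence mf' if' LIf' growth' mA.
apply: filterS2 P1 P2 => x P1 P2 Ax; rewrite neq_lt => /orP[fx|fx] n; last exact: P1.
have [|t [nt gt At]] := P2 Ax _ n; first by rewrite /f' oppr_gt0.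
exists t; split => //; move: gt; rewrite time_integralN// => /eqP.
by rewrite oppr_eq0 => /eqP.
Qed.

End semiflow_recurrence.

(** * Regularity of measures along fibres *)

(* K is the decreasing limit of the measurable sets U j, which are neighbourhoods
   of it along each fibre {a} x R; no topology on S is involved. *)
Definition fiber_closed d (S : measurableType d) (R : realType)
    (K : set (S * measurableTypeR R)) : Prop :=
  exists U : nat -> set (S * measurableTypeR R),
    [/\ forall j, measurable (U j),
        forall j, U j.+1 `<=` U j,
        forall a b j, K (a, b) -> exists2 e : R, 0 < e &
          forall b', `|b' - b| < e -> U j (a, b') &
        forall a b, ~ K (a, b) -> exists j, exists2 e : R, 0 < e &
          forall b', `|b' - b| < e -> ~ U j (a, b')].

Lemma nonincreasing_subset T (U : nat -> set T) : (forall j, U j.+1 `<=` U j) ->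
  forall i j, (i <= j)%N -> U j `<=` U i.
Proof.
move=> Udec i j; elim: j => [|j IH]; first by rewrite leqn0 => /eqP ->.
by rewrite leq_eqVlt => /orP[/eqP -> //|ij] x /Udec; exact: IH.
Qed.

Section fiber_closed.
Context d (S : measurableType d) (R : realType).
Let Om := (S * measurableTypeR R)%type.
Implicit Types (K E : set Om).

Lemma fiber_closed_fst (B : set S) : measurable B -> fiber_closed (fst @^-1` B : set Om).
Proof.
move=> mB; exists (fun=> fst @^-1` B); split.
- by move=> _; rewrite -[X in measurable X]setTI; exact: measurable_fst.
- by move=> _.
- by move=> a b _ Ka; exists 1.
- by move=> a b nKa; exists 0%N; exists 1.
Qed.

Lemma fiber_closed0 : fiber_closed (set0 : set Om).
Proof. by rewrite -(preimage_set0 fst); exact: fiber_closed_fst. Qed.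

Lemma fiber_closed_snd (C : nat -> set R) :
  (forall j, measurable (C j : set (measurableTypeR R))) ->
  (forall j, C j.+1 `<=` C j) -> (forall j, open (C j)) ->
  (forall b, ~ (\bigcap_(j in [set: nat]) C j) b ->
    exists j, ~ closure (C j) b) ->
  fiber_closed (snd @^-1` (\bigcap_(j in [set: nat]) C j) : set Om).
Proof.
move=> mC Cdec oC Cb; exists (fun j => snd @^-1` C j); split.
- by move=> j; rewrite -[X in measurable X]setTI; exact: measurable_snd.
- by move=> j x; exact: Cdec.
- move=> a b j Cjb; have /open_nbhs_nbhs/nbhs_ballP[e e0 H] : open_nbhs b (C j).
    by split; [exact: oC|exact: Cjb].
  by exists e => // b' bb'; apply: H; rewrite /ball /= distrC.
- move=> a b nCb; have [j nCj] := Cb _ nCb; exists j.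
  have : open (~` closure (C j)) by apply: closed_openC; exact: closed_closure.
  move=> oj; have /open_nbhs_nbhs/nbhs_ballP[e e0 H] : open_nbhs b (~` closure (C j)).
    by [].
  exists e => // b' bb' Cb'; apply: (H b'); first by rewrite /ball /= distrC.
  exact: subset_closure.
Qed.

Lemma fiber_closedU K E : fiber_closed K -> fiber_closed E -> fiber_closed (K `|` E).
Proof.
move=> [U [mU Udec KU nKU]] [V [mV Vdec EV nEV]].
exists (fun j => U j `|` V j); split.
- by move=> j; exact: measurableU.
- by move=> j; apply: setUSS.
- move=> a b j [Kab|Eab].
    by have [e e0 H] := KU a b j Kab; exists e => // b' bb'; left; exact: H.
  by have [e e0 H] := EV a b j Eab; exists e => // b' bb'; right; exact: H.
- move=> a b nKE.
  have [|i [e e0 H]] := nKU a b; first by move=> ?; apply: nKE; left.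
  have [|i' [e' e'0 H']] := nEV a b; first by move=> ?; apply: nKE; right.
  exists (maxn i i'), (Num.min e e'); first by rewrite lt_min e0.
  move=> b'; rewrite lt_min => /andP[bb' bb''] [UV|UV].
    by apply: (H b' bb'); apply: (nonincreasing_subset Udec (leq_maxl i i')).
  by apply: (H' b' bb''); apply: (nonincreasing_subset Vdec (leq_maxr i i')).
Qed.

Lemma fiber_closed_bigsetU (K : nat -> set Om) n :
  (forall i, fiber_closed (K i)) -> fiber_closed (\big[setU/set0]_(i < n) K i).
Proof.
move=> Kc; elim: n => [|n IH]; first by rewrite big_ord0; exact: fiber_closed0.
by rewrite big_ord_recr; exact: fiber_closedU.
Qed.

(** A diagonal choice: only finitely many of the sets enter the [j]-th neighbourhood, since
    neighbourhoods survive finite intersections only. *)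
Lemma fiber_closed_bigcap (K : nat -> set Om) :
  (forall i, fiber_closed (K i)) -> fiber_closed (\bigcap_(i in [set: nat]) K i).
Proof.
move=> /choice[U HU].
exists (fun j => [set x | forall i, (i <= j)%N -> U i j x]); split.
- move=> j; rewrite (_ : [set x | _] =
      \bigcap_(i in [set: nat]) (if (i <= j)%N then U i j else setT)).
    apply: bigcapT_measurable => i; case: ifP => // _.
    by have [mU _ _ _] := HU i.
  apply/seteqP; split => x Ux i; first by move=> _; case: ifP => // /Ux.
  by move=> ij; have := Ux i Logic.I; rewrite ij.
- move=> j x Ux i ij; have [_ Udec _ _] := HU i.
  by apply: Udec; apply: Ux; exact: leq_trans ij _.
- move=> a b j Kab.
  suff [e e0 H] : exists2 e : R, 0 < e & forall b', `|b' - b| < e ->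
      forall i, (i < j.+1)%N -> U i j (a, b').
    by exists e => // b' bb' i; exact: H.
  elim: j.+1 => [|k [e e0 IH]]; first by exists 1.
  have [_ _ KU _] := HU k.
  have [e' e'0 H'] := KU a b j (Kab k Logic.I).
  exists (Num.min e e'); first by rewrite lt_min e0.
  move=> b'; rewrite lt_min => /andP[bb' bb''] i.
  by rewrite ltnS leq_eqVlt => /orP[/eqP ->|]; [exact: H'|exact: IH].
- move=> a b nK; have [i nKi] : exists i, ~ K i (a, b).
    by apply/existsNP => H; apply: nK => i _; exact: H.
  have [_ Udec _ nKU] := HU i; have [j [e e0 H]] := nKU a b nKi.
  exists (maxn i j), e => // b' bb' Uab.
  apply: (H b' bb'); apply: (nonincreasing_subset Udec (leq_maxr i j)).
  by apply: Uab; rewrite leq_maxl.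
Qed.

Lemma fiber_closed_measurable K : fiber_closed K -> measurable K.
Proof.
move=> [U [mU _ KU nKU]].
have -> : K = \bigcap_(j in [set: nat]) U j; last exact: bigcapT_measurable.
apply/seteqP; split => -[a b].
  move=> Kab j _; have [e e0 H] := KU a b j Kab.
  by apply: H; rewrite subrr normr0.
move=> Uab; apply: contrapT => nK; have [j [e e0 H]] := nKU a b nK.
by apply: (H b); [rewrite subrr normr0|exact: Uab].
Qed.

Variable m : {finite_measure set Om -> \bar R}.

Let approx E := forall e : R, 0 < e ->
  exists K, [/\ K `<=` E, fiber_closed K & (m (E `\` K) < e%:E)%E].

Let approx_self K : fiber_closed K -> approx K.
Proof. by move=> Kc e e0; exists K; split => //; rewrite setDv measure0. Qed.

Let approx_seq (E : nat -> set Om) : (forall i, approx (E i)) ->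
  forall e : R, 0 < e -> exists K : nat -> set Om, forall i,
    [/\ K i `<=` E i, fiber_closed (K i) & (m (E i `\` K i) < (e / (2 ^ i.+1)%:R)%:E)%E].
Proof.
move=> Ea e e0; have /choice[K HK] i : exists K, [/\ K `<=` E i, fiber_closed K &
    (m (E i `\` K) < (e / (2 ^ i.+1)%:R)%:E)%E].
  by apply: Ea; rewrite divr_gt0// ltr0n expn_gt0.
by exists K.
Qed.

Let approx_sum (E K : nat -> set Om) (D : set Om) (e : R) : 0 < e ->
  measurable D -> (forall i, measurable (E i)) ->
  (forall i, [/\ K i `<=` E i, fiber_closed (K i) &
    (m (E i `\` K i) < (e / (2 ^ i.+1)%:R)%:E)%E]) ->
  D `<=` \bigcup_(i in [set: nat]) (E i `\` K i) -> (m D <= e%:E)%E.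
Proof.
move=> e0 mD mE HK DEK.
have mK i : measurable (K i) by apply: fiber_closed_measurable; have [] := HK i.
apply: le_trans (epsilon_trick0 xpredT (ltW e0)).
have mEK i : measurable (E i `\` K i) by exact: measurableD.
apply: (le_trans (@measure_sigma_subadditive _ _ _ m D _ mEK mD DEK)).
by apply: lee_nneseries => // i _; apply: ltW; have [] := HK i.
Qed.

Let approx_bigcap (E : nat -> set Om) : (forall i, measurable (E i)) ->
  (forall i, approx (E i)) -> approx (\bigcap_(i in [set: nat]) E i).
Proof.
move=> mE Ea e e0; have e20 : 0 < e / 2 by rewrite divr_gt0.
have [K HK] := approx_seq Ea e20.
have mK i : measurable (K i) by apply: fiber_closed_measurable; have [] := HK i.
exists (\bigcap_(i in [set: nat]) K i); split.
- by move=> x Kx i _; have [KE _ _] := HK i; apply: KE; exact: Kx.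
- by apply: fiber_closed_bigcap => i; have [] := HK i.
apply: (@le_lt_trans _ _ (e / 2)%:E); last by rewrite lte_fin; lra.
apply: (approx_sum e20 _ mE HK).
  by apply: measurableD; exact: bigcapT_measurable.
move=> x [Ex /existsNP[i nKi]]; have {}nKi : ~ K i x by move=> ?; apply: nKi.
by exists i => //; split => //; exact: Ex.
Qed.

(** An infinite union of the [K i] need not be closed; by continuity from above of the finite
    measure, a finite one is good enough. Half of [e] pays for the approximations, half for this
    truncation. *)
Let approx_bigcup (E : nat -> set Om) : (forall i, measurable (E i)) ->
  (forall i, approx (E i)) -> approx (\bigcup_(i in [set: nat]) E i).
Proof.
move=> mE Ea e e0; have e20 : 0 < e / 2 by rewrite divr_gt0.
have [K HK] := approx_seq Ea e20.
have mK i : measurable (K i) by apply: fiber_closed_measurable; have [] := HK i.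
pose D n := \bigcup_(i in [set: nat]) E i `\` \big[setU/set0]_(i < n) K i.
have mD n : measurable (D n).
  by apply: measurableD; [exact: bigcupT_measurable|exact: bigsetU_measurable].
have mDcap : measurable (\bigcap_(n in [set: nat]) D n) by exact: bigcapT_measurable.
have Dle : (m (\bigcap_(n in [set: nat]) D n) <= (e / 2)%:E)%E.
  apply: (approx_sum e20 mDcap mE HK) => x Dx.
  have [[i _ Eix] _] := Dx 0%N Logic.I; exists i => //; split => // Kix.
  have [_] := Dx i.+1 Logic.I; apply; rewrite -bigcup_mkord.
  by exists i => /=.
have Dcvg : m \o D @ \oo --> m (\bigcap_(n in [set: nat]) D n).
  apply: nonincreasing_cvg_mu => //.
    by rewrite ltey_eq fin_num_measure.
  apply/nonincreasing_seqP => n; apply/subsetPset => x [Ex nK]; split => // Kx.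
  by apply: nK; rewrite big_ord_recr; left.
have [N _ HN] : \forall n \near \oo, (m (D n) < e%:E)%E.
  have Dfin : m (\bigcap_(n in [set: nat]) D n) \is a fin_num by exact: fin_num_measure.
  move: Dcvg; rewrite -(fineK Dfin) => /fine_cvgP[_ /cvgrPdist_lt/(_ _ e20)].
  apply: filterS => n /=; rewrite ltr_distl => /andP[+ _].
  have : fine (m (\bigcap_(n in [set: nat]) D n)) <= e / 2.
    by rewrite -lee_fin fineK.
  move=> H1 H2; rewrite -[ltLHS]fineK ?fin_num_measure// lte_fin; lra.
exists (\big[setU/set0]_(i < N) K i); split.
- rewrite -bigcup_mkord => x [i _ Kx]; exists i => //.
  by have [KE _ _] := HK i; exact: KE.
- by apply: fiber_closed_bigsetU => i; have [] := HK i.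
- by apply: HN => /=.
Qed.

(** The usual class in proofs of regularity of finite measures; approximating the complement as well
    makes it stable under complements. *)
Let good := [set E : set Om | [/\ measurable E, approx E & approx (~` E)]].

Let good_sigma_algebra : sigma_algebra setT good.
Proof.
split.
- split => //; first exact: approx_self fiber_closed0.
  by rewrite setC0; apply: approx_self; rewrite -(preimage_setT fst); exact: fiber_closed_fst.
- move=> E [mE Ea nEa]; rewrite setTD; split => //; first exact: measurableC.
  by rewrite setCK.
- move=> E HE; split.
  + by apply: bigcupT_measurable => i; have [] := HE i.
  + by apply: approx_bigcup => i; have [] := HE i.
  + rewrite setC_bigcup; apply: approx_bigcap => i; have [? ? ?] := HE i => //.
    exact: measurableC.
Qed.

Let good_fst (B : set S) : measurable B -> good (fst @^-1` B).
Proof.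
move=> mB; split.
- by rewrite -[X in measurable X]setTI; exact: measurable_fst.
- exact/approx_self/fiber_closed_fst.
- by rewrite preimage_setC; apply/approx_self/fiber_closed_fst; exact: measurableC.
Qed.

Let fiber_closed_itvcy (c : R) : fiber_closed (snd @^-1` `[c, +oo[ : set Om).
Proof.
pose C j := `]c - j.+1%:R^-1, +oo[%classic.
have inv0 j : 0 < j.+1%:R^-1 :> R by rewrite invr_gt0.
have invS j : j.+2%:R^-1 <= j.+1%:R^-1 :> R by rewrite lef_pV2 ?posrE// ler_nat.
have Cb b : b < c -> exists j, b < c - j.+1%:R^-1.
  rewrite -subr_gt0 => bc; exists (Num.trunc (c - b)^-1).
  rewrite ltrBrDl -ltrBrDr -[ltRHS]invrK ltf_pV2 ?posrE ?invr_gt0//.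
  exact: truncnS_gt.
have -> : `[c, +oo[%classic = \bigcap_(j in [set: nat]) C j.
  apply/seteqP; split => b; rewrite /C /= in_itv/= andbT.
    by move=> cb j _; rewrite /= in_itv/= andbT (lt_le_trans _ cb)// gtrBl.
  move=> Hb; rewrite leNgt; apply/negP => /Cb[j bj].
  by have := Hb j Logic.I; rewrite /= in_itv/= andbT ltNge ltW.
apply: fiber_closed_snd => [j|j b|j|b nb].
- exact: measurable_itv.
- rewrite /C /= !in_itv/= !andbT; apply: le_lt_trans.
  by rewrite lerD2l lerN2.
- exact: interval_open.
- have {}/Cb[j bj] : b < c.
    rewrite ltNge; apply/negP => cb; apply: nb => j _.
    by rewrite /C /= in_itv/= andbT (lt_le_trans _ cb)// gtrBl.
  exists j; have -> : C j = [set x | c - j.+1%:R^-1 < x].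
    by apply/seteqP; split => x; rewrite /C /= in_itv/= andbT.
  by rewrite closure_gt /= leNgt bj.
Qed.

Let fiber_closed_itvNyc (c : R) : fiber_closed (snd @^-1` `]-oo, c] : set Om).
Proof.
pose C j := `]-oo, c + j.+1%:R^-1[%classic.
have inv0 j : 0 < j.+1%:R^-1 :> R by rewrite invr_gt0.
have invS j : j.+2%:R^-1 <= j.+1%:R^-1 :> R by rewrite lef_pV2 ?posrE// ler_nat.
have Cb b : c < b -> exists j, c + j.+1%:R^-1 < b.
  rewrite -subr_gt0 => bc; exists (Num.trunc (b - c)^-1).
  rewrite -ltrBrDl -[ltRHS]invrK ltf_pV2 ?posrE ?invr_gt0//.
  exact: truncnS_gt.
have -> : `]-oo, c]%classic = \bigcap_(j in [set: nat]) C j.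
  apply/seteqP; split => b; rewrite /C /= in_itv/=.
    by move=> cb j _; rewrite /= in_itv/= (le_lt_trans cb)// ltrDl.
  move=> Hb; rewrite leNgt; apply/negP => /Cb[j bj].
  by have := Hb j Logic.I; rewrite /= in_itv/= ltNge ltW.
apply: fiber_closed_snd => [j|j b|j|b nb].
- exact: measurable_itv.
- rewrite /C /= !in_itv/= => /lt_le_trans; apply.
  by rewrite lerD2l.
- exact: interval_open.
- have {}/Cb[j bj] : c < b.
    rewrite ltNge; apply/negP => cb; apply: nb => j _.
    by rewrite /C /= in_itv/= (le_lt_trans cb)// ltrDl.
  exists j; have -> : C j = [set x | x < c + j.+1%:R^-1].
    by apply/seteqP; split => x; rewrite /C /= in_itv/=.
  by rewrite closure_lt /= leNgt bj.
Qed.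

Let good_snd (C : set (measurableTypeR R)) : measurable C -> good (snd @^-1` C).
Proof.
pose G' := [set C : set R | good (snd @^-1` C)].
suff H : @measurable _ (measurableTypeR R) `<=` G' by exact: H.
rewrite [X in X `<=` _](RGenOInfty.measurableE R).
have [g0 gC gU] := good_sigma_algebra.
apply: smallest_sub.
  split.
  - by rewrite /G' /= preimage_set0.
  - by move=> A; rewrite /G' /= !setTD => /gC; rewrite setTD.
  - by move=> A HA; rewrite /G' /= preimage_bigcup; exact: gU.
move=> _ [x ->]; rewrite /G' /=; split.
- have mx : measurable (`]x, +oo[%classic : set (measurableTypeR R)) by [].
  by rewrite -[X in measurable X]setTI; exact: measurable_snd.
- have inv0 j : 0 < j.+1%:R^-1 :> R by rewrite invr_gt0.
  have -> : `]x, +oo[%classic =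
      \bigcup_(j in [set: nat]) `[x + j.+1%:R^-1, +oo[%classic.
    apply/seteqP; split => b /=; rewrite in_itv/= andbT.
      rewrite -subr_gt0 => bx; exists (Num.trunc (b - x)^-1) => //=.
      rewrite in_itv/= andbT -lerBrDl ltW//.
      rewrite -[ltRHS]invrK ltf_pV2 ?posrE ?invr_gt0//; exact: truncnS_gt.
    by move=> [j _ /=]; rewrite in_itv/= andbT; apply: lt_le_trans; rewrite ltrDl.
  rewrite preimage_bigcup; apply: approx_bigcup => j.
    exact: fiber_closed_measurable.
  exact: approx_self.
- rewrite preimage_setC; have -> : ~` `]x, +oo[ = `]-oo, x]%classic.
    by apply/seteqP; split => b /=; rewrite !in_itv/= andbT leNgt => /negP.
  exact: approx_self.
Qed.

Theorem fiber_closed_approximation E : measurable E ->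
  forall e : R, 0 < e ->
    exists K, [/\ K `<=` E, fiber_closed K & (m (E `\` K) < e%:E)%E].
Proof.
move=> mE; suff [] : good E by [].
have : measurable `<=` good.
  apply: smallest_sub; first exact good_sigma_algebra.
  move=> A [|] [B mB <-]; rewrite setTI; [exact: good_fst|exact: good_snd].
exact.
Qed.

End fiber_closed.

(** * Observables locally integrable along almost every orbit only *)

Section local_integrability.
Context d (T : measurableType d) (R : realType) (m : probability T R).
Variable Phi : R -> T -> T.
Notation mu := (@lebesgue_measure R).
Hypotheses (Phi0 : forall x, Phi 0 x = x)
  (PhiD : forall (s t : R) x, 0 <= s -> 0 <= t ->
    Phi (s + t) x = Phi s (Phi t x))
  (mPhi : measurable_fun setT
    (fun z : measurableTypeR R * T => Phi z.1 z.2))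
  (Phi_mp : forall (t : R) E, 0 <= t -> measurable E -> m (Phi t @^-1` E) = m E)
  (Phi_erg : forall B, measurable B ->
    (forall (t : R) x, 0 <= t -> B x -> B (Phi t x)) ->
    m B = 0%E \/ m B = 1%E)
  (Phi_reg : forall E (e : R), measurable E -> 0 < e ->
    exists K, [/\ K `<=` E, orbit_closed Phi K & (m (E `\` K) < e%:E)%E]).
Variable f : T -> R.
Hypotheses (mf : measurable_fun setT f) (if_ : m.-integrable setT (EFin \o f)).

Let I (n : nat) (x : T) : \bar R :=
  (\int[mu]_(s in `[0%R, n%:R]) (`|f (Phi s x)|)%:E)%E.

Let I_ge0 n x : (0 <= I n x)%E.
Proof. by apply: integral_ge0 => s _; rewrite lee_fin. Qed.

Let measurable_I n : measurable_fun setT (I n).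
Proof.
apply: (measurable_time_integral_ge0 mPhi _ (h := fun x => `|f x|)) => //.
exact: measurableT_comp.
Qed.

Definition locally_integrable_orbits : set T := [set x | forall n, (I n x < +oo)%E].
Let D := locally_integrable_orbits.

Lemma measurable_locally_integrable_orbits : measurable D.
Proof.
have -> : D = \bigcap_(n in [set: nat]) [set x | (I n x < +oo)%E].
  by apply/seteqP; split => x Dx n; [move=> _|]; exact: Dx.
apply: bigcapT_measurable => n; rewrite -[X in measurable X]setTI.
exact: emeasurable_fun_infty_o.
Qed.

Lemma locally_integrable_orbits_ae : {ae m, forall x, D x}.
Proof.
apply: ae_foralln => n.
have iI : m.-integrable setT (I n).
  apply/integrableP; split => //.
  under eq_integral do rewrite gee0_abs//.
  rewrite (integral_time_integral_ge0 mPhi Phi_mp (h := fun x => `|f x|))//.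
    have /integrableP[_ ?] := if_; exact: lte_mul_pinfty.
  exact: measurableT_comp.
have := integrable_ae measurableT iI; apply: filterS => x /(_ Logic.I).
by rewrite ge0_fin_numE.
Qed.

Lemma locally_integrable_orbitsP x (t : R) : D x ->
  mu.-integrable `[0, t] (fun s => (f (Phi s x))%:E).
Proof.
move=> Dx; have mI (a b : R) : measurable (`[a, b]%classic : set (measurableTypeR R)).
  by [].
have : mu.-integrable `[0, (Num.trunc t).+1%:R] (fun s => (f (Phi s x))%:E).
  apply/integrableP; split; last exact: (Dx (Num.trunc t).+1).
  by apply: measurable_funTS; apply/measurable_EFinP; exact: (measurable_orbit mPhi x mf).
apply: integrableS => // s; rewrite /= !in_itv/= => /andP[-> st] /=.
by rewrite (le_trans st)// ltW// truncnS_gt.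
Qed.

Lemma locally_integrable_orbits_flow x (t : R) : 0 <= t -> D x -> D (Phi t x).
Proof.
move=> t0 Dx n; have := locally_integrable_orbitsP (t + n%:R) Dx.
move=> /integrableP[mfx]; apply: le_lt_trans.
rewrite /I.
have -> : (\int[mu]_(s in `[0%R, n%:R]) (`|f (Phi s (Phi t x))|)%:E =
    \int[mu]_(s in `[0%R, n%:R]) `|(f (Phi (t + s)%R x))%:E|)%E.
  apply: eq_integral => s /set_mem; rewrite /= in_itv/= => /andP[s0 _].
  by rewrite addrC PhiD.
have mabs : measurable_fun setT
    (fun s : measurableTypeR R => `|(f (Phi s x))%:E|)%E.
  apply: measurableT_comp => //; apply/measurable_EFinP.
  exact: (measurable_orbit mPhi x mf).
rewrite (@integral_translation _ t 0 n%:R (fun s => `|(f (Phi s x))%:E|%E)); last first.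
  exact: measurable_funTS.
apply: ge0_subset_integral => //=; first exact: measurable_funTS.
by move=> s /=; rewrite !in_itv/= addr0 => /andP[ts ->]; rewrite (le_trans t0 ts).
Qed.

(* The orbits along which f is not locally integrable are frozen. *)
Let Phi' (t : R) (x : T) : T := if x \in D then Phi t x else x.
Let f' (x : T) : R := f x * \1_D x.

Let mD := measurable_locally_integrable_orbits.

Let Phi'_in x t : D x -> Phi' t x = Phi t x.
Proof. by move=> Dx; rewrite /Phi' mem_set. Qed.

Let Phi'_out x t : ~ D x -> Phi' t x = x.
Proof. by move=> Dx; rewrite /Phi' memNset. Qed.

Let Phi'0 x : Phi' 0 x = x.
Proof. by rewrite /Phi' Phi0; case: ifP. Qed.

Let Phi'D (s t : R) x : 0 <= s -> 0 <= t -> Phi' (s + t) x = Phi' s (Phi' t x).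
Proof.
move=> s0 t0; have [Dx|nDx] := pselect (D x); last by rewrite !Phi'_out.
by rewrite !Phi'_in ?PhiD//; exact: locally_integrable_orbits_flow.
Qed.

Let mPhi' : measurable_fun setT (fun z : measurableTypeR R * T => Phi' z.1 z.2).
Proof.
rewrite (_ : (fun z => _) = (fun z : measurableTypeR R * T =>
  if z.2 \in D then Phi z.1 z.2 else z.2)) //.
apply: measurable_fun_ifT => //.
apply: (measurable_fun_bool true); rewrite setTI.
rewrite (_ : _ @^-1` _ = snd @^-1` D).
  by rewrite -[X in measurable X]setTI; exact: measurable_snd.
by apply/seteqP; split => z /=; [exact: set_mem|exact: mem_set].
Qed.

Let nD0 : m (~` D) = 0%E.
Proof.
have [N [mN N0 DN]] := locally_integrable_orbits_ae.
apply/eqP; rewrite eq_le measure_ge0 andbT -N0; apply: le_measure; rewrite ?inE//.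
exact: measurableC.
Qed.

Let m_D E : measurable E -> m (E `&` D) = m E.
Proof.
move=> mE; rewrite -[E in RHS](setUIDK E D) measureU//; last 3 first.
- exact: measurableI.
- exact: measurableD.
- by rewrite -subset0 => x [[_ Dx] [_ nDx]].
rewrite [X in (_ + X)%E](_ : _ = 0%E) ?adde0//.
apply/eqP; rewrite eq_le measure_ge0 andbT -nD0.
by apply: le_measure; rewrite ?inE//; [exact: measurableD|exact: measurableC].
Qed.

Let Phi'_mp (t : R) E : 0 <= t -> measurable E -> m (Phi' t @^-1` E) = m E.
Proof.
move=> t0 mE; have mPE : measurable (Phi' t @^-1` E).
  by rewrite -[X in measurable X]setTI; exact: (measurable_flow mPhi').
have mPE' : measurable (Phi t @^-1` E).
  by rewrite -[X in measurable X]setTI; exact: (measurable_flow mPhi).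
rewrite -m_D// -(Phi_mp t0 mE) -[RHS]m_D//; congr (m _).
by apply/seteqP; split => x /= [Ex Dx]; split => //; move: Ex; rewrite Phi'_in.
Qed.

Let Phi'_erg B : measurable B ->
  (forall (t : R) x, 0 <= t -> B x -> B (Phi' t x)) -> m B = 0%E \/ m B = 1%E.
Proof.
move=> mB Binv; rewrite -m_D//; apply: Phi_erg; first exact: measurableI.
move=> t x t0 [Bx Dx]; split; last exact: locally_integrable_orbits_flow.
by rewrite -Phi'_in//; exact: Binv.
Qed.

(** The approximating set is taken inside [D], so that a frozen orbit never meets it. *)
Let Phi'_reg E (e : R) : measurable E -> 0 < e ->
  exists K, [/\ K `<=` E, orbit_closed Phi' K & (m (E `\` K) < e%:E)%E].
Proof.
move=> mE e0; have [K [KED Kcl Km]] := Phi_reg (measurableI _ _ mE mD) e0.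
have mK := measurable_orbit_closed Phi0 Kcl.
exists K; split.
- by move=> x /KED[].
- have [U [mU Udec KU nKU]] := Kcl; exists U; split => //.
    move=> x t j t0; have [Dx|nDx] := pselect (D x); last first.
      by rewrite Phi'_out// => /KED[].
    rewrite Phi'_in// => /(KU _ _ j t0)[b b0 H]; exists b => // s ts st.
    by rewrite Phi'_in//; exact: H.
  move=> x t t0; have [Dx|nDx] := pselect (D x).
    rewrite Phi'_in// => /(nKU _ _ t0)[j [b b0 H]]; exists j, b => // s s0 st.
    by rewrite Phi'_in//; exact: H.
  rewrite Phi'_out// => nKx; have := nKU x 0 (lexx 0); rewrite Phi0.
  move=> /(_ nKx)[j [b b0 H]]; exists j, 1 => // s _ _; rewrite Phi'_out//.
  by have := H 0 (lexx 0); rewrite Phi0 subrr normr0; apply.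
- rewrite -m_D; last exact: measurableD.
  suff -> : (E `\` K) `&` D = (E `&` D) `\` K by [].
  by apply/seteqP; split => x [[? ?] ?].
Qed.

Let mf' : measurable_fun setT f'.
Proof. by apply: measurable_funM => //; exact: measurable_indic. Qed.

Let if' : m.-integrable setT (EFin \o f').
Proof.
apply: le_integrable if_ => //; first exact/measurable_EFinP.
move=> x _; rewrite lee_fin normrM indicE.
by case: (_ \in _); rewrite ?normr1 ?normr0 ?mulr1 ?mulr0.
Qed.

Let f'E x : D x -> f' x = f x.
Proof. by move=> Dx; rewrite /f' indicE mem_set// mulr1. Qed.

Let LIf' x t : mu.-integrable `[0, t] (fun s => (f' (Phi' s x))%:E).
Proof.
have mI : measurable (`[0, t]%classic : set (measurableTypeR R)) by [].
have [Dx|nDx] := pselect (D x).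
  apply: eq_integrable (locally_integrable_orbitsP t Dx) => //.
  move=> s /set_mem; rewrite /= in_itv/= => /andP[s0 _].
  by rewrite Phi'_in// f'E//; exact: locally_integrable_orbits_flow.
rewrite (_ : (fun s => _) = cst 0%E); first exact: integrable0.
by apply/funext => s; rewrite Phi'_out// /f' indicE memNset// mulr0.
Qed.

Lemma semiflow_recurrence_ae : (\int[m]_x (f x)%:E = 0)%E ->
  forall A, measurable A ->
  {ae m, forall x, A x -> f x != 0 ->
    forall n : nat, zero_return Phi A f n%:R x}.
Proof.
move=> f0 A mA; have f'0 : (\int[m]_x (f' x)%:E = 0)%E.
  rewrite -f0; apply: ae_eq_integral => //; first exact/measurable_EFinP.
    exact/measurable_EFinP.
  by apply: filterS locally_integrable_orbits_ae => x Dx _; rewrite f'E.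
have := semiflow_recurrence Phi'0 Phi'D mPhi' Phi'_mp Phi'_erg Phi'_reg mf' if' LIf' f'0 mA.
apply: filterS2 locally_integrable_orbits_ae => x Dx H Ax fx n.
have [|t [nt gt At]] := H Ax _ n; first by rewrite f'E.
have t0 : 0 <= t by exact: le_trans nt.
exists t; split => //; last by rewrite -Phi'_in.
rewrite -gt; apply: eq_Rintegral => s /set_mem; rewrite /= in_itv/= => /andP[s0 _].
by rewrite Phi'_in// f'E//; exact: locally_integrable_orbits_flow.
Qed.

End local_integrability.

(** * Suspension semiflows *)

Section skew_product.
Context d (S : measurableType d) (R : realType).
Variable nu : {sigma_finite_measure set S -> \bar R}.
Notation lam := (@lebesgue_measure R).
Variables (p : S -> S) (g : S -> R).
Hypotheses (mp : measurable_fun setT p) (mg : measurable_fun setT g)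
  (nup : forall B, measurable B -> nu (p @^-1` B) = nu B).

Definition skew (x : S * measurableTypeR R) : S * measurableTypeR R :=
  (p x.1, x.2 + g x.1).

Lemma measurable_skew : measurable_fun setT skew.
Proof.
apply: measurable_fun_pair => /=; first exact: measurableT_comp.
by apply: measurable_funD => //; exact: measurableT_comp.
Qed.

(** Each section of [F] is translated, which keeps its Lebesgue measure, and the base is moved by
    [p], which keeps [nu]. *)
Lemma skew_mp (F : set (S * measurableTypeR R)) : measurable F ->
  (nu \x lam)%E (skew @^-1` F) = (nu \x lam)%E F.
Proof.
move=> mF; rewrite /product_measure1.
have mphi : measurable_fun setT (lam \o xsection F) by exact: measurable_fun_xsection.
rewrite -[RHS](mp_ge0_integral mp nup (D := setT))//.
rewrite preimage_setT; apply: eq_integral => a _ /=.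
rewrite -[RHS](lebesgue_translation (g a)); last exact: measurable_xsection.
congr (lam _); apply/seteqP; split => u /=; rewrite /xsection /= !inE /skew /=;
  by rewrite addrC.
Qed.

End skew_product.

Section suspension.
Context d (S : measurableType d) (R : realType).
Variable nu : {sigma_finite_measure set S -> \bar R}.
Notation lam := (@lebesgue_measure R).
Variables (P Q : S -> S) (r : S -> R) (Y : set S).
Hypotheses (PK : cancel P Q) (QK : cancel Q P)
  (mP : measurable_fun setT P) (mQ : measurable_fun setT Q)
  (nuP : forall B, measurable B -> nu (P @^-1` B) = nu B)
  (mr : measurable_fun setT r) (r_ge0 : forall a, 0 <= r a)
  (mY : measurable Y) (YP : forall a, Y (P a) <-> Y a).
Let T := (S * measurableTypeR R)%type.

Definition roof_sum (n : nat) (a : S) : R := \sum_(k < n) r (iter k P a).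

(** The roofs over [Q a], ..., [iter n Q a]: the time needed to come down from [(a, 0)] through [n]
    floors. The roof over [a] itself does not count. *)
Definition past_sum (n : nat) (a : S) : R := roof_sum n (iter n Q a).

Lemma roof_sum0 a : roof_sum 0 a = 0.
Proof. by rewrite /roof_sum big_ord0. Qed.

Lemma roof_sumSr n a : roof_sum n.+1 a = roof_sum n a + r (iter n P a).
Proof. by rewrite /roof_sum big_ord_recr. Qed.

Lemma roof_sumD n k a : roof_sum (n + k) a = roof_sum n a + roof_sum k (iter n P a).
Proof.
elim: k => [|k IH]; first by rewrite addn0 roof_sum0 addr0.
by rewrite addnS !roof_sumSr IH -addrA -iterD addnC.
Qed.

Lemma roof_sumS n a : roof_sum n.+1 a = r a + roof_sum n (P a).
Proof. by rewrite -add1n roof_sumD roof_sumSr roof_sum0 add0r. Qed.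

Lemma roof_sum_le n k a : (n <= k)%N -> roof_sum n a <= roof_sum k a.
Proof.
move=> nk; rewrite -(subnK nk) addnC roof_sumD lerDl.
by apply: sumr_ge0 => i _; exact: r_ge0.
Qed.

Lemma iterPK n : cancel (iter n P) (iter n Q).
Proof. by elim: n => // n IH a; rewrite iterSr /= PK IH. Qed.

Lemma iterQK n : cancel (iter n Q) (iter n P).
Proof. by elim: n => // n IH a; rewrite iterSr /= QK IH. Qed.

Lemma past_sumS n a : past_sum n.+1 a = r (iter n.+1 Q a) + past_sum n a.
Proof. by rewrite /past_sum roof_sumS [in P _]iterS QK. Qed.

Lemma past_sumSr n a : past_sum n.+1 a = past_sum n (Q a) + r (Q a).
Proof. by rewrite /past_sum roof_sumSr iterSr iterQK. Qed.

Lemma past_sum_le n k a : (n <= k)%N -> past_sum n a <= past_sum k a.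
Proof.
elim: k => [|k IH]; first by rewrite leqn0 => /eqP ->.
rewrite leq_eqVlt => /orP[/eqP -> //|nk].
by rewrite past_sumS (le_trans (IH nk))// lerDr.
Qed.

(* The base points above which the flow is defined for all positive and negative
   times. *)
Definition recurrent_base : set S := [set a | Y a /\
  ((forall C : nat, exists n, C%:R < roof_sum n a) /\
   (forall C : nat, exists n, C%:R < past_sum n a))].

Let natD_gt (C : nat) (b : R) : (C%:R + b < (C + (Num.trunc b).+1)%:R)%R.
Proof. by rewrite natrD ltrD2l truncnS_gt. Qed.

Lemma recurrent_baseP a : recurrent_base a -> recurrent_base (P a).
Proof.
move=> [Ya [Fa Pa]]; split; first exact/YP.
split=> C; have [n Hn] := Fa (C + (Num.trunc (r a)).+1)%N.
  exists n; have := roof_sum_le a (leqnSn n); rewrite roof_sumS.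
  have := natD_gt C (r a); lra.
have [k Hk] := Pa C; exists k.+1; rewrite past_sumSr PK.
by rewrite (lt_le_trans Hk)// lerDl.
Qed.

Lemma recurrent_baseQ a : recurrent_base a -> recurrent_base (Q a).
Proof.
move=> [Ya [Fa Pa]]; split; first by apply/YP; rewrite QK.
split=> C.
  have [n Hn] := Fa C; exists n.+1.
  by rewrite roof_sumS QK (lt_le_trans Hn)// lerDr.
have [n Hn] := Pa (C + (Num.trunc (r (Q a))).+1)%N; exists n.
have := past_sum_le a (leqnSn n); rewrite past_sumSr.
have := natD_gt C (r (Q a)); lra.
Qed.

Lemma recurrent_base_iterP n a : recurrent_base a -> recurrent_base (iter n P a).
Proof. by move=> Ya; elim: n => // n; exact: recurrent_baseP. Qed.

Lemma recurrent_base_iterQ n a : recurrent_base a -> recurrent_base (iter n Q a).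
Proof. by move=> Ya; elim: n => // n; exact: recurrent_baseQ. Qed.

Lemma measurable_iterP n : measurable_fun setT (iter n P).
Proof.
elim: n => [|n IH]; first exact: measurable_id.
exact: (measurableT_comp mP IH).
Qed.

Lemma measurable_iterQ n : measurable_fun setT (iter n Q).
Proof.
elim: n => [|n IH]; first exact: measurable_id.
exact: (measurableT_comp mQ IH).
Qed.

Lemma measurable_roof_sum n : measurable_fun setT (roof_sum n).
Proof.
apply: measurable_sum => k; apply: measurableT_comp => //.
exact: measurable_iterP.
Qed.

Lemma measurable_past_sum n : measurable_fun setT (past_sum n).
Proof.
exact: (measurableT_comp (measurable_roof_sum n) (measurable_iterQ n)).
Qed.

Lemma measurable_recurrent_base : measurable recurrent_base.
Proof.
have mdiv (F : nat -> S -> R) : (forall n, measurable_fun setT (F n)) ->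
    measurable [set a | forall C : nat, exists n, C%:R < F n a].
  move=> mF; rewrite (_ : [set a | _] = \bigcap_(C in [set: nat])
      \bigcup_(n in [set: nat]) [set a | C%:R < F n a]).
    apply: bigcapT_measurable => C; apply: bigcupT_measurable => n.
    exact: measurable_set_lt.
  apply/seteqP; split => a Ha C; first by move=> _; have [n ?] := Ha C; exists n.
  by have [n _ ?] := Ha C Logic.I; exists n.
apply: measurableI => //; apply: measurableI; apply: mdiv => n.
  exact: measurable_roof_sum.
exact: measurable_past_sum.
Qed.

Definition suspension : set T :=
  [set x | recurrent_base x.1 /\ 0 <= x.2 < r x.1].

Lemma measurable_suspension : measurable suspension.
Proof.
have m1 : measurable_fun setT (fun x : T => r x.1) by exact: measurableT_comp.
have m2 : measurable_fun setT (fun x : T => x.2) by exact: measurable_snd.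
rewrite (_ : suspension = (fst @^-1` recurrent_base) `&`
    ((~` [set x : T | x.2 < 0]) `&` [set x : T | x.2 < r x.1])).
  apply: measurableI.
    rewrite -[X in measurable X]setTI; apply: measurable_fst => //.
    exact: measurable_recurrent_base.
  apply: measurableI; last exact: measurable_set_lt.
  by apply: measurableC; exact: measurable_set_lt.
apply/seteqP; split => x /= [Yx].
  by move=> /andP[x0 xr]; split => //; split => //; apply/negP; rewrite -leNgt.
by move=> [/negP x0 xr]; split => //; rewrite leNgt x0.
Qed.

(** The number of passages through the roof at total height [u]; the default 0 is not reached when
    [a] is in [recurrent_base] and [u >= 0]. *)
Definition level (a : S) (u : R) : nat :=
  xget 0%N [set n | roof_sum n a <= u < roof_sum n.+1 a].

Lemma level_unique a u n : roof_sum n a <= u < roof_sum n.+1 a -> level a u = n.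
Proof.
move=> nu_; rewrite /level; case: xgetP => [k _ /= |/(_ n)//].
move: nu_ => /andP[n1 n2] /andP[k1 k2]; apply/eqP; rewrite eqn_leq.
apply/andP; split; rewrite leqNgt; apply/negP => lt.
  by have := roof_sum_le a lt; lra.
by have := roof_sum_le a lt; lra.
Qed.

Lemma levelP a u : recurrent_base a -> 0 <= u ->
  roof_sum (level a u) a <= u < roof_sum (level a u).+1 a.
Proof.
move=> [_ [Fa _]] u0.
have ex : exists n, u < roof_sum n a.
  have [n Hn] := Fa (Num.trunc u).+1; exists n.
  by rewrite (lt_trans (truncnS_gt u)).
case: (ex_minnP ex) => -[|n] un min; first by move: un; rewrite roof_sum0 ltNge u0.
suff H : roof_sum n a <= u < roof_sum n.+1 a by rewrite (level_unique H).
by rewrite un andbT leNgt; apply/negP => /min; rewrite ltnn.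
Qed.

(** Made total by freezing the points off [suspension], which keeps the semigroup law; for negative
    times it is a mere convention. *)
Definition suspension_flow (t : R) (x : T) : T :=
  if (0 <= t) && (x \in suspension) then
    let n := level x.1 (x.2 + t) in
    (iter n P x.1, x.2 + t - roof_sum n x.1)
  else x.

Local Notation Phi := suspension_flow.

Lemma suspension_flow_out t x : ~ suspension x -> Phi t x = x.
Proof. by move=> nx; rewrite /Phi memNset// andbF. Qed.

Lemma suspension_flowE t x n : 0 <= t -> suspension x ->
  roof_sum n x.1 <= x.2 + t < roof_sum n.+1 x.1 ->
  Phi t x = (iter n P x.1, x.2 + t - roof_sum n x.1).
Proof. by move=> t0 Xx H; rewrite /Phi t0 mem_set//= (level_unique H). Qed.

Lemma suspension_flowP t x : 0 <= t -> suspension x ->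
  exists2 n, roof_sum n x.1 <= x.2 + t < roof_sum n.+1 x.1 &
    Phi t x = (iter n P x.1, x.2 + t - roof_sum n x.1).
Proof.
move=> t0 Xx; have [Yx /andP[x0 xr]] := Xx.
have /(levelP Yx) H : 0 <= x.2 + t by rewrite addr_ge0.
by exists (level x.1 (x.2 + t)) => //; exact: suspension_flowE.
Qed.

Lemma suspension_flow_in t x : 0 <= t -> suspension x -> suspension (Phi t x).
Proof.
move=> t0 Xx; have [n /andP[n1 n2] ->] := suspension_flowP t0 Xx.
split => /=; first by apply: recurrent_base_iterP; have [] := Xx.
by rewrite subr_ge0 n1/= ltrBlDl -roof_sumSr.
Qed.

Lemma suspension_flow0 x : Phi 0 x = x.
Proof.
have [Xx|nXx] := pselect (suspension x); last exact: suspension_flow_out.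
have [Yx /andP[x0 xr]] := Xx.
rewrite (suspension_flowE (lexx 0) Xx (n := 0%N)).
  by rewrite roof_sum0 subr0 addr0 /=; case: x {Xx Yx x0 xr}.
by rewrite roof_sumSr roof_sum0 add0r addr0 x0.
Qed.

Lemma suspension_flowD (s t : R) x : 0 <= s -> 0 <= t ->
  Phi (s + t) x = Phi s (Phi t x).
Proof.
move=> s0 t0; have [Xx|nXx] := pselect (suspension x); last first.
  by rewrite !suspension_flow_out.
have Xtx := suspension_flow_in t0 Xx.
have [n /andP[n1 n2] E] := suspension_flowP t0 Xx.
have [k /andP[k1 k2] ->] := suspension_flowP s0 Xtx.
move: k1 k2; rewrite E /= => k1 k2.
rewrite (suspension_flowE (n := (n + k)%N) _ Xx) ?addr_ge0//.
  by rewrite [in iter _ P _]addnC iterD roof_sumD; congr pair; lra.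
by rewrite -addnS !roof_sumD; apply/andP; split; lra.
Qed.

(** The pairs of time and point split into countably many measurable pieces, by the number of
    passages, with an explicit measurable formula on each. *)
Lemma measurable_suspension_flow :
  measurable_fun setT (fun z : measurableTypeR R * T => Phi z.1 z.2).
Proof.
pose psi n (z : measurableTypeR R * T) : T :=
  (iter n P z.2.1, z.2.2 + z.1 - roof_sum n z.2.1).
have m21 : measurable_fun setT (fun z : measurableTypeR R * T => z.2.1).
  by apply: (measurableT_comp measurable_fst).
have m221 : measurable_fun setT (fun z : measurableTypeR R * T => z.2.2 + z.1 : R).
  by apply: measurable_funD => //; apply: (measurableT_comp measurable_snd).
have mroof n : measurable_fun setT
    (fun z : measurableTypeR R * T => roof_sum n z.2.1).
  exact: (measurableT_comp (measurable_roof_sum n)).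
have mpsi n : measurable_fun setT (psi n).
  apply: measurable_fun_pair; first exact: (measurableT_comp (measurable_iterP n)).
  exact: measurable_funB.
pose D := [set z : measurableTypeR R * T | ~ (z.1 < 0) /\ suspension z.2].
have mD : measurable D.
  apply: measurableI; first by apply: measurableC; exact: measurable_set_lt.
  rewrite -[X in measurable X]setTI; apply: measurable_snd => //.
  exact: measurable_suspension.
pose C n := [set z : measurableTypeR R * T |
  ~ (z.2.2 + z.1 < roof_sum n z.2.1) /\ z.2.2 + z.1 < roof_sum n.+1 z.2.1].
have mC n : measurable (C n).
  by apply: measurableI; [apply: measurableC|]; exact: measurable_set_lt.
move=> _ E mE; rewrite setTI.
rewrite (_ : _ @^-1` E = (\bigcup_(n in [set: nat]) (D `&` C n `&` psi n @^-1` E))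
    `|` (~` D `&` snd @^-1` E)).
  apply: measurableU.
    apply: bigcupT_measurable => n; apply: measurableI; first exact: measurableI.
    by rewrite -[X in measurable X]setTI; exact: mpsi.
  apply: measurableI; first exact: measurableC.
  by rewrite -[X in measurable X]setTI; exact: measurable_snd.
apply/seteqP; split => z /=.
  move=> Ez; have [[/negP z0 Xz]|nDz] := pselect (D z); last first.
    right; split => //; move: Ez; rewrite /Phi; case: ifP => // /andP[z0 /set_mem Xz].
    by exfalso; apply: nDz; split => //; apply/negP; rewrite -leNgt.
  rewrite -leNgt in z0; left.
  have [n /andP[n1 n2] E'] := suspension_flowP z0 Xz; exists n => //.
  rewrite E' in Ez; split => //; split.
    by split => //; apply/negP; rewrite -leNgt.
  by split => //; apply/negP; rewrite -leNgt.
move=> [[n _ [[[/negP z0 Xz] [/negP n1 n2]] Ez]]|[nDz Ez]].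
  rewrite -leNgt in z0; rewrite -leNgt in n1.
  by rewrite (suspension_flowE z0 Xz (n := n)) ?n1.
rewrite /Phi; case: ifP => // /andP[z0 /set_mem Xz].
by exfalso; apply: nDz; split => //; apply/negP; rewrite -leNgt.
Qed.

(** The [n]-th branch of the inverse of the time-[t] map: going down through [n] floors. *)
Let theta (n : nat) (t : R) (y : T) : T :=
  (iter n Q y.1, y.2 - t + past_sum n y.1).

Let flow_theta (t : R) y n : 0 <= t -> suspension y -> suspension (theta n t y) ->
  Phi t (theta n t y) = y.
Proof.
move=> t0 [Yy /andP[y0 yr]] Xth; rewrite (suspension_flowE t0 Xth (n := n)).
  rewrite /= iterQK -/(past_sum n y.1); case: y {Yy y0 yr Xth} => a b /=.
  by congr pair; lra.
by rewrite /= roof_sumSr iterQK -/(past_sum n y.1); apply/andP; split; lra.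
Qed.

Let theta_unique (t : R) y n k : suspension (theta n t y) -> suspension (theta k t y) ->
  n = k.
Proof.
wlog nk : n k / (n < k)%N.
  move=> H Hn Hk; have [lt|lt|//] := ltngtP n k; first exact: H.
  by apply/esym/H.
case: k nk => // k nk [_ /= /andP[n1 _]] [_ /= /andP[_]].
rewrite past_sumS /= => k1; have pnk := past_sum_le y.1 (nk : (n <= k)%N).
by exfalso; clear nk; lra.
Qed.

(** The branch that lands in the suspension belongs to the least [n] whose past sum makes up for
    [t - y.2]; it exists because past sums are unbounded over [recurrent_base]. *)
Lemma suspension_flow_surj (t : R) y : 0 <= t -> suspension y ->
  exists2 x, suspension x & Phi t x = y.
Proof.
move=> t0 Xy; have [Yy /andP[y0 yr]] := Xy.
have ex : exists n, t - y.2 <= past_sum n y.1.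
  have [_ [_ Pa]] := Yy; have [n Hn] := Pa (Num.trunc (t - y.2)).+1; exists n.
  by rewrite ltW// (lt_trans (truncnS_gt _)).
have [n Hn Hmin] := ex_minnP ex.
have Xth : suspension (theta n t y).
  split; first exact: recurrent_base_iterQ.
  apply/andP; split => /=; first by lra.
  case: n Hn Hmin => [|n] Hn Hmin.
    by rewrite /past_sum roof_sum0 /=; lra.
  rewrite past_sumS /=; have : past_sum n y.1 < t - y.2.
    by rewrite ltNge; apply/negP => /Hmin; rewrite ltnn.
  lra.
by exists (theta n t y) => //; exact: flow_theta.
Qed.

(** After time [t] the orbit stays in its fibre for a while, and so it does before [t], except that
    an arrival at the base comes from the graph of the roof. The left limit is then a point of the
    graph, which is off [suspension] and therefore off [K]. *)
Lemma fiber_closed_orbit_closed K : fiber_closed K -> K `<=` suspension ->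
  orbit_closed Phi K.
Proof.
move=> [U [mU Udec KU nKU]] KX.
have right x (t : R) : 0 <= t -> suspension x -> forall s, t <= s ->
    s - t < r (Phi t x).1 - (Phi t x).2 ->
    Phi s x = ((Phi t x).1, (Phi t x).2 + (s - t)).
  move=> t0 Xx s ts st; have Xtx := suspension_flow_in t0 Xx.
  have -> : s = (s - t) + t by rewrite subrK.
  have st0 : 0 <= s - t by rewrite subr_ge0.
  rewrite suspension_flowD// (suspension_flowE st0 Xtx (n := 0%N)).
    by rewrite roof_sum0 subr0 addrK.
  have [_ /andP[b0 br]] := Xtx.
  by rewrite roof_sumSr roof_sum0 add0r /=; apply/andP; split; lra.
exists U; split => //.
  move=> x t j t0 Kt.
  have Xx : suspension x.
    by apply: contrapT => nXx; move: Kt; rewrite suspension_flow_out// => /KX.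
  have [_ /andP[b0 br]] := suspension_flow_in t0 Xx.
  move: (right x t t0 Xx) Kt b0 br; case: (Phi t x) => a b /= {}right Kab b0 br.
  have [e e0 H] := KU a b j Kab.
  exists (Num.min e (r a - b)); first by rewrite lt_min e0 subr_gt0.
  move=> s ts; rewrite -ltrBlDl lt_min => /andP[se sr].
  by rewrite right//; apply: H; rewrite addrAC subrr add0r ger0_norm// subr_ge0.
move=> x t t0 nK; have [Xx|nXx] := pselect (suspension x); last first.
  rewrite suspension_flow_out// in nK.
  have [j [e e0 H]] := nKU x.1 x.2 (ltac:(by rewrite -surjective_pairing)).
  exists j, 1 => // s _ _; rewrite suspension_flow_out// [x]surjective_pairing.
  by apply: H; rewrite subrr normr0.
have [jr [er er0 Hr]] : exists j, exists2 e : R, 0 < e & forall s, t <= s ->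
    s - t < e -> ~ U j (Phi s x).
  have [_ /andP[b0 br]] := suspension_flow_in t0 Xx.
  move: (right x t t0 Xx) nK b0 br; case: (Phi t x) => a b /= {}right nK b0 br.
  have [j [e e0 H]] := nKU a b nK.
  exists j, (Num.min e (r a - b)); first by rewrite lt_min e0 subr_gt0.
  move=> s ts; rewrite lt_min => /andP[se sr].
  by rewrite right//; apply: H; rewrite addrAC subrr add0r ger0_norm// subr_ge0.
have [jl [el el0 Hl]] : exists j, exists2 e : R, 0 < e & forall s, 0 <= s -> s < t ->
    t - s < e -> ~ U j (Phi s x).
  have [t0'|tpos] := leP t 0.
    by exists 0%N, 1 => // s s0 st; have := lt_le_trans st t0'; rewrite ltNge s0.
  have [Yx /andP[x0 xr]] := Xx.
  have ex : exists n, x.2 + t <= roof_sum n x.1.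
    have [_ [Fa _]] := Yx; have [n Hn] := Fa (Num.trunc (x.2 + t)).+1; exists n.
    by rewrite ltW// (lt_trans (truncnS_gt _)).
  case: (ex_minnP ex) => -[|n] Hn Hmin.
    by exfalso; move: Hn; rewrite roof_sum0; lra.
  have n1 : roof_sum n x.1 < x.2 + t.
    by rewrite ltNge; apply/negP => /Hmin; rewrite ltnn.
  (* The limit of the orbit at [t] from the left; it is [Phi t x] unless [b' = r a']. *)
  pose a' := iter n P x.1; pose b' := x.2 + t - roof_sum n x.1.
  have nK' : ~ K (a', b').
    have [lt|ge] := ltP (x.2 + t) (roof_sum n.+1 x.1).
      suff <- : Phi t x = (a', b') by [].
      by rewrite (suspension_flowE t0 Xx (n := n))// lt ltW.
    move=> /KX[_ /= /andP[_]]; rewrite /b' /a' ltNge => /negP; apply.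
    by move: ge; rewrite roof_sumSr; lra.
  have [j [e e0 H]] := nKU a' b' nK'.
  exists j, (Num.min e b'); first by rewrite lt_min e0 subr_gt0.
  move=> s s0 st; rewrite lt_min => /andP[se sb].
  rewrite (suspension_flowE s0 Xx (n := n)); last first.
    by move: sb; rewrite /b'; move: Hn => Hn sb; apply/andP; split; lra.
  apply: H; rewrite /b'.
  have -> : x.2 + s - roof_sum n x.1 - (x.2 + t - roof_sum n x.1) = - (t - s) by lra.
  by rewrite normrN ger0_norm// subr_ge0 ltW.
exists (maxn jl jr), (Num.min el er); first by rewrite lt_min el0.
move=> s s0; rewrite lt_min => /andP[sl sr] Us; have [ts|st] := leP t s.
  apply: (Hr s ts); first by rewrite -[ltLHS]ger0_norm ?subr_ge0.
  exact: nonincreasing_subset Udec _ _ (leq_maxr jl jr) _ Us.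
apply: (Hl s s0 st); last exact: nonincreasing_subset Udec _ _ (leq_maxl jl jr) _ Us.
by rewrite -[ltLHS]ger0_norm ?subr_ge0 1?ltW// distrC.
Qed.

Variables (m : probability T R) (c : R).
Hypotheses (c_ge0 : 0 <= c) (m_area : forall E, measurable E ->
  m E = ((nu \x lam) (suspension `&` E) * c%:E)%E).

Let mX := measurable_suspension.

Let psi (n : nat) (t : R) : T -> T := skew (iter n P) (fun a => t - roof_sum n a).

Let theta_psi n t x : theta n t (psi n t x) = x.
Proof.
rewrite /theta /psi /skew /past_sum /= iterPK; case: x => a b /=.
by congr pair; lra.
Qed.

Let measurable_theta n t : measurable_fun setT (theta n t).
Proof.
rewrite (_ : theta n t = skew (iter n Q) (fun a => past_sum n a - t)).
  apply: measurable_skew; first exact: measurable_iterQ.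
  by apply: measurable_funB => //; exact: measurable_past_sum.
by apply/funext => y; rewrite /theta /skew; congr pair; lra.
Qed.

Let nu_iterP n B : measurable B -> nu (iter n P @^-1` B) = nu B.
Proof.
elim: n B => [|n IH] B mB //; rewrite -[RHS]nuP// -[RHS]IH//.
by rewrite -[X in measurable X]setTI; exact: mP.
Qed.

Let flow_mp_le (t : R) E : 0 <= t -> measurable E ->
  (m (Phi t @^-1` E) <= m E)%E.
Proof.
move=> t0 mE; have mPE : measurable (Phi t @^-1` E).
  rewrite -[X in measurable X]setTI.
  exact: (measurable_flow measurable_suspension_flow).
rewrite !m_area// lee_wpmul2r//.
pose F n := (E `&` suspension) `&` theta n t @^-1` suspension.
have mF n : measurable (F n).
  apply: measurableI; first exact: measurableI.
  by rewrite -[X in measurable X]setTI; exact: measurable_theta.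
have tF : trivIset setT F.
  apply/trivIsetP => i j _ _ /eqP ij; rewrite -subset0 => y [[_ yi] [_ yj]].
  exact: ij (theta_unique yi yj).
have mg n : measurable_fun setT (fun a => t - roof_sum n a).
  by apply: measurable_funB => //; exact: measurable_roof_sum.
have mpsi n : measurable_fun setT (psi n t).
  by apply: measurable_skew => //; exact: measurable_iterP.
have mpsiF n : measurable (psi n t @^-1` F n).
  by rewrite -[X in measurable X]setTI; exact: mpsi.
have sub : suspension `&` Phi t @^-1` E `<=` \bigcup_(n in [set: nat]) psi n t @^-1` F n.
  move=> x [Xx Ex]; have [n Hn E'] := suspension_flowP t0 Xx; exists n => //.
  have psiE : psi n t x = Phi t x by rewrite E' /psi /skew; congr pair; lra.
  split; last by rewrite /= theta_psi.
  by rewrite psiE; split => //; exact: suspension_flow_in.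
apply: (@le_trans _ _ (\sum_(n <oo) (nu \x lam)%E (psi n t @^-1` F n))%E).
  apply: (@measure_sigma_subadditive _ _ _ (nu \x lam)%E _ _ mpsiF _ sub).
  exact: measurableI.
rewrite (eq_eseriesr (g := fun n => (nu \x lam)%E (F n))); last first.
  by move=> n _; exact: (skew_mp _ (measurable_iterP n) (@nu_iterP n) (mF n)).
rewrite -(@measure_semi_bigcup _ _ _ (nu \x lam)%E F)//; last first.
  exact: bigcupT_measurable.
apply: le_measure; rewrite ?inE//; [exact: bigcupT_measurable|exact: measurableI|].
by move=> x [n _ [[]]].
Qed.

(** For a probability measure, the inequality for [E] and for its complement gives equality. *)
Lemma suspension_flow_mp (t : R) E : 0 <= t -> measurable E ->
  m (Phi t @^-1` E) = m E.
Proof.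
move=> t0 mE; have mPE : measurable (Phi t @^-1` E).
  rewrite -[X in measurable X]setTI.
  exact: (measurable_flow measurable_suspension_flow).
apply/eqP; rewrite eq_le flow_mp_le//=.
have := flow_mp_le t0 (measurableC mE); rewrite -preimage_setC !probability_setC//.
have Ef : m E \is a fin_num by exact: fin_num_measure.
have PEf : m (Phi t @^-1` E) \is a fin_num by exact: fin_num_measure.
rewrite -(fineK Ef) -(fineK PEf) -!EFinB !lee_fin; lra.
Qed.

Let m_suspension E : measurable E -> m (E `&` suspension) = m E.
Proof.
by move=> mE; rewrite !m_area//; [rewrite setIA setIAC setIid setIC|exact: measurableI].
Qed.

Lemma suspension_flow_reg E (e : R) : measurable E -> 0 < e ->
  exists K, [/\ K `<=` E, orbit_closed Phi K & (m (E `\` K) < e%:E)%E].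
Proof.
move=> mE e0.
have [K [KEX Kc Km]] := fiber_closed_approximation m (measurableI _ _ mE mX) e0.
exists K; split; first by move=> x /KEX[].
  by apply: fiber_closed_orbit_closed => // x /KEX[].
have mK := fiber_closed_measurable Kc.
rewrite -m_suspension; last exact: measurableD.
suff -> : (E `\` K) `&` suspension = (E `&` suspension) `\` K by [].
by apply/seteqP; split => x [[? ?] ?].
Qed.

Hypothesis exact_ergodic : forall B, B `<=` suspension -> measurable B ->
  (forall t : R, 0 <= t -> suspension `&` Phi t @^-1` B = B) ->
  m B = 0%E \/ m B = 1%E.

(** The increasing union of the preimages of a forward invariant [B] under integer times is
    invariant in the exact sense, and each of these preimages has the measure of [B]. *)
Lemma suspension_flow_erg B : measurable B ->
  (forall (t : R) x, 0 <= t -> B x -> B (Phi t x)) -> m B = 0%E \/ m B = 1%E.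
Proof.
move=> mB Binv; pose B' n := suspension `&` Phi n%:R @^-1` B.
have mB' n : measurable (B' n).
  apply: measurableI => //; rewrite -[X in measurable X]setTI.
  exact: (measurable_flow measurable_suspension_flow).
have B'le n k : (n <= k)%N -> B' n `<=` B' k.
  move=> nk x [Xx Bx]; split => //; rewrite /= -(subnK nk) natrD suspension_flowD//.
  exact: Binv.
have mUB' : m (\bigcup_(n in [set: nat]) B' n) = m B.
  have : m \o B' @ \oo --> m (\bigcup_(n in [set: nat]) B' n).
    apply: nondecreasing_cvg_mu => //; first exact: bigcupT_measurable.
    by move=> n k nk; apply/subsetPset; exact: B'le.
  have -> : m \o B' = cst (m B).
    apply/funext => n /=; rewrite /B' setIC m_suspension ?suspension_flow_mp//.
    rewrite -[X in measurable X]setTI.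
    exact: (measurable_flow measurable_suspension_flow).
  by move=> H; apply: cvg_unique H (cvg_cst _).
rewrite -mUB'; apply: exact_ergodic.
- by move=> x [n _ []].
- exact: bigcupT_measurable.
- move=> t t0; apply/seteqP; split => x.
    move=> [Xx [n _ [_ /= Bx]]]; exists ((Num.trunc t).+1 + n)%N => //; split => //=.
    (* The point is in [B] at time [n + t]; forward invariance carries it to the integer time that
       the union requires. *)
    have -> : (((Num.trunc t).+1 + n)%:R : R) = ((Num.trunc t).+1%:R - t) + (n%:R + t).
      by rewrite natrD [n%:R + t]addrC addrA subrK.
    rewrite suspension_flowD ?subr_ge0 ?addr_ge0//; last by rewrite ltW// truncnS_gt.
    apply: Binv; first by rewrite subr_ge0 ltW// truncnS_gt.
    by rewrite suspension_flowD.
  move=> [n _ [Xx /= Bx]]; split => //; exists n => //; split => /=.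
    exact: suspension_flow_in.
  by rewrite -suspension_flowD// addrC suspension_flowD//; exact: Binv.
Qed.

End suspension.

(** * Completed Lebesgue measures *)

Section completions.
Context {R : realType}.
Notation lam := (@lebesgue_measure R).
Let B1 := measurableTypeR R.
Let T := (line R * B1)%type.

Lemma lebesgue1E (A : set R) : lebesgue1 R A = lam A.
Proof. by []. Qed.

Lemma line_measurable_Borel (A : set R) :
  measurable (A : set B1) -> measurable (A : set (line R)).
Proof. exact: sub_caratheodory. Qed.

Lemma plane_measurable_Borel (A : set (R * R)) :
  measurable (A : set (B1 * B1)) -> measurable (A : set (plane R)).
Proof. exact: caratheodory_measurable_mu_ext. Qed.

Lemma lebesgue2_Borel (A : set (R * R)) :
  measurable (A : set (B1 * B1)) -> lebesgue2 R A = (lam \x lam)%E A.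
Proof. exact: measurable_mu_extE. Qed.

Lemma lebesgue2_complete (A : set (plane R)) :
  (lebesgue2 R).-negligible A -> measurable A.
Proof. exact: measure_is_complete_caratheodory. Qed.

Lemma line_measurable_decomposition (A : set (line R)) : measurable A ->
  exists A0 N0 : set B1, [/\ measurable A0, measurable N0, lam N0 = 0%E,
    A0 `<=` A & A `<=` A0 `|` N0].
Proof.
move=> mA.
have : completed_algebra_gen lam A.
  by rewrite -g_sigma_completed_algebra_genE completed_caratheodory_measurable.
move=> [A0 mA0 [N [N0 [mN0 N00 NN0]] <-]]; exists A0, N0; split => //.
by apply: setUS.
Qed.

(** A Lebesgue set of the base is a Borel set up to a subset of a Borel null set, and the strip
    above that null set is null in the plane. *)
Lemma plane_measurable (A : set (R * R)) :
  measurable (A : set T) -> measurable (A : set (plane R)).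
Proof.
suff : @measurable _ T `<=` @measurable _ (plane R) by exact.
apply: smallest_sub; first exact: sigma_algebra_measurable.
move=> E [|] [C mC <-]; rewrite setTI.
  have [C0 [N0 [mC0 mN0 N00 C0C CC0]]] := line_measurable_decomposition mC.
  have bf (D : set B1) : measurable D -> measurable (fst @^-1` D : set (B1 * B1)).
    by move=> mD; rewrite -[X in measurable X]setTI; exact: measurable_fst.
  rewrite (_ : fst @^-1` C = fst @^-1` C0 `|` (fst @^-1` (C `\` C0))); last first.
    by rewrite -preimage_setU setDUK.
  apply: measurableU; first by apply: plane_measurable_Borel; exact: bf.
  apply: lebesgue2_complete; exists (fst @^-1` N0); split.
  - by apply: plane_measurable_Borel; exact: bf.
  - rewrite lebesgue2_Borel; last exact: bf.
    have -> : fst @^-1` N0 = N0 `*` [set: B1] by apply/seteqP; split => [x|x []].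
    by rewrite product_measure1E// [X in (X * _)%E]N00 mul0e.
  - by move=> x [Cx nC0x]; have [|] := CC0 _ Cx.
apply: plane_measurable_Borel; rewrite -[X in measurable X]setTI.
exact: measurable_snd.
Qed.

(** By uniqueness of product measures rectangles suffice; there the Lebesgue side is squeezed
    between two Borel sets of equal measure. *)
Lemma lebesgue2E (E : set (R * R)) : measurable (E : set T) ->
  lebesgue2 R E = (@completed_lebesgue_measure R \x lam)%E (E : set T).
Proof.
pose i : plane R -> T := id.
have mi : measurable_fun setT i.
  by move=> _ D mD; rewrite setTI; exact: plane_measurable.
move=> mE; apply/esym.
rewrite (@product_measure_unique _ _ _ _ R (@completed_lebesgue_measure R) lam
  (pushforward (lebesgue2 R) i))// => A C mA mC.
have [A0 [N0 [mA0 mN0 N00 A0A AA0]]] := line_measurable_decomposition mA.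
have mAC : measurable (A `*` C : set (plane R)).
  by apply: plane_measurable; exact: measurableX.
have lamA : @completed_lebesgue_measure R A = lam A0.
  rewrite -[LHS]/(lebesgue1 R A) -lebesgue1E; apply/eqP; rewrite eq_le.
  apply/andP; split; last first.
    by apply: le_measure; rewrite ?inE//; exact: line_measurable_Borel.
  apply: (@le_trans _ _ (lebesgue1 R (A0 `|` N0))).
    apply: le_measure; rewrite ?inE//.
    by apply: line_measurable_Borel; exact: measurableU.
  rewrite !lebesgue1E; apply: (le_trans (measureU2 _ _ _)) => //=.
  by rewrite [X in (_ + X)%E]N00 adde0.
suff H : lebesgue2 R (A `*` C) = (lam A0 * lam C)%E.
  by rewrite [X in _ = (X * _)%E]lamA; exact: H.
apply/eqP; rewrite eq_le; apply/andP; split.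
  apply: (@le_trans _ _ (lebesgue2 R ((A0 `|` N0) `*` C))).
    apply: le_measure; rewrite ?inE//.
      by apply: plane_measurable_Borel; apply: measurableX => //; exact: measurableU.
    by move=> x [Ax Cx]; split => //; exact: AA0.
  rewrite lebesgue2_Borel; last by apply: measurableX => //; exact: measurableU.
  rewrite product_measure1E//; last exact: measurableU.
  apply: lee_wpmul2r => //; apply: (le_trans (measureU2 _ _ _)) => //=.
  by rewrite [X in (_ + X)%E]N00 adde0.
rewrite -product_measure1E// -lebesgue2_Borel; last exact: measurableX.
apply: le_measure; rewrite ?inE//.
  by apply: plane_measurable_Borel; exact: measurableX.
by move=> x [Ax Cx]; split => //; exact: A0A.
Qed.

(** The measure is the outer measure given by countable Borel covers; intersect covers that are
    optimal up to [1 / (n + 1)]. *)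
Lemma plane_Borel_hull (E : set (plane R)) : measurable E ->
  (lebesgue2 R E < +oo)%E -> exists B : set (B1 * B1),
    [/\ measurable B, E `<=` B & lebesgue2 R (B `\` E) = 0%E].
Proof.
move=> mE Efin; have Ef : lebesgue2 R E \is a fin_num by rewrite ge0_fin_numE.
have inv0 n : 0 < n.+1%:R^-1 :> R by rewrite invr_gt0.
have /choice[F HF] n : exists F : set (B1 * B1), [/\ measurable F, E `<=` F &
    (lebesgue2 R F <= lebesgue2 R E + n.+1%:R^-1%:E)%E].
  have /(lb_ereal_inf_adherent (inv0 n))[_ [G [mG EG] <-] HG] :
      ereal_inf [set (\sum_(k <oo) (lam \x lam) (G k))%E | G in
        @measurable_cover _ (B1 * B1)%type E] \is a fin_num by exact: Ef.
  exists (\bigcup_(k in [set: nat]) G k); split => //.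
    exact: bigcupT_measurable.
  rewrite lebesgue2_Borel; last exact: bigcupT_measurable.
  apply: le_trans (ltW HG).
  apply: (@measure_sigma_subadditive _ _ _ (lam \x lam)%E _ _ mG) => //.
  exact: bigcupT_measurable.
have mF n : measurable (F n) by have [] := HF n.
have mB : measurable (\bigcap_(n in [set: nat]) F n) by exact: bigcapT_measurable.
exists (\bigcap_(n in [set: nat]) F n); split => //.
  by move=> x Ex n _; have [_ EF _] := HF n; exact: EF.
have mBp : measurable (\bigcap_(n in [set: nat]) F n : set (plane R)).
  exact: plane_measurable_Borel.
have Ble : (lebesgue2 R (\bigcap_(n in [set: nat]) F n) <= lebesgue2 R E)%E.
  apply/lee_addgt0Pr => e e0; have [_ _ HFn] := HF (Num.trunc e^-1).
  apply: (@le_trans _ _ (lebesgue2 R (F (Num.trunc e^-1)))).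
    apply: le_measure; rewrite ?inE//; first exact: plane_measurable_Borel.
    by move=> x; apply.
  apply: (le_trans HFn); rewrite leeD2l// lee_fin ltW//.
  by rewrite -[ltRHS]invrK ltf_pV2 ?posrE ?invr_gt0// truncnS_gt.
have Bf : lebesgue2 R (\bigcap_(n in [set: nat]) F n) \is a fin_num.
  by rewrite ge0_fin_numE// (le_lt_trans Ble).
rewrite measureD//=; last by rewrite ltey_eq Bf.
rewrite (setIidr _); last by move=> x Ex n _; have [_ EF _] := HF n; exact: EF.
apply/eqP; rewrite eq_le; apply/andP; split.
  by rewrite leeBlDr// add0e.
rewrite sube_ge0//; last by rewrite Ef.
by apply: le_measure; rewrite ?inE// => x Ex n _; have [_ EF _] := HF n; exact: EF.
Qed.

(** Two hulls: [B] is one of [E], and [N] is one of the null set by which [B] exceeds [E]. *)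
Lemma plane_Borel_approximation (E : set (plane R)) : measurable E ->
  (lebesgue2 R E < +oo)%E -> exists B N : set (B1 * B1),
    [/\ measurable B, measurable N, lebesgue2 R N = 0%E & E `\` N = B `\` N].
Proof.
move=> mE Efin; have [B [mB EB BE0]] := plane_Borel_hull mE Efin.
have mBE : measurable (B `\` E : set (plane R)).
  by apply: measurableD => //; exact: plane_measurable_Borel.
have [|N [mN BEN N0]] := plane_Borel_hull mBE; first by rewrite BE0.
exists B, N; split => //.
  apply/eqP; rewrite eq_le measure_ge0 andbT.
  rewrite -[N](setDUK BEN).
  apply: (le_trans (measureU2 _ _ _)) => //=.
    by apply: measurableD => //; exact: plane_measurable_Borel.
  by rewrite [X in (X + _)%E]BE0 [X in (_ + X)%E]N0 add0e.
apply/seteqP; split => x [Ex nN]; split => //; first exact: EB.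
by apply: contrapT => nE; apply: nN; exact: BEN.
Qed.

End completions.

(** * Special flows *)

Section extension_by_identity.
Context d (S : measurableType d) (R : realType).
Variables (nu : {measure set S -> \bar R}) (Y : set S) (P : S -> S).
Hypotheses (mY : measurable Y) (bijP : set_bij Y Y P) (mP : measurable_fun Y P)
  (mimP : forall B, B `<=` Y -> measurable B -> measurable (P @` B))
  (nuP : forall B, B `<=` Y -> measurable B -> nu (Y `&` P @^-1` B) = nu B).

(** [P] carries information on [Y] only; the extension is a bijection of the whole line, so that the
    suspension can be built with total, mutually inverse maps. *)
Definition extend_id (a : S) : S := if a \in Y then P a else a.

Definition extend_id_inv (a : S) : S :=
  if a \in Y then xget a [set b | Y b /\ P b = a] else a.

Let PY a : Y a -> Y (P a).
Proof. by have [PY _ _] := bijP => Ya; exact: PY. Qed.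

Let Pinj a b : Y a -> Y b -> P a = P b -> a = b.
Proof. by have [_ Pinj _] := bijP => Ya Yb; apply: Pinj; rewrite inE. Qed.

Let Psurj a : Y a -> exists2 b, Y b & P b = a.
Proof. by have [_ _ Psurj] := bijP => /Psurj[b Yb <-]; exists b. Qed.

Lemma extend_idE a : Y a -> extend_id a = P a.
Proof. by move=> Ya; rewrite /extend_id mem_set. Qed.

Lemma extend_id_out a : ~ Y a -> extend_id a = a.
Proof. by move=> Ya; rewrite /extend_id memNset. Qed.

Lemma extend_idY a : Y (extend_id a) <-> Y a.
Proof.
have [Ya|nYa] := pselect (Y a); last by rewrite extend_id_out.
by rewrite extend_idE//; split => // _; exact: PY.
Qed.

Lemma extend_idK : cancel extend_id extend_id_inv.
Proof.
move=> a; rewrite /extend_id_inv; have [Ya|nYa] := pselect (Y a); last first.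
  by rewrite extend_id_out// memNset.
rewrite extend_idE// mem_set; last exact: PY.
by case: xgetP => [b _ [Yb /Pinj]|/(_ a)[]//]; exact.
Qed.

Lemma extend_id_invK : cancel extend_id_inv extend_id.
Proof.
move=> a; rewrite /extend_id_inv; have [Ya|nYa] := pselect (Y a); last first.
  by rewrite memNset// extend_id_out.
rewrite mem_set//; have [b Yb Pb] := Psurj Ya.
by case: xgetP => [c _ [Yc Pc]|/(_ b)[]//]; rewrite extend_idE.
Qed.

Let preimage_extend B : extend_id @^-1` B = (Y `&` P @^-1` (B `&` Y)) `|` (B `\` Y).
Proof.
apply/seteqP; split => a /=.
  have [Ya|nYa] := pselect (Y a); last by rewrite extend_id_out//; right.
  by rewrite extend_idE// => BPa; left; split => //; split => //; exact: PY.
by move=> [[Ya [BPa _]]|[Ba nYa]]; [rewrite extend_idE|rewrite extend_id_out].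
Qed.

Lemma measurable_extend_id : measurable_fun setT extend_id.
Proof.
move=> _ B mB; rewrite setTI preimage_extend; apply: measurableU.
  by apply: mP => //; exact: measurableI.
exact: measurableD.
Qed.

Lemma measurable_extend_id_inv : measurable_fun setT extend_id_inv.
Proof.
move=> _ B mB; rewrite setTI.
rewrite (_ : _ @^-1` B = (P @` (B `&` Y)) `|` (B `\` Y)).
  apply: measurableU; last exact: measurableD.
  by apply: mimP; [exact: subIsetr|exact: measurableI].
apply/seteqP; split => a /=.
  have [Ya|nYa] := pselect (Y a); last first.
    by rewrite /extend_id_inv memNset//; right.
  move=> Ba; left; exists (extend_id_inv a); last first.
    rewrite -extend_idE; first exact: extend_id_invK.
    by apply/extend_idY; rewrite extend_id_invK.
  by split => //; apply/extend_idY; rewrite extend_id_invK.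
move=> [[b [Bb Yb] <-]|[Ba nYa]]; last by rewrite /extend_id_inv memNset.
by rewrite -extend_idE// extend_idK.
Qed.

Lemma extend_id_mp B : measurable B -> nu (extend_id @^-1` B) = nu B.
Proof.
move=> mB; rewrite preimage_extend measureU.
- rewrite [X in (X + _)%E]nuP; [|exact: subIsetr|exact: measurableI].
  rewrite -measureU; [by rewrite setUIDK|exact: measurableI|exact: measurableD|].
  by rewrite -subset0 => a [[_ Ya] [_]].
- by apply: mP => //; exact: measurableI.
- exact: measurableD.
- by rewrite -subset0 => a [[Ya _] [_]].
Qed.

Lemma iter_extend_id n a : Y a -> iter n extend_id a = iter n P a /\ Y (iter n P a).
Proof.
move=> Ya; elim: n => // n [IH Yn]; rewrite !iterS IH extend_idE//.
by split => //; exact: PY.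
Qed.

End extension_by_identity.

Section special_flow_as_suspension.
Context {R : realType}.
Variables (Y : set (line R)) (P : line R -> line R) (r : line R -> R).
Hypothesis sf : special_flow Y P r.
Notation lam := (@lebesgue_measure R).
Notation B1 := (measurableTypeR R).

Let P' := extend_id Y P.
Let Q' := extend_id_inv Y P.
Let r' (a : line R) : R := if a \in Y then r a else 0.

Let mY : measurable Y. Proof. by have [] := sf. Qed.
Let autP : automorphism Y P. Proof. by have [] := sf. Qed.
Let bijP : set_bij Y Y P. Proof. by have [] := autP. Qed.
Let r_ge0 a : Y a -> 0 <= r a. Proof. by have [_ _ + _ _] := sf; exact. Qed.

Lemma roof_ge0 a : 0 <= r' a.
Proof. by rewrite /r'; case: ifP => // /set_mem; exact: r_ge0. Qed.

Lemma roofE a : Y a -> r' a = r a.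
Proof. by move=> Ya; rewrite /r' mem_set. Qed.

Lemma measurable_roof : measurable_fun setT r'.
Proof.
have [_ _ _ /integrableP[/measurable_EFinP mr _] _] := sf.
exact: (measurable_restrictT r mY).1 mr.
Qed.

Lemma roof_sum_base n a : Y a ->
  roof_sum P' r' n a = \sum_(k < n) r (iter k P a).
Proof.
move=> Ya; apply: eq_bigr => k _.
by have [-> Yk] := iter_extend_id bijP k Ya; rewrite /r' mem_set.
Qed.

Definition special_domain : set (line R * B1) := suspension P' Q' r' Y.
Definition special_semiflow : R -> line R * B1 -> line R * B1 :=
  suspension_flow P' Q' r' Y.

Let X0 := special_domain.
Let Phi := special_semiflow.

Lemma special_domain_phase_space : X0 `<=` phase_space Y r.
Proof.
move=> x [[Yx _] xr]; split => //.
by rewrite -(roofE Yx).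
Qed.

(** For [y] to lie under the graph of [r] means precisely that [n] is the level of the total height
    [x.2 + t]. *)
Lemma moves_upE (t : R) (x y : line R * B1) : Y x.1 ->
  moves_up Y P r t x y <->
  exists n, y = (iter n P' x.1, x.2 + t - roof_sum P' r' n x.1) /\
    roof_sum P' r' n x.1 <= x.2 + t < roof_sum P' r' n.+1 x.1.
Proof.
move=> Yx; split.
  move=> [[Yy yr] [n yE]]; exists n; have [iE Yn] := iter_extend_id bijP n Yx.
  rewrite roof_sumSr iE (roofE Yn) roof_sum_base//; split => //.
  by move: yr; rewrite yE /= subr_ge0 ltrBlDl.
move=> [n [-> H]]; have [iE Yn] := iter_extend_id bijP n Yx; split.
  split; first by rewrite /= iE.
  move: H; rewrite roof_sumSr iE (roofE Yn) => /andP[H1 H2].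
  by rewrite subr_ge0 H1 ltrBlDl.
by exists n; rewrite iE roof_sum_base.
Qed.

Let nu := @completed_lebesgue_measure R.

Let PK : cancel P' Q' := extend_idK bijP.
Let QK : cancel Q' P' := extend_id_invK bijP.
Let YP' a : Y (P' a) <-> Y a := extend_idY bijP a.

Let mP' : measurable_fun setT P'.
Proof. by have [_ mP _ _] := autP; exact: measurable_extend_id. Qed.

Let mQ' : measurable_fun setT Q'.
Proof. by have [_ _ mi _] := autP; exact: measurable_extend_id_inv. Qed.

Let nuP' B : measurable B -> nu (P' @^-1` B) = nu B.
Proof.
have [_ mP _ nuP] := autP.
exact: (@extend_id_mp _ _ _ nu Y P mY bijP mP nuP).
Qed.

Lemma moves_up_semiflow (t : R) x y : 0 <= t -> X0 x ->
  moves_up Y P r t x y -> Phi t x = y.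
Proof.
move=> t0 Xx; have [[Yx _] _] := Xx.
move=> /(moves_upE t y Yx)[n [-> H]]; exact: (suspension_flowE roof_ge0 t0 Xx H).
Qed.

Lemma semiflow_moves_up (t : R) x : 0 <= t -> X0 x -> moves_up Y P r t x (Phi t x).
Proof.
move=> t0 Xx; have [[Yx _] _] := Xx; apply/(moves_upE t _ Yx).
by have [n H E] := suspension_flowP roof_ge0 t0 Xx; exists n.
Qed.

Lemma flow_semiflow (t : R) x : 0 <= t -> X0 x -> flow Y P r t x = Phi t x.
Proof.
move=> t0 Xx; rewrite /flow; case: xgetP => [y _|/(_ (Phi t x))].
  by rewrite /= /flow_rel t0 => /(moves_up_semiflow t0 Xx).
by rewrite /= /flow_rel t0 => H; exfalso; apply: H; exact: semiflow_moves_up.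
Qed.

Let moves_up_base (t : R) x y : Y x.1 -> moves_up Y P r t x y ->
  recurrent_base P' Q' r' Y x.1 <-> recurrent_base P' Q' r' Y y.1.
Proof.
move=> Yx /(moves_upE t y Yx)[n [-> _]] /=; split.
  exact: (recurrent_base_iterP PK QK roof_ge0 YP').
by move=> /(recurrent_base_iterQ QK roof_ge0 YP' n); rewrite iterPK.
Qed.

Let phase_special x : phase_space Y r x -> recurrent_base P' Q' r' Y x.1 -> X0 x.
Proof. by move=> [Yx xr] Rx; split => //; rewrite roofE. Qed.

(** The base points of [x] and [y] lie on one orbit of [P], along which divergence of the roof sums
    in both directions is invariant. *)
Lemma flow_rel_special_domain (t : R) x y : phase_space Y r x ->
  flow_rel Y P r t x y -> X0 x <-> X0 y.
Proof.
move=> px; rewrite /flow_rel; have [Yx _] := px.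
case: ifP => t0 [].
  move=> py mv; have /(moves_up_base Yx) H : moves_up Y P r t x y by split.
  by split => -[Rb _]; apply: phase_special => //; apply/H.
move=> py mv; have [Yy _] := py; have H := moves_up_base Yy mv.
by split => -[Rb _]; apply: phase_special => //; apply/H.
Qed.

Lemma backward_flow (t : R) x : t < 0 -> X0 x ->
  X0 (flow Y P r t x) /\ Phi (- t) (flow Y P r t x) = x.
Proof.
move=> t0 Xx; have px := special_domain_phase_space Xx.
have nt0 : 0 <= - t by rewrite oppr_ge0 ltW.
have t0F : (0 <= t) = false by apply/negbTE; rewrite -ltNge.
have [z Xz zx] := suspension_flow_surj QK roof_ge0 YP' nt0 Xx.
have relz : flow_rel Y P r t x z.
  rewrite /flow_rel t0F; split; first exact: special_domain_phase_space.
  by rewrite -zx; exact: semiflow_moves_up.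
rewrite /flow; case: xgetP => [y _ /= rely|/(_ z)//].
have Xy : X0 y by apply/(flow_rel_special_domain px rely).
split => //; move: rely; rewrite /flow_rel t0F => -[_].
exact: moves_up_semiflow.
Qed.

Lemma flow_out_special_domain (t : R) x : phase_space Y r x -> ~ X0 x ->
  ~ X0 (flow Y P r t x).
Proof.
move=> px nXx; rewrite /flow; case: xgetP => [y _ /= rely|//].
by move=> /(flow_rel_special_domain px rely).
Qed.

Lemma special_domain_full x : phase_space Y r x ->
  (forall t, exists y, flow_rel Y P r t x y) -> X0 x.
Proof.
move=> px H; have [Yx /andP[x0 xr]] := px; apply: phase_special => //.
split=> //; split=> C.
  have [y] := H C%:R; rewrite /flow_rel ler0n => /(moves_upE _ _ Yx)[n [_ /andP[_ n2]]].
  by exists n.+1; rewrite (le_lt_trans _ n2)// lerDr.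
(* Going back by this time crosses roofs of total height [y.2 + C + 1 > C]. *)
pose s := C%:R + 1 + x.2.
have s0 : 0 < s by rewrite /s -addrA ltr_wpDl// ltr_pwDl.
have [y] := H (- s); rewrite /flow_rel oppr_ge0 leNgt s0 /= opprK.
move=> [[Yy /andP[y0 _]] /(moves_upE _ _ Yy)[n [xE _]]]; exists n.
have y1 : y.1 = iter n Q' x.1 by rewrite xE /= iterPK.
rewrite /past_sum -y1.
have : x.2 = y.2 + s - roof_sum P' r' n y.1 by rewrite [in LHS]xE.
by move: y0; rewrite /s; move: (C%:R : R) => c; lra.
Qed.

Lemma measurable_special_domain : measurable X0.
Proof. exact: measurable_suspension measurable_roof mY. Qed.

Lemma special_domain_ae : {ae lebesgue2 R, forall x, phase_space Y r x -> X0 x}.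
Proof.
have [_ _ _ _] := sf; apply: filterS.
by move=> x Hx px; apply: special_domain_full => //; exact: Hx.
Qed.

End special_flow_as_suspension.

Section completed_integral.
Context {R : realType}.
Notation lam := (@lebesgue_measure R).
Notation B1 := (measurableTypeR R).

(** [sigma] integrates [f] for the completed measure of the line, while the semiflow results
    integrate a Borel function of time; this passes from one to the other. *)
Lemma Rintegral_lebesgue1_ae (D Z : set R) (g h : R -> R) :
  measurable (D : set B1) -> measurable (Z : set B1) -> lam Z = 0%E ->
  measurable_fun D (h : B1 -> R) -> (forall s, D s -> ~ Z s -> g s = h s) ->
  \int[lebesgue1 R]_(s in D) g s = \int[lam]_(s in D) h s.
Proof.
move=> mD mZ Z0 mh gh; pose j : line R -> B1 := id.
have mj : measurable_fun setT j.
  by move=> _ C mC; rewrite setTI; exact: line_measurable_Borel.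
pose Dl : set (line R) := D.
have mDl : measurable Dl by exact: line_measurable_Borel.
have mhl : measurable_fun Dl (EFin \o (h : line R -> R)).
  pose hl : line R -> R := h.
  suff mhl : measurable_fun Dl hl by exact/measurable_EFinP.
  move=> _ C mC; exact (line_measurable_Borel (mh mD C mC)).
have hg : ae_eq (lebesgue1 R) Dl (fun s : line R => (h s)%:E) (fun s => (g s)%:E).
  exists Z; split; first exact: line_measurable_Borel.
    exact: Z0.
  by move=> s /=; apply: contra_notP => nZ Ds; rewrite gh.
have mgl : measurable_fun Dl (fun s : line R => (g s)%:E).
  apply: (ae_measurable_fun _ hg mhl); exact: completed_lebesgue_measure_is_complete.
rewrite /Rintegral; congr fine.
rewrite -(ae_eq_integral _ _ mDl mhl mgl hg).
have jE A : measurable A -> lebesgue1 R (j @^-1` A) = lam A by [].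
have mhE : measurable_fun (D : set B1) (fun s : B1 => (h s)%:E) by exact/measurable_EFinP.
exact (mp_integral mj jE mD mhE).
Qed.

End completed_integral.

(** * Transfer of the recurrence theorem to special flows *)

Section special_flow_recurrence.
Context {R : realType}.
Variables (Y : set (line R)) (P : line R -> line R) (r : line R -> R)
  (mu : probability (plane R) R).
Hypotheses (sf : special_flow Y P r) (area : normalized_area Y r mu)
  (erg : ergodic Y P r mu).
Notation lam := (@lebesgue_measure R).
Notation B1 := (measurableTypeR R).
Notation T := (line R * B1)%type.

Let P' := extend_id Y P.
Let Q' := extend_id_inv Y P.
Let r' (a : line R) : R := if a \in Y then r a else 0.
Let nu := @completed_lebesgue_measure R.
Let X : set T := special_domain Y P r.
Let Phi : R -> T -> T := special_semiflow Y P r.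
Let ph := phase_space Y r.
Let c := (fine (lebesgue2 R ph))^-1.

Let mX : measurable (X : set T) := measurable_special_domain sf.

Let mXp : measurable (X : set (plane R)).
Proof. exact: plane_measurable mX. Qed.

Let phX : (lebesgue2 R).-negligible (ph `\` X).
Proof.
have [N [mN N0 H]] := special_domain_ae sf; exists N; split => // x [px nXx].
by apply: H => /(_ px).
Qed.

Let mph : measurable ph.
Proof.
have -> : ph = X `|` (ph `\` X).
  by rewrite setDUK//; exact: special_domain_phase_space.
by apply: measurableU => //; exact: lebesgue2_complete.
Qed.

Let lebesgue2_phase E : measurable E -> lebesgue2 R (ph `&` E) = lebesgue2 R (X `&` E).
Proof.
move=> mE; apply/eqP; rewrite eq_le; apply/andP; split; last first.
  apply: le_measure; rewrite ?inE//; try exact: measurableI.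
  by apply: setSI; exact: special_domain_phase_space.
have [N [mN N0 HN]] := phX.
apply: (@le_trans _ _ (lebesgue2 R ((X `&` E) `|` N))).
  apply: le_measure; rewrite ?inE//; first exact: measurableI.
    by apply: measurableU => //; exact: measurableI.
  move=> x [px Ex]; have [Xx|nXx] := pselect (X x); first by left.
  by right; apply: HN.
apply: (le_trans (measureU2 _ _ _)) => //; first exact: measurableI.
by rewrite [X in (_ + X)%E]N0 adde0.
Qed.

Let ph_fin : (lebesgue2 R ph < +oo)%E.
Proof.
(* For infinite area [fine] gives 0, whose inverse is 0, and [mu] would vanish. *)
rewrite ltey; apply/eqP => phoo; have := area measurableT.
rewrite probability_setT setIT -/ph phoo /= invr0 mule0 => /eqP.
by rewrite eqe oner_eq0.
Qed.

Let c_ge0 : 0 <= c. Proof. by rewrite invr_ge0 fine_ge0. Qed.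

(* Fubini's theorem along orbits needs (s, x) |-> Phi s x to be jointly
   measurable; it is so for the product T of the Lebesgue and the Borel
   sigma-algebras, since s is only added to the second coordinate of x, but not
   for the completed sigma-algebra of the plane. *)
Let i : plane R -> T := id.

Let measurable_i : measurable_fun setT i.
Proof. by move=> _ D mD; rewrite setTI; exact: plane_measurable. Qed.

Let i_mixin := isMeasurableFun.Build _ _ _ _ i measurable_i.
Let i_mfun : {mfun plane R >-> T} := MeasurableFun.Pack (MeasurableFun.Class i_mixin).

Let m : probability T R := distribution mu i_mfun.

Let mE (E : set T) : m E = mu E. Proof. by []. Qed.

Let m_area (E : set T) : measurable E -> m E = ((nu \x lam)%E (X `&` E) * c%:E)%E.
Proof.
move=> mEE; have mEp := plane_measurable mEE.
by rewrite mE area// -/ph lebesgue2_phase// -lebesgue2E//; exact: measurableI.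
Qed.

Let mu_null E : measurable E -> lebesgue2 R E = 0%E -> mu E = 0%E.
Proof.
move=> mEE E0; rewrite area//; suff -> : lebesgue2 R (phase_space Y r `&` E) = 0%E.
  by rewrite mul0e.
apply/eqP; rewrite eq_le measure_ge0 andbT -E0.
by apply: le_measure; rewrite ?inE//; exact: measurableI.
Qed.

(** Ergodicity of the flow tests all real times. For [t < 0] the flow leads to a point of [X] that
    the semiflow brings back to [x] after time [- t], so invariance under nonnegative times
    suffices; points off [X] never enter it. *)
Let exact_erg (B : set T) : B `<=` X -> measurable B ->
  (forall t : R, 0 <= t -> X `&` Phi t @^-1` B = B) -> m B = 0%E \/ m B = 1%E.
Proof.
move=> BX mB inv; suff: mu (B : set (plane R)) = 0%E \/ mu (B : set (plane R)) = 1%E by [].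
apply: erg.
- by move=> x /BX; exact: special_domain_phase_space.
- exact: plane_measurable.
move=> t; have [t0|t0] := leP 0 t.
  apply/seteqP; split => x.
    move=> [px Bx]; have [Xx|nXx] := pselect (X x).
      have Bx' : B (Phi t x) by move: Bx; rewrite /= (flow_semiflow sf t0 Xx).
      by rewrite -(inv t t0); split.
    by exfalso; exact: flow_out_special_domain px nXx (BX _ Bx).
  rewrite -{1}(inv t t0) => -[Xx Bx]; split; first exact: (special_domain_phase_space Xx).
  by rewrite /= (flow_semiflow sf t0 Xx).
have nt0 : 0 <= - t by rewrite oppr_ge0 ltW.
apply/seteqP; split => x.
  move=> [px Bx]; have [Xx|nXx] := pselect (X x); last first.
    by exfalso; exact: flow_out_special_domain px nXx (BX _ Bx).
  have [_ E] := backward_flow sf t0 Xx.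
  by move: Bx; rewrite /= -{1}(inv _ nt0) => -[_ /=]; rewrite /Phi E.
move=> Bx; have Xx := BX _ Bx; split; first exact: (special_domain_phase_space Xx).
have [Xy E] := backward_flow sf t0 Xx.
by rewrite /= -(inv _ nt0); split => //=; rewrite /Phi E.
Qed.

Variable f : plane R -> R.
Hypotheses (if_ : mu.-integrable ph (EFin \o f))
  (f0 : (\int[mu]_(x in ph) (f x)%:E = 0)%E).

Let mf : measurable_fun ph f.
Proof. by have /integrableP[/measurable_EFinP] := if_. Qed.

Let Borel_mod_null (E : set (plane R)) : E `<=` ph -> measurable E ->
  exists B N : set T, [/\ measurable B, measurable N, lebesgue2 R N = 0%E &
    E `\` N = B `\` N].
Proof.
move=> Eph mEE.
have Efin : (lebesgue2 R E < +oo)%E.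
  by apply: le_lt_trans ph_fin; apply: le_measure; rewrite ?inE.
have [B [N [mB mN N0 EB]]] := plane_Borel_approximation mEE Efin.
have mBT (C : set (B1 * B1)) : measurable C -> measurable (C : set T).
  suff : @measurable _ (B1 * B1)%type `<=` @measurable _ T by exact.
  apply: smallest_sub; first exact: sigma_algebra_measurable.
  move=> F [|] [D mD <-]; rewrite setTI.
    by rewrite -[X in measurable X]setTI; apply: measurable_fst => //; exact: line_measurable_Borel.
  by rewrite -[X in measurable X]setTI; exact: measurable_snd.
exists B, N; split => //; exact: mBT.
Qed.

Variable A : set (plane R).
Hypotheses (Aph : A `<=` ph) (mA : measurable A).

(** [f] is determined by its superlevel sets at rational heights; replacing each of them, and [A],
    by a Borel set costs countably many null sets, collected in [N]. *)
Let Borel_version : exists (N A1 : set T) (f1 : T -> R),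
  [/\ measurable N, lebesgue2 R N = 0%E, measurable A1, A1 `<=` A &
   [/\ A `&` X `\` N `<=` A1, measurable_fun setT f1 & forall x, X x -> ~ N x -> f1 x = f x]].
Proof.
pose E (q : rat) := ph `&` f @^-1` `]ratr q, +oo[.
have mE' q : measurable (E q) by exact: mf.
have /choice[BN HBN] q : exists BN : set T * set T, [/\ measurable BN.1,
    measurable BN.2, lebesgue2 R BN.2 = 0%E & E q `\` BN.2 = BN.1 `\` BN.2].
  have [B [N H]] : exists B N : set T, [/\ measurable B, measurable N, lebesgue2 R N = 0%E &
    E q `\` N = B `\` N] by apply: Borel_mod_null => //; exact: subIsetl.
  by exists (B, N).
have [BA [NA [mBA mNA NA0 ABA]]] := Borel_mod_null Aph mA.
pose qn (n : nat) : rat := odflt 0 (unpickle n).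
pose N : set T := NA `|` \bigcup_(n in [set: nat]) (BN (qn n)).2.
have mN : measurable N.
  by apply: measurableU => //; apply: bigcupT_measurable => n; have [] := HBN (qn n).
have mXN : measurable (X `\` N) by exact: measurableD.
exists N, ((BA `&` X) `\` N), (f \_ (X `\` N)); split => //.
- apply: measure_negligible; first exact: plane_measurable.
  have null (M : set T) : measurable M -> lebesgue2 R M = 0%E -> (lebesgue2 R).-negligible M.
    by move=> mM M0; apply/negligibleP => //; exact: plane_measurable.
  apply: negligibleU; first exact: null.
  by apply: negligible_bigcup => n; have [_ mM M0 _] := HBN (qn n); exact: null.
- by apply: measurableD => //; exact: measurableI.
- move=> x [[Bx Xx] nN]; have : (BA `\` NA) x by split => // NAx; apply: nN; left.
  by rewrite -ABA => -[].
split.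
- move=> x [[Ax Xx] nN]; split => //; split => //.
  have : (A `\` NA) x by split => // NAx; apply: nN; left.
  by rewrite ABA => -[].
- apply/(measurable_restrictT _ mXN).
  apply: (measurability _ (RGenOInfty.measurableE R)) => //.
  move=> _ [_ [a ->] <-].
  rewrite (_ : _ `&` _ = \bigcup_(q in [set: rat])
      (if a <= ratr q then (X `\` N) `&` (BN q).1 else set0)).
    apply: bigcupT_measurable_rat => q; case: ifP => // _.
    by apply: measurableI => //; have [] := HBN q.
  have BNE q x : X x -> ~ N x -> (BN q).1 x <-> ratr q < f x.
    move=> Xx nN; have [_ _ _ EB] := HBN q.
    have nNq : ~ (BN q).2 x by move=> H; apply: nN; right; exists (pickle q) => //; rewrite /qn pickleK.
    have px := special_domain_phase_space Xx; split.
      move=> Bx; have : ((BN q).1 `\` (BN q).2) x by split.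
      by rewrite -EB => -[[_ /=]]; rewrite in_itv/= andbT.
    move=> qf; have : (E q `\` (BN q).2) x.
      by split => //; split => //=; rewrite in_itv/= andbT.
    by rewrite EB => -[].
  apply/seteqP; split => x /=.
    rewrite in_itv/= andbT => -[[Xx nN] /rat_in_itvoo[q]].
    rewrite in_itv/= => /andP[aq qf]; exists q => //.
    by rewrite ltW//; split => //; apply/BNE.
  move=> [q _]; case: ifP => // aq [[Xx nN] /(BNE q x Xx nN) qf].
  by split => //; rewrite in_itv/= andbT; exact: le_lt_trans qf.
- by move=> x Xx nN; rewrite patchE mem_set.
Qed.

Let mY : measurable Y. Proof. by have [] := sf. Qed.
Let autP : automorphism Y P. Proof. by have [] := sf. Qed.
Let bijP : set_bij Y Y P. Proof. by have [] := autP. Qed.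
Let PK : cancel P' Q' := extend_idK bijP.
Let QK : cancel Q' P' := extend_id_invK bijP.
Let YP' a : Y (P' a) <-> Y a := extend_idY bijP a.

Let mP' : measurable_fun setT P'.
Proof. by have [_ mP _ _] := autP; exact: measurable_extend_id. Qed.

Let mQ' : measurable_fun setT Q'.
Proof. by have [_ _ mi _] := autP; exact: measurable_extend_id_inv. Qed.

Let nuP' B : measurable B -> nu (P' @^-1` B) = nu B.
Proof.
have [_ mP _ nuP] := autP.
exact: (@extend_id_mp _ _ _ nu Y P mY bijP mP nuP).
Qed.

Let r'_ge0 := roof_ge0 sf.
Let mr' := measurable_roof sf.

Let mPhi : measurable_fun setT (fun z : B1 * T => Phi z.1 z.2).
Proof. exact: measurable_suspension_flow mP' mQ' mr' r'_ge0 mY. Qed.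

Let Phi_mp (t : R) E : 0 <= t -> measurable E -> m (Phi t @^-1` E) = m E.
Proof.
exact: (suspension_flow_mp PK QK mP' mQ' nuP' mr' r'_ge0 mY YP' c_ge0 m_area).
Qed.

Let m_ae (Q : T -> Prop) : {ae m, forall x, Q x} -> {ae mu, forall x : plane R, Q x}.
Proof.
move=> [N [mN N0 HN]]; exists N; split => //; exact: plane_measurable.
Qed.

Let Phi_in (t : R) x : 0 <= t -> X x -> X (Phi t x).
Proof. exact: (suspension_flow_in PK QK r'_ge0 YP'). Qed.

(** The orbit spends no time in [N] up to [n], so replacing [f] by [f1] does not affect the
    integral. *)
Let sigmaE (N : set T) (f1 : T -> R) (x : T) (n : nat) (t : R) :
  measurable N -> measurable_fun setT f1 ->
  (forall x, X x -> ~ N x -> f1 x = f x) -> X x -> 0 <= t -> t <= n%:R ->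
  (\int[lam]_(s in `[0%R, n%:R]) (\1_N (Phi s x))%:E = 0)%E ->
  sigma Y P r f t x = time_integral Phi f1 t x.
Proof.
move=> mN mf1 f1E Xx t0 tn int0; rewrite /sigma t0 /time_integral.
have mI : measurable (`[0, n%:R]%classic : set B1) by [].
pose S : set B1 := [set s | N (Phi s x)].
have mS : measurable S.
  have -> : S = [set: B1] `&` (fun s => Phi s x) @^-1` N by rewrite setTI.
  suff mxPhi : measurable_fun [set: B1] (fun s => Phi s x) by exact: mxPhi.
  by apply: (measurableT_comp mPhi (g := fun s => (s, x))); exact: pair2_measurable.
have mZ : measurable (S `&` `[0, n%:R]%classic : set B1) by exact: measurableI.
apply: (Rintegral_lebesgue1_ae _ mZ) => //.
- rewrite -[RHS]int0 -[LHS](integral_indic lam mI mS).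
  by apply: eq_integral => s _; congr (_%:E); rewrite !indicE; congr (_ _)%:R.
- by apply: measurable_funTS; exact: measurable_orbit.
move=> s /=; rewrite in_itv/= => /andP[s0 st] nZ.
rewrite (flow_semiflow sf s0 Xx) f1E//; first exact: Phi_in.
by move=> Ns; apply: nZ; split => //=; rewrite in_itv/= s0 (le_trans st).
Qed.

Let mu_X : mu (~` X) = 0%E.
Proof.
rewrite area; last exact: measurableC.
rewrite (_ : lebesgue2 R _ = 0%E) ?mul0e//.
by rewrite [LHS](lebesgue2_phase (measurableC mXp)) setICr measure0.
Qed.

Section Borel_version_mean.
Variables (N : set T) (f1 : T -> R).
Hypotheses (mN : measurable N) (N0 : lebesgue2 R N = 0%E)
  (mf1 : measurable_fun setT f1) (f1E : forall x, X x -> ~ N x -> f1 x = f x).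

Let F : plane R -> \bar R := (EFin \o f) \_ ph.
Let F1 : plane R -> \bar R := fun x => (f1 x)%:E.

Let mF : measurable_fun setT F.
Proof. by apply/(measurable_restrictT _ mph); exact/measurable_EFinP. Qed.

Let mF1T : measurable_fun setT (fun x : T => (f1 x)%:E).
Proof. exact/measurable_EFinP. Qed.

Let mF1 : measurable_fun setT F1.
Proof. exact: (measurableT_comp mF1T measurable_i). Qed.

Let F_F1 : ae_eq mu setT F F1.
Proof.
have mNp := plane_measurable mN.
exists (N `|` ~` X); split.
- by apply: measurableU => //; exact: measurableC.
- apply: measure_negligible; first by apply: measurableU => //; exact: measurableC.
  apply: negligibleU; apply/negligibleP => //; [exact: mu_null|exact: measurableC].
move=> x /=; apply: contra_notP => /not_orP[nN /contrapT Xx] _.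
by rewrite /F /F1 patchE (mem_set (special_domain_phase_space Xx))/= f1E.
Qed.

Lemma Borel_version_integral : (\int[m]_x (f1 x)%:E = 0)%E.
Proof.
have H1 := (ae_eq_integral _ _ measurableT mF mF1 F_F1).
have H2 := mp_integral measurable_i (fun E _ => esym (mE E)) measurableT mF1T.
transitivity (\int[mu]_x F1 x)%E; first by rewrite -H2 preimage_setT.
by rewrite -H1 -f0 [RHS]integral_mkcond.
Qed.

Lemma Borel_version_integrable : m.-integrable setT (EFin \o f1).
Proof.
have mAF : measurable_fun setT (abse \o F) by exact: measurableT_comp.
have mAF1 : measurable_fun setT (abse \o F1) by exact: measurableT_comp.
have AF_F1 : ae_eq mu setT (abse \o F) (abse \o F1).
  by apply: filterS F_F1 => x /= H /H ->.
have mAF1T : measurable_fun setT (fun x : T => `|(f1 x)%:E|%E).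
  exact: (measurableT_comp _ mF1T).
have H1 := (ae_eq_integral _ _ measurableT mAF mAF1 AF_F1).
have H2 := mp_integral measurable_i (fun E _ => esym (mE E)) measurableT mAF1T.
rewrite preimage_setT in H2.
apply/integrableP; split; first exact: mF1T.
have /integrableP[_] := if_.
rewrite [X in (X < _)%E -> _]integral_mkcond [X in integral _ _ X](restrict_abse (EFin \o f) ph).
by move=> ?; rewrite -H2; apply: le_lt_trans; last eassumption; rewrite H1.
Qed.

End Borel_version_mean.

(** A point of [X] off [N] has [f1 x = f x] and lies in [A1] if it lies in [A]; its returns to [A1]
    under the semiflow are returns to [A] under the flow. *)
Lemma special_flow_recurrence : {ae mu, forall x, A x -> f x != 0 ->
  exists t : nat -> R,
    t k @[k --> \oo] --> +oo /\
    forall k, sigma Y P r f (t k) x = 0 /\ A (flow Y P r (t k) x)}.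
Proof.
have [N [A1 [f1 [mN N0 mA1 A1A [AA1 mf1 f1E]]]]] := Borel_version.
have mNp := plane_measurable mN.
have muN : mu N = 0%E by exact: mu_null.
have if1 := Borel_version_integrable mN N0 mf1 f1E.
have f10 := Borel_version_integral mN N0 mf1 f1E.
have Phi0 := @suspension_flow0 _ _ _ P' Q' r' Y r'_ge0.
have PhiD := @suspension_flowD _ _ _ P' Q' r' Y PK QK r'_ge0 YP'.
have Phi_reg := suspension_flow_reg PK QK mP' mQ' mr' r'_ge0 mY YP' m_area.
have Phi_erg := suspension_flow_erg PK QK mP' mQ' nuP' mr' r'_ge0 mY YP' c_ge0
  m_area exact_erg.
have ret := m_ae (semiflow_recurrence_ae Phi0 PhiD mPhi Phi_mp Phi_erg Phi_reg
  mf1 if1 f10 mA1).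
have null : {ae mu, forall x, forall n : nat,
    (\int[lam]_(s in `[0%R, n%:R]) (\1_N (Phi s x))%:E = 0)%E}.
  apply: ae_foralln => n; apply: m_ae; exact: (null_set_time_ae mPhi Phi_mp).
have XN : {ae mu, forall x, X x /\ ~ N x}.
  exists (N `|` ~` X); split.
  - by apply: measurableU => //; exact: measurableC.
  - apply: measure_negligible; first by apply: measurableU => //; exact: measurableC.
    apply: negligibleU; apply/negligibleP => //; exact: measurableC.
  - move=> x /=; apply: contra_notP => /not_orP[nN /contrapT Xx]; exact: conj.
have aeF := ae_filter_ringOfSetsType mu.
move: ret null XN; apply: filterS3 => x Hret Hnull [Xx nN] Ax fx.
have A1x : A1 x by apply: AA1.
have /choice[t Ht] n : exists t, [/\ n%:R <= t, time_integral Phi f1 t x = 0 & A1 (Phi t x)].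
  by apply: Hret => //; rewrite f1E.
have t0 k : 0 <= t k by have [kt _ _] := Ht k; exact: le_trans kt.
exists t; split.
  apply/cvgryPge => a; near=> k; have [kt _ _] := Ht k; apply: le_trans kt.
  by near: k; exact: nbhs_infty_ger.
move=> k; have [_ tk A1k] := Ht k; split; last first.
  by rewrite (flow_semiflow sf (t0 k) Xx); exact: A1A.
rewrite -tk (sigmaE mN mf1 f1E Xx (t0 k) _ (Hnull (Num.trunc (t k)).+1))//.
by rewrite ltW// truncnS_gt.
Unshelve. all: by end_near. Qed.

End special_flow_recurrence.

Theorem theoremA (R : realType)
    (Y : set (line R)) (P : line R -> line R) (r : line R -> R)
    (mu : probability (plane R) R)
    (f : plane R -> R) (A : set (plane R)) :
  special_flow Y P r ->
  normalized_area Y r mu ->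
  null_orbits Y P r mu ->
  ergodic Y P r mu ->
  mu.-integrable (phase_space Y r) (EFin \o f) ->
  (\int[mu]_(x in phase_space Y r) (f x)%:E = 0)%E ->
  A `<=` phase_space Y r ->
  measurable A ->
  (0 < mu A)%E ->
  {ae mu, forall x, A x -> f x != 0 ->
    exists t : nat -> R,
      t k @[k --> \oo] --> +oo /\
      forall k, sigma Y P r f (t k) x = 0 /\ A (flow Y P r (t k) x)}.
Proof.
move=> sf area _ erg if_ f0 Aph mA _.
exact: (special_flow_recurrence sf area erg if_ f0 Aph mA).
Qed.
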